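(* Let $E$ be any equivalence relation which is classifiable by countable structures. Then either $=^{+\omega}\le_B E$, or $=^{+\omega}$ is prime to $E$. Consequently $=^{+\omega}$ is regular.
   Context: Friedman–Stanley jumps: for an equivalence relation $E$ on $X$, $E^+$ on $X^{\mathbb N}$ is $x\mathrel{E^+}y\iff\{[x(i)]_E:i\in\mathbb N\}=\{[y(i)]_E:i\in\mathbb N\}$; $=^{+0}$ is equality on $\mathbb R$, $=^{+(n+1)}=(=^{+n})^+$, and $=^{+\omega}=\prod_{n<\omega}=^{+n}$ (coordinatewise equivalence on the product of the domains). For equivalence relations $E$ on $X$ and $F$ on $Y$: $E$ is prime to $F$ if for every Borel homomorphism $f\colon X\to Y$ from $E$ to $F$ (i.e. $x_1\mathrel Ex_2\Rightarrow f(x_1)\mathrel Ff(x_2)$) there is $y\in Y$ with $E\le_B E\restriction\{x\in X:f(x)\mathrel Fy\}$. A Borel equivalence relation $E$ is regular if $E$ is prime to every Borel equivalence relation $F$ with $F<_B E$ (i.e. $F\le_B E$ and $E\not\le_B F$). Classifiable by countable structures: Borel reducible to isomorphism of countable $\mathcal L$-structures for some countable language $\mathcal L$. *)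

(* Defs.v *)
From HB Require Import structures.
From Stdlib Require Import Rdefinitions Rbasic_fun.
From mathcomp Require Import all_boot.
From mathcomp Require Import classical_sets boolp measurable_structure.


Local Open Scope classical_set_scope.

Record bspace := BSpace { carrier :> Type ; meas : set (set carrier) }.
Arguments meas : clear implicits.
Arguments BSpace : clear implicits.

Definition borel_map {X Y : bspace} (f : X -> Y) : Prop :=
  forall B, meas Y B -> meas X (f @^-1` B).

Definition prod_meas (X Y : bspace) : set (set (X * Y)) :=
  <<s [set C | exists A B, meas X A /\ meas Y B /\ C = A `*` B] >>.

Definition borel_rel {X : bspace} (E : X -> X -> Prop) : Prop :=
  prod_meas X X [set p | E p.1 p.2].

Definition equivalence {X : Type} (E : X -> X -> Prop) : Prop :=
  (forall x, E x x) /\ (forall x y, E x y -> E y x) /\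
  (forall x y z, E x y -> E y z -> E x z).

Definition is_metric {T : Type} (d : T -> T -> R) : Prop :=
  (forall x y, Rle R0 (d x y)) /\ (forall x y, d x y = R0 <-> x = y) /\
  (forall x y, d x y = d y x) /\
  (forall x y z, Rle (d x z) (Rplus (d x y) (d y z))).

Definition metric_open {T : Type} (d : T -> T -> R) : set (set T) :=
  [set U | forall x, U x -> exists e, Rlt R0 e /\ (forall y, Rlt (d x y) e -> U y)].

Definition metric_complete {T : Type} (d : T -> T -> R) : Prop :=
  forall s : nat -> T,
    (forall e, Rlt R0 e -> exists N, forall m n, (N <= m)%N -> (N <= n)%N ->
        Rlt (d (s m) (s n)) e) ->
    exists x, forall e, Rlt R0 e -> exists N, forall n, (N <= n)%N -> Rlt (d (s n) x) e.

Definition metric_separable {T : Type} (d : T -> T -> R) : Prop :=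
  exists D : nat -> T, forall x e, Rlt R0 e -> exists n, Rlt (d x (D n)) e.

Definition standard_borel (X : bspace) : Prop :=
  exists d : X -> X -> R,
    [/\ is_metric d, metric_complete d, metric_separable d &
        forall A, meas X A <-> <<s metric_open d >> A].

Definition borel_reducible {X Y : bspace} (E : X -> X -> Prop) (F : Y -> Y -> Prop)
  : Prop :=
  exists f : X -> Y, borel_map f /\ forall x1 x2, E x1 x2 <-> F (f x1) (f x2).

Definition borel_homomorphism {X Y : bspace} (E : X -> X -> Prop)
  (F : Y -> Y -> Prop) (f : X -> Y) : Prop :=
  borel_map f /\ forall x1 x2, E x1 x2 -> F (f x1) (f x2).

Definition reducible_to_restriction {X : bspace} (E : X -> X -> Prop) (A : set X)
  : Prop :=
  exists g : X -> X, borel_map g /\ (forall x, A (g x)) /\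
    forall x1 x2, E x1 x2 <-> E (g x1) (g x2).

Definition prime_to {X Y : bspace} (E : X -> X -> Prop) (F : Y -> Y -> Prop)
  : Prop :=
  forall f : X -> Y, borel_homomorphism E F f ->
    exists y : Y, reducible_to_restriction E [set x | F (f x) y].

Definition regular {X : bspace} (E : X -> X -> Prop) : Prop :=
  [/\ standard_borel X, equivalence E, borel_rel E &
    forall (Y : bspace) (F : Y -> Y -> Prop),
      standard_borel Y -> equivalence F -> borel_rel F ->
      borel_reducible F E -> ~ borel_reducible E F -> prime_to E F].

Definition real_space : bspace := BSpace R <<s metric_open (fun x y : R => Rabs (Rminus x y)) >>.

Definition seq_space (X : bspace) : bspace :=
  BSpace (nat -> X)
    <<s [set C | exists i A, meas X A /\ C = [set x | A (x i)]] >>.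

Definition jump {X : Type} (E : X -> X -> Prop) (x y : nat -> X) : Prop :=
  (forall i, exists j, E (x i) (y j)) /\ (forall j, exists i, E (x i) (y j)).

Fixpoint dom (n : nat) : bspace :=
  match n with 0 => real_space | S m => seq_space (dom m) end.

Fixpoint eq_jump (n : nat) : dom n -> dom n -> Prop :=
  match n return dom n -> dom n -> Prop with
  | 0 => fun x y => x = y
  | S m => @jump (dom m) (eq_jump m)
  end.

Definition dom_omega : bspace :=
  BSpace (forall n, dom n)
    <<s [set C | exists n A, meas (dom n) A /\ C = [set x | A (x n)]] >>.

Definition eq_omega (x y : dom_omega) : Prop := forall n, eq_jump n (x n) (y n).

Definition mod_space (I : countType) (ar : I -> nat) : bspace :=
  BSpace (forall i : I, (ar i).-tuple nat -> bool)
    <<s [set C | exists i t, C = [set x : forall i : I, (ar i).-tuple nat -> bool | x i t = true]] >>.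

Definition iso_rel {I : countType} (ar : I -> nat)
  (x y : mod_space I ar) : Prop :=
  exists pi : nat -> nat, bijective pi /\
    forall i (t : (ar i).-tuple nat), x i t = y i (map_tuple pi t).

Definition classifiable_by_countable_structures {X : bspace} (E : X -> X -> Prop)
  : Prop :=
  exists (I : countType) (ar : I -> nat), borel_reducible E (iso_rel ar).

(* Main.v *)
(* Both isomorphism of countable structures and [eq_omega] are bisimilarity of Borel families of
   labelled trees [T], so let [f] be a Borel homomorphism from [eq_omega] to such a relation. Points
   of the Cantor space of towers of levels (level [l.+1] is a family of subsets of level [l]) code
   elements of [dom_omega], and [F x := T (f (code x))] is continuous on a comeager set.

   Fix [k]. Consider the real-valued invariants of states of [F x] that are continuous in [x] and only
   depend on the levels below [k] and on the bisimilarity type of the state. Among them is one that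
   separates generic pairs of states as well as all of them do. If all invariants are locally functions
   of the levels below [k], equality of this one is a bisimulation; then the class of [f] is constant
   on a set of generic towers with a fixed generic part [z] below [k], and stacking on [z] a tower
   built from a given element of [dom_omega] reduces [eq_omega] to a fibre of [f].

   Otherwise, for every [k], some invariant of some state depends on level [k]. Enumerating one tower
   generically in two ways shows that it depends on finitely many rows of level [k] only, for else the
   two enumerations could be made to diverge; by minimality some row matters everywhere below a
   condition. To [x] in [dom_omega] attach the tower [coding x], whose objects at level [l] are finite
   tuples of hereditary elements of [x] with tags describing memberships by finite tables. It has the
   extension property of a generic tower, its level 1 consists of mutually generic reals, and its
   objects are determined by [x] up to [eq_omega]. If [x] and [y] first differ at level [k], put an
   object that occurs in only one of the towers in the row that matters, and build generic enumerations
   of both towers that agree below [k] and make the invariants diverge. Hence [f \o code \o coding] is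
   a reduction of [eq_omega]. *)

Require Import Defs.
From HB Require Import structures.
From Stdlib Require Import Reals Lra Eqdep_dec.
From mathcomp Require Import all_boot classical_sets boolp measurable_structure.
From mathcomp Require Import zify.
Set Implicit Arguments.
Unset Strict Implicit.
Unset Printing Implicit Defensive.
Local Open Scope classical_set_scope.

(** A reduction must be Borel, so the tower of [x] cannot be picked by a category argument: it is
    written down from [x] alone, before its generic enumerations are made. Above level 1 this works
    because a condition constrains finitely many memberships, and a fresh object can carry these in
    its tag. An object of level 1, however, is an infinite row of bits over the named objects of
    level 0, and no later enumeration can alter it. So these rows come from a family of mutually
    generic reals, built once for all [k] against the countably many requirements that finite stages
    of an enumeration can pose. The obstacle to divergence is that two enumerations with equal
    levels below [k] also have equal rows at every object of level [k.+1] that occurs in both. A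
    change that separates two values must leave these shared rows alone. Either no finite set of
    rows supports the value, and then some change avoids them, or the row that matters is reserved
    ([bad]) for an object missing on the other side. The [k] used for [x] and [y] is the least
    dimension, in jumps above the reals, of a base object that only one of them has. *)

Lemma dependent_sequence (T : Type) (Inv : T -> Prop) (P : nat -> T -> T -> Prop) (t0 : T) :
  Inv t0 -> (forall n t, Inv t -> exists t', Inv t' /\ P n t t') ->
  exists s : nat -> T, s 0 = t0 /\ forall n, Inv (s n) /\ P n (s n) (s n.+1).
Proof.
move=> I0 H.
have H' (p : nat * T) : exists t', Inv p.2 -> Inv t' /\ P p.1 p.2 t'.
  case: p => n t /=; have [it|nit] := pselect (Inv t).
    by have [t' ?] := H n t it; exists t'.
  by exists t0.
have [f Hf] := choice H'.
pose s := fix s n := if n is m.+1 then f (m, s m) else t0.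
exists s; split=> //.
have Is n : Inv (s n) by elim: n => //= n IH; case: (Hf (n, s n) IH).
by move=> n; split=> //; case: (Hf (n, s n) (Is n)).
Qed.

(** * Baire category in Cantor spaces *)

Definition agree (I : eqType) (A : seq I) (x y : I -> bool) := forall i, i \in A -> x i = y i.

Definition is_open (I : eqType) (D : set (I -> bool)) :=
  forall x, D x -> exists A, forall y, agree A x y -> D y.

Definition is_dense (I : eqType) (D : set (I -> bool)) :=
  forall x A, exists y, agree A x y /\ D y.

Definition comeager (I : eqType) (S : set (I -> bool)) :=
  exists D : nat -> set (I -> bool),
    (forall n, is_open (D n) /\ is_dense (D n)) /\ (forall x, (forall n, D n x) -> S x).

Lemma agree_sym (I : eqType) A (x y : I -> bool) : agree A x y -> agree A y x.
Proof. by move=> H i /H ->. Qed.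
Lemma agree_trans (I : eqType) A (x y z : I -> bool) : agree A x y -> agree A y z -> agree A x z.
Proof. by move=> H H' i iA; rewrite H // H'. Qed.
Lemma agree_cat (I : eqType) A B (x y : I -> bool) :
  agree (A ++ B) x y <-> agree A x y /\ agree B x y.
Proof.
split=> [H|[HA HB] i]; first by split=> i iA; apply: H; rewrite mem_cat iA ?orbT.
by rewrite mem_cat => /orP[/HA|/HB].
Qed.

Lemma comeager_sub (I : eqType) (S S' : set (I -> bool)) :
  comeager S -> (forall x, S x -> S' x) -> comeager S'.
Proof. by move=> [D [oD DS]] H; exists D; split=> // x /DS /H. Qed.

Lemma comeager_all (I : eqType) (S : set (I -> bool)) : (forall x, S x) -> comeager S.
Proof. by move=> H; exists (fun=> setT); split=> // n; split=> [x _|x A]; [exists [::]|exists x]. Qed.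

Lemma open_dense_comeager (I : eqType) (D : set (I -> bool)) :
  is_open D -> is_dense D -> comeager D.
Proof. by move=> ? ?; exists (fun=> D); split=> // x /(_ 0). Qed.

Lemma comeager_bigcap (I : eqType) (J : countType) (S : J -> set (I -> bool)) :
  (forall j, comeager (S j)) -> comeager (fun x => forall j, S j x).
Proof.
move=> /choice[D HD].
exists (fun n => if unpickle n is Some (j, m) then D j m else setT); split.
  move=> n; case: unpickle => [[j m]|]; first by case: (HD j).
  by split=> [x _|x A]; [exists [::]|exists x].
move=> x Hx j; have [_] := HD j; apply=> m.
by have := Hx (pickle (j, m)); rewrite pickleK.
Qed.

Lemma comeagerI (I : eqType) (S S' : set (I -> bool)) :
  comeager S -> comeager S' -> comeager (fun x => S x /\ S' x).
Proof.
move=> HS HS'; apply: (@comeager_sub _ (fun x => forall b : bool, (if b then S else S') x)).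
  by apply: comeager_bigcap; case.
by move=> x H; split; [exact: (H true)|exact: (H false)].
Qed.

Theorem baire (I : countType) (S : set (I -> bool)) : comeager S ->
  is_dense S.
Proof.
move=> [D [oD DS]] x0 A0.
pose P n (p q : (I -> bool) * seq I) := [/\ agree p.2 p.1 q.1, {subset p.2 <= q.2},
  (forall i, unpickle n = Some i -> i \in q.2) & forall y, agree q.2 q.1 y -> D n y].
have [|n [x A] _|s [s0 Hs]] := @dependent_sequence _ (fun=> True) P (x0, A0).
- by [].
- have [oDn dDn] := oD n; have [y [xy Dy]] := dDn x A; have [B HB] := oDn y Dy.
  exists (y, (if unpickle n is Some i then [:: i] else [::]) ++ A ++ B); split=> //; split=> //=.
  + by move=> i iA; rewrite !mem_cat iA orbT.
  + by move=> i ->; rewrite inE eqxx.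
  + by move=> z /agree_cat[_ /agree_cat[_ /HB]].
have sub m n : {subset (s m).2 <= (s (n + m)).2}.
  elim: n => //= n IH i /IH; rewrite addSn.
  by have [_ [_ h _ _]] := Hs (n + m); exact: h.
have agr m n : agree (s m).2 (s m).1 (s (n + m)).1.
  elim: n => //= n IH i im; rewrite IH // addSn.
  by have [_ [h _ _ _]] := Hs (n + m); apply: h; apply: sub.
pose x i := (s (pickle i).+1).1 i.
have Hx n : agree (s n).2 (s n).1 x.
  move=> i iA; rewrite (agr n (pickle i).+1 i iA) /x addnC.
  apply/esym/agr; have [_ [_ _ h _]] := Hs (pickle i); apply: h; exact: pickleK.
exists x; split; first by have := Hx 0; rewrite s0.
by apply: DS => n; have [_ [_ _ _ h]] := Hs n; apply/h/Hx.
Qed.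

(** A requirement on [u \o h] is met by changing [u] on the range of [h] only; injectivity makes the
    bits read through [h] independent. *)
Lemma comeager_pullback (I J : eqType) (h : I -> J) (S : set (I -> bool)) :
  injective h -> comeager S -> comeager (fun u : J -> bool => S (u \o h)).
Proof.
move=> hi [D [oD DS]]; exists (fun n u => D n (u \o h)); split; last by move=> u /DS.
move=> n; have [oDn dDn] := oD n; split.
  move=> u /oDn[A HA]; exists (map h A) => v uv; apply: HA => i iA; apply: uv.
  exact: map_f.
move=> u A.
(* only finitely many coordinates of [A] lie in the range of [h] *)
have [B HB] : exists B : seq I, forall i, h i \in A -> i \in B.
  elim: A => [|a A [B HB]]; first by exists [::].
  have [[i hia]|na] := pselect (exists i, h i = a).
    exists (i :: B) => j; rewrite !inE => /orP[/eqP e|/HB ->]; rewrite ?orbT //.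
    by rewrite -hia in e; rewrite (hi _ _ e) eqxx.
  by exists B => i; rewrite inE => /orP[/eqP e|/HB //]; case: na; exists i.
have [y [uy Dy]] := dDn (u \o h) B.
pose v j := if pselect (exists i, h i = j) is left p then y (projT1 (cid p)) else u j.
have vh : v \o h = y.
  apply/funext => i /=; rewrite /v; case: pselect => [p|[]]; last by exists i.
  by case: cid => j /= /hi ->.
exists v; split; last by rewrite vh.
move=> j jA; rewrite /v; case: pselect => // p.
by case: cid => i /= ij; rewrite -ij -uy //; apply: HB; rewrite ij.
Qed.

Definition holds (I : eqType) (c : seq (I * bool)) (x : I -> bool) := all (fun e => x e.1 == e.2) c.

Definition cond_of (I : eqType) (A : seq I) (x : I -> bool) := [seq (i, x i) | i <- A].

Lemma holds_cond_of (I : eqType) A (x y : I -> bool) : holds (cond_of A x) y <-> agree A x y.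
Proof.
rewrite /holds /cond_of all_map; split=> [/allP H i /H /= /eqP //|H].
by apply/allP => i /H /= ->.
Qed.

Lemma holds_agree (I : eqType) (c : seq (I * bool)) (x y : I -> bool) :
  agree (map fst c) x y -> holds c x -> holds c y.
Proof.
move=> H /allP hc; apply/allP => e ec; rewrite -H ?hc //; exact: map_f.
Qed.

(** Since [g] may rename coordinates, this covers both replacing the levels from [k] on and shifting
    a whole tower above level [k]. *)
Definition mix (I J : Type) (g : I -> option J) (x : I -> bool) (y : J -> bool) i :=
  if g i is Some j then y j else x i.

(** For each condition [c] on [y] and each [n], the points [x] for which some [y] in [c] puts
    [mix g x y] into [D n] form an open dense set; an [x] in all these countably many sets has a
    comeager section. *)
Theorem kuratowski_ulam (I : eqType) (J : countType) (g : I -> option J) (S : set (I -> bool)) :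
  (forall i i' j, g i = Some j -> g i' = Some j -> i = i') ->
  comeager S -> comeager (fun x => comeager (fun y => S (mix g x y))).
Proof.
move=> gi [D [oD DS]].
have key n (c : seq (J * bool)) : comeager (fun x => (exists y, holds c y) ->
    exists y, holds c y /\ D n (mix g x y)).
  have [[y0 cy0]|nc] := pselect (exists y, holds c y); last first.
    exact: comeager_all.
  have [oDn dDn] := oD n.
  apply: (@comeager_sub _ (fun x => exists y, holds c y /\ D n (mix g x y))) => //.
  apply: open_dense_comeager.
    move=> x [y [cy Dxy]]; have [A HA] := oDn _ Dxy.
    exists A => x' xx'; exists y; split=> //; apply: HA => i iA.
    by rewrite /mix xx'.
  move=> x A.
  (* [h] inverts [g], turning the condition on [y] into one on the merged point. *)
  have [h Hh] : exists h : J -> option I, forall i j, h j = Some i <-> g i = Some j.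
    have H j : exists o : option I, forall i, o = Some i <-> g i = Some j.
      have [[i0 E0]|n0] := pselect (exists i, g i = Some j).
        by exists (Some i0) => i; split=> [[<-] //|/gi/(_ E0) ->].
      by exists None => i; split=> // E; case: n0; exists i.
    by have [h Hh] := choice H; exists h => i j; exact: Hh.
  have [w [xw Dw]] := dDn (mix g x y0) (A ++ pmap h (map fst c)).
  move/agree_cat: xw => [xwA xwB].
  pose y j := if h j is Some i then w i else y0 j.
  have yw x' : (forall i, g i = None -> x' i = w i) -> mix g x' y = w.
    move=> x'w; apply/funext => i; rewrite /mix /y; case E: (g i) => [j|]; last exact: x'w.
    by rewrite ((Hh i j).2 E).
  exists (fun i => if g i is Some _ then x i else w i); split.
    by move=> i iA; case E: (g i) => //; rewrite -(xwA i iA) /mix E.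
  exists y; split; last by rewrite yw // => i ->.
  move/allP: cy0 => cy0; apply/allP => e ec; rewrite -(eqP (cy0 e ec)); apply/eqP.
  rewrite /y; case E: (h e.1) => [i|//].
  rewrite -xwB ?/mix ?((Hh _ _).1 E) // mem_pmap -E; exact/map_f/map_f.
apply: (@comeager_sub _ (fun x => forall nc : nat * seq (J * bool), (exists y, holds nc.2 y) ->
    exists y, holds nc.2 y /\ D nc.1 (mix g x y))).
  by apply: comeager_bigcap => -[n c]; exact: key.
move=> x Hx; exists (fun n y => D n (mix g x y)); split; last by move=> y /DS.
move=> n; split.
  move=> y /(proj1 (oD n))[A HA]; exists (pmap g A) => y' yy'; apply: HA => i iA.
  rewrite /mix; case E: (g i) => [j|//]; apply: yy'; rewrite mem_pmap -E; exact: map_f.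
move=> y A; have [|y' [/holds_cond_of h Dy']] := Hx (n, cond_of A y); last by exists y'.
by exists y; apply/holds_cond_of.
Qed.

(** A form of the Baire property: the conditions in which [S] or its complement is comeager are
    dense. *)
Definition decided (I : eqType) (S : set (I -> bool)) :=
  forall x A, exists y B, agree A x y /\
    (comeager (fun z => agree B y z -> S z) \/ comeager (fun z => agree B y z -> ~ S z)).

Definition locally_constant (I : eqType) (C S : set (I -> bool)) :=
  forall x, C x -> exists A, forall y, C y -> agree A x y -> (S y <-> S x).

(** [C] consists of the points that satisfy some deciding condition and obey every deciding
    condition they satisfy; there are countably many conditions. *)
Lemma decided_locally_constant (I : countType) (S : set (I -> bool)) : decided S ->
  exists C, comeager C /\ locally_constant C S.
Proof.
move=> dS.
pose good (c : seq (I * bool)) b := comeager (fun z => holds c z -> if b then S z else ~ S z).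
pose K : set (I -> bool) := fun z => exists c b, holds c z /\ good c b.
pose C : set (I -> bool) := fun z => K z /\
  forall cb : seq (I * bool) * bool, good cb.1 cb.2 -> holds cb.1 z -> if cb.2 then S z else ~ S z.
exists C; split.
  apply: comeagerI.
    apply: open_dense_comeager.
      move=> z [c [b [cz gc]]]; exists (map fst c) => y zy; exists c, b; split=> //.
      exact: holds_agree zy cz.
    move=> x A; have [y [B [xy H]]] := dS x A.
    have [b gb] : exists b, good (cond_of (A ++ B) y) b.
      case: H => H; [exists true|exists false]; rewrite /good; refine (comeager_sub H _) => z /= Hz
        /holds_cond_of /agree_cat[_] zB; exact: Hz zB.
    exists y; split=> //.
    by exists (cond_of (A ++ B) y), b; split=> //; exact/holds_cond_of.
  apply: comeager_bigcap => -[c b] /=.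
  have [gc|ngc] := pselect (good c b); first by move: gc => /[dup] gc /comeager_sub; apply => z h _.
  exact: comeager_all.
move=> x [[c [b [cx gc]]] Hx]; exists (map fst c) => y [_ Hy] xy.
have cy := holds_agree xy cx.
have := Hx (c, b) gc cx; have := Hy (c, b) gc cy => /=.
by case: (b).
Qed.

(** If no stronger condition forces a single [S j], then generically no [S j] holds at all: a
    generic point of [S j] has a neighbourhood that forces it. *)
Lemma decided_bigcup (I : countType) (J : countType) (S : J -> set (I -> bool)) :
  (forall j, decided (S j)) -> decided (fun x => exists j, S j x).
Proof.
move=> dS x A.
have [[y [B [j [xy H]]]]|nH] := pselect (exists y B j, agree A x y /\
    comeager (fun z => agree B y z -> S j z)).
  exists y, B; split=> //; left; refine (comeager_sub H _) => z Hz /Hz ?; by exists j.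
exists x, A; split=> //; right.
suff H j : comeager (fun z => agree A x z -> ~ S j z).
  by refine (comeager_sub (comeager_bigcap H) _) => z Hz Az [j Sj]; exact: (Hz j).
have [C [cC lC]] := decided_locally_constant (dS j).
refine (comeager_sub cC _) => z Cz xz Sz.
have [B HB] := lC z Cz.
apply: nH; exists z, B, j; split=> //; refine (comeager_sub cC _) => w Cw zw.
exact/(HB w Cw zw).
Qed.

(** * Trees and bisimilarity *)

(** Points that share bits can be generic simultaneously: all are read off a single generic [v], and
    they share the bits at which the injections [h a] coincide. *)
Lemma generic_family (I : eqType) (I' J : countType) (h : J -> I -> I') (C : set (I -> bool))
    (u : I' -> bool) (A : seq I') :
  (forall a, injective (h a)) -> comeager C ->
  exists v, agree A u v /\ forall a, C (v \o h a).
Proof.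
move=> hi cC; apply: (@baire _ (fun v => forall a, C (v \o h a))).
by apply: comeager_bigcap => a; apply: comeager_pullback.
Qed.

Definition tree := seq nat -> nat -> bool.

Definition bisimulation (T T' : tree) (R : seq nat -> seq nat -> Prop) :=
  forall s t, R s t -> [/\ T s = T' t,
    forall i, exists j, R (rcons s i) (rcons t j) &
    forall j, exists i, R (rcons s i) (rcons t j)].

Definition bisimilar_at (T T' : tree) (s t : seq nat) :=
  exists R, bisimulation T T' R /\ R s t.

Definition bisimilar (T T' : tree) := bisimilar_at T T' [::] [::].

Lemma bisimilar_at_label T T' s t : bisimilar_at T T' s t -> T s = T' t.
Proof. by move=> [R [bR /bR[]]]. Qed.

Lemma bisimilar_at_step T T' s t i : bisimilar_at T T' s t ->
  exists j, bisimilar_at T T' (rcons s i) (rcons t j).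
Proof. by move=> [R [bR Rst]]; have [_ /(_ i)[j Rj] _] := bR _ _ Rst; exists j, R. Qed.

Lemma bisimilar_at_sym T T' s t : bisimilar_at T T' s t -> bisimilar_at T' T t s.
Proof.
move=> [R [bR Rst]]; exists (fun s t => R t s); split=> // s' t' Rts.
by have [e a b] := bR _ _ Rts.
Qed.

Lemma bisimilar_at_state T T' s : bisimilar T T' -> exists t, bisimilar_at T T' s t.
Proof.
move=> H; elim/last_ind: s => [|s i [t Ht]]; first by exists [::].
by have [j Hj] := bisimilar_at_step i Ht; exists (rcons t j).
Qed.

(* A configuration [x] is a tower of levels indexed by [nat]: [x (l, j, i)] says that object [i] of
   level [l] is a member of object [j] of level [l.+1]. The objects of level 0 are named by their
   indices, those of higher levels are only given by their members. *)
Definition coord : countType := (nat * nat * nat)%type.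
Definition config := coord -> bool.

(** * Configurations with equal lower levels, and names of states *)

Definition low (k : nat) (x y : config) := forall c : coord, c.1.1 < k -> x c = y c.

Lemma low_refl k x : low k x x. Proof. by []. Qed.
Lemma low_sym k x y : low k x y -> low k y x. Proof. by move=> H c /H ->. Qed.
Lemma low_trans k x y z : low k x y -> low k y z -> low k x z.
Proof. by move=> H H' c ck; rewrite H // H'. Qed.

(** Bits below level [k] carry the mark [true] for both points and are thus shared; from [k] on each
    point has its own copy. *)
Lemma generic_pair k (C : set config) x y A : comeager C -> low k x y ->
  exists x' y', [/\ C x', C y', low k x' y', agree A x x' & agree A y y'].
Proof.
move=> cC xy.
pose h (b : bool) (c : coord) := (b || (c.1.1 < k), c).
pose u (e : bool * coord) := if e.1 then x e.2 else y e.2.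
have hi b : injective (h b) by move=> c c' [].
have [v [/agree_cat[uv uv'] Cv]] := generic_family u (map (h true) A ++ map (h false) A) hi cC.
exists (v \o h true), (v \o h false); split=> //.
- by move=> c ck; rewrite /h /= ck.
- by move=> c cA; rewrite /= -uv ?map_f.
- move=> c cA; rewrite /= -uv' ?map_f // /u /=.
  by case: ifP => // /xy ->.
Qed.

(* A name assigns to a state of the tree [F x] a real that depends continuously on [x], and only
   on the levels of [x] below [k] and on the bisimilarity type of the state. *)
Definition name k (F : config -> tree) (C : set config) (b : config -> tree) :=
  [/\ comeager C,
      forall x s m, C x -> exists A, forall y, C y -> agree A x y -> b y s m = b x s m &
      forall x y s t, C x -> C y -> low k x y -> bisimilar_at (F x) (F y) s t -> b x s = b y t].

(** A forcing relation between pairs of a condition and a state. There are countably many such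
    pairs, so one name can do the work of all. *)
Definition same_value k (C : set config) (b : config -> tree) (e : seq (coord * bool) * seq nat)
    (e' : seq (coord * bool) * seq nat) :=
  forall x y, C x -> C y -> holds e.1 x -> holds e'.1 y -> low k x y -> b x e.2 = b y e'.2.

(** A difference at one bit persists near [x] and [y] by continuity, and there one finds pairs in
    any comeager set that still agree below [k]. *)
Lemma same_value_restrict k F C b (C' : set config) e e' : name k F C b -> comeager C' ->
  (forall x y, C x -> C y -> C' x -> C' y -> holds e.1 x -> holds e'.1 y -> low k x y ->
    b x e.2 = b y e'.2) -> same_value k C b e e'.
Proof.
move=> [cC con _] cC' H x y Cx Cy ex ey xy; apply/funext => m.
have [A HA] := con x e.2 m Cx; have [B HB] := con y e'.2 m Cy.
have [x' [y' [[Cx' C'x'] [Cy' C'y'] xy' xx' yy']]] :=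
  generic_pair (A ++ B ++ map fst e.1 ++ map fst e'.1) (comeagerI cC cC') xy.
move: xx' yy' => /agree_cat[xA /agree_cat[_ /agree_cat[xe _]]].
move=> /agree_cat[_ /agree_cat[yB /agree_cat[_ ye]]].
rewrite -(HA x') // -(HB y') // (H x' y') //; [exact: holds_agree xe ex|exact: holds_agree ye ey].
Qed.

(** Whenever some name refutes [same_value] for [e] and [e'], one such name is chosen; [b]
    interleaves these countably many choices and so refutes whatever any name refutes. *)
Lemma minimal_name k F : (exists C b, name k F C b) ->
  exists C b, name k F C b /\ forall C' b' e e', name k F C' b' ->
    same_value k C b e e' -> same_value k C' b' e e'.
Proof.
move=> [C0 [b0 n0]].
pose T := ((seq (coord * bool) * seq nat) * (seq (coord * bool) * seq nat))%type.
have /choice[W HW] (t : T) : exists Cb : set config * (config -> tree),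
    name k F Cb.1 Cb.2 /\ (same_value k Cb.1 Cb.2 t.1 t.2 ->
      forall C' b', name k F C' b' -> same_value k C' b' t.1 t.2).
  have [[[C b] [nb nsv]]|H] := pselect (exists Cb : set config * (config -> tree),
      name k F Cb.1 Cb.2 /\ ~ same_value k Cb.1 Cb.2 t.1 t.2); first by exists (C, b).
  exists (C0, b0); split=> // _ C' b' n'; apply: contrapT => nsv.
  by apply: H; exists (C', b').
pose C : set config := fun x => forall t, (W t).1 x.
pose b (x : config) s m := if unpickle m is Some (t, m') then (W t).2 x s m' else false.
have cC : comeager C by apply: comeager_bigcap => t; have [[]] := HW t.
exists C, b; split.
  split=> //.
    move=> x s m Cx; rewrite /b; case: unpickle => [[t m']|]; last by exists [::].
    have [[_ con _] _] := HW t; have [A HA] := con x s m' (Cx t).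
    by exists A => y Cy; apply: HA; apply: Cy.
  move=> x y s t Cx Cy xy bis; apply/funext => m; rewrite /b; case: unpickle => [[u m']|] //.
  by have [[_ _ inv] _] := HW u; rewrite (inv x y s t).
move=> C' b' e e' n' sv; have [nW] := HW (e, e'); apply=> //=.
apply: (same_value_restrict nW cC) => x y _ _ Cx Cy ex ey xy; apply/funext => m.
by have := congr1 (fun f => f (pickle ((e, e'), m))) (sv x y Cx Cy ex ey xy); rewrite /b pickleK.
Qed.

(** Kuratowski-Ulam over the levels below [k]: for generic [x], the points of [C] are dense among
    those with the same lower levels. *)
Lemma comeager_low k (C : set config) : comeager C ->
  comeager (fun x => forall c, (exists y, low k x y /\ holds c y) ->
    exists y, [/\ C y, low k x y & holds c y]).
Proof.
move=> cC; pose g (c : coord) := if c.1.1 < k then None else Some c.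
have gi i i' j : g i = Some j -> g i' = Some j -> i = i'.
  by rewrite /g; case: ifP => // _ [->]; case: ifP => // _ [->].
have lm x y : low k x (mix g x y) by move=> c ck; rewrite /mix /g ck.
have ml x y : low k x y -> mix g x y = y.
  by move=> xy; apply/funext => c; rewrite /mix /g; case: ifP => // /xy.
refine (comeager_sub (kuratowski_ulam gi cC) _) => x cx c [y [xy cy]].
have [y' [yy' Cy']] := baire cx y (map fst c).
exists (mix g x y'); split=> //; apply: holds_agree cy => i ic.
rewrite /mix; case E: (g i) => [j|]; move: E; rewrite /g; case: ifP => // ik.
  by case=> <-; exact: yy'.
by rewrite xy.
Qed.

(** If the first alternative fails, equality of the minimal name is a bisimulation for the following
    reason: having a child of a given type is again a name, so it cannot separate two states that
    the minimal name identifies. *)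
Theorem name_dichotomy k (F : config -> tree) : (forall s m, decided (fun x => F x s m)) ->
  (exists C b x0 A0 s0, name k F C b /\ forall x A, agree A0 x0 x ->
    exists x1 x2, [/\ C x1, C x2, agree A x x1 & agree A x x2] /\ (low k x1 x2 /\ b x1 s0 <> b x2 s0)) \/
  (exists C x0 A0, comeager C /\ forall x y, C x -> C y -> agree A0 x0 x -> agree A0 x0 y ->
    low k x y -> bisimilar (F x) (F y)).
Proof.
move=> dF; have or_not (P Q : Prop) : (~ P -> Q) -> P \/ Q.
  by move=> PQ; have [?|/PQ ?] := pselect P; [left|right].
apply: or_not => nI.
have dI C b : name k F C b -> forall x0 A0 s, exists x A, agree A0 x0 x /\
    same_value k C b (cond_of A x, s) (cond_of A x, s).
  move=> nb x0 A0 s; apply: contrapT => H; apply: nI; exists C, b, x0, A0, s; split=> // x A xx.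
  apply: contrapT => H'; apply: H; exists x, A; split=> // x1 x2 /= C1 C2.
  move=> /holds_cond_of a1 /holds_cond_of a2 l12; apply: contrapT => n12.
  by apply: H'; exists x1, x2.
have [CF [cCF lF]] : exists CF, comeager CF /\ forall s m, locally_constant CF (fun x => F x s m).
  have /choice[D HD] (sm : seq nat * nat) := decided_locally_constant (dF sm.1 sm.2).
  exists (fun x => forall sm, D sm x); split; first by apply: comeager_bigcap => sm; case: (HD sm).
  move=> s m x Dx; have [_ /(_ x (Dx _))[A HA]] := HD (s, m); exists A => y Dy; exact: HA.
have nF : name k F CF F.
  split=> //; last by move=> x y s t _ _ _ /bisimilar_at_label.
  move=> x s m Cx; have [A HA] := lF s m x Cx; exists A => y Cy xy.
  by have [h1 h2] := HA y Cy xy; apply/idP/idP.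
have [C [b [nb min]]] : exists C b, name k F C b /\ forall C' b' e e', name k F C' b' ->
    same_value k C b e e' -> same_value k C' b' e e' by apply: minimal_name; exists CF, F.
have [cC con inv] := nb.
(* Below [e.1], the value of [b] at [e.2] is a function of the levels below [k]. *)
pose self e := same_value k C b e e.
(* the state [t] of [x] has the type named by [e] *)
pose S e (x : config) t := exists w, [/\ C w, holds e.1 w, low k x w & b x t = b w e.2].
pose Cl : set config := fun x => forall c, (exists y, low k x y /\ holds c y) ->
    exists y, [/\ C y, low k x y & holds c y].
have cCl : comeager Cl := comeager_low k cC.
(* Three cases: the type named by [e] occurs at [t] generically below the condition; the lower
   levels of some [x] exclude [e.1]; or some bit of [b x t] differs from the one that [e] names, and
   does so in a neighbourhood. *)
have dS e t : self e -> decided (fun x => S e x t).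
  move=> se x0 A0.
  have [H|/existsNP[x /not_implyP[[Cx Clx] /not_implyP[xx0 nS]]]] := pselect (forall x, C x /\ Cl x ->
      agree A0 x0 x -> S e x t).
    exists x0, A0; split=> //; left; refine (comeager_sub (comeagerI cC cCl) _) => x.
    exact: H.
  have [[y [xy ey]]|nz] := pselect (exists y, low k x y /\ holds e.1 y); last first.
    exists x, [seq c <- map fst e.1 | c.1.1 < k]; split=> //; right.
    refine (comeager_sub cC _) => z Cz xz [w [Cw ew zw _]]; apply: nz.
    exists (fun c => if c.1.1 < k then x c else w c); split; first by move=> c ->.
    apply: holds_agree ew => c ce; case: ifP => // ck; rewrite xz -?zw //.
    by rewrite mem_filter ck.
  have [w [Cw xw ew]] := Clx _ (ex_intro _ y (conj xy ey)).
  have [m bm] : exists m, b x t m <> b w e.2 m.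
    by apply/existsNP => bw; apply: nS; exists w; split=> //; apply/funext.
  have [A HA] := con x t m Cx; have [B HB] := con w e.2 m Cw.
  exists x, (A ++ [seq c <- map fst e.1 ++ B | c.1.1 < k]); split=> //; right.
  refine (comeager_sub (comeagerI cC cCl) _) => z [Cz Clz] /agree_cat[xz xz'] [v [Cv ev zv bv]].
  have [w' [Cw' zw' /[dup] ew' /holds_cond_of]] : exists y, [/\ C y, low k z y &
      holds (cond_of (map fst e.1 ++ B) w) y].
    apply: Clz; exists (fun c => if c.1.1 < k then z c else w c); split; first by move=> c ->.
    apply/holds_cond_of => c cB; case: ifP => // ck.
    by rewrite -xz' ?mem_filter ?ck // xw.
  move=> /agree_cat[wa wB]; apply: bm.
  rewrite -(HA z) // -(HB w') // bv.
  suff -> : b v e.2 = b w' e.2 by [].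
  apply: se => //; first exact: holds_agree wa ew.
  exact: low_trans (low_sym zv) zw'.
have nS e : self e -> exists C', [/\ comeager C', (forall x, C' x -> C x),
    forall t, locally_constant C' (fun x => S e x t) &
    name k F C' (fun x s _ => `[<exists i, S e x (rcons s i)>])].
  move=> se.
  have /choice[D HD] t := decided_locally_constant (dS e t se).
  have dE s : decided (fun x => exists i, S e x (rcons s i)).
    by apply: decided_bigcup => i; exact: dS.
  have /choice[D' HD'] s := decided_locally_constant (dE s).
  pose C' : set config := fun x => C x /\ forall s, D s x /\ D' s x.
  have cC' : comeager C'.
    by apply: comeagerI => //; apply: comeager_bigcap => s; apply: comeagerI; case: (HD s); case: (HD' s).
  exists C'; split=> //; first by move=> x [].
    move=> t x [_ Dx]; have [_ /(_ x)[|A HA]] := HD t; first by case: (Dx t).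
    by exists A => y [_ Dy]; apply: HA; case: (Dy t).
  split=> //.
    move=> x s _ [_ Dx]; have [_ /(_ x)[|A HA]] := HD' s; first by case: (Dx s).
    by exists A => y [_ Dy] xy; apply/asbool_equiv_eq/HA => //; case: (Dy s).
  move=> x y s t [Cx _] [Cy _] xy bis; apply/funext => _; apply/asbool_equiv_eq.
  have H x' y' s' t' : C x' -> C y' -> low k x' y' -> bisimilar_at (F x') (F y') s' t' ->
      (exists i, S e x' (rcons s' i)) -> exists i, S e y' (rcons t' i).
    move=> Cx' Cy' xy' bis' [i [w [Cw ew xw bw]]].
    have [j bj] := bisimilar_at_step i bis'; exists j, w; split=> //.
      exact: low_trans (low_sym xy') xw.
    by rewrite -(inv x' y' (rcons s' i)).
  split; first exact: H.
  by apply: H => //; [exact: low_sym|exact: bisimilar_at_sym].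
have /choice[D HD] (e : seq (coord * bool) * seq nat) : exists C', self e ->
    [/\ comeager C', (forall x, C' x -> C x), forall t, locally_constant C' (fun x => S e x t) &
    name k F C' (fun x s _ => `[<exists i, S e x (rcons s i)>])].
  by have [/nS[C' HC']|n] := pselect (self e); [exists C'|exists setT].
pose Cfin : set config := fun x => [/\ C x, CF x, forall s, exists c, holds c x /\ self (c, s) &
  forall e, self e -> D e x].
have cCfin : comeager Cfin.
  have H1 : comeager (fun x => forall s, exists c, holds c x /\ self (c, s)).
    apply: comeager_bigcap => s; apply: open_dense_comeager.
      by move=> x [c [cx sc]]; exists (map fst c) => y xy; exists c; split=> //; exact: holds_agree xy cx.
    move=> x A; have [y [B [xy sy]]] := dI C b nb x A s.
    by exists y; split=> //; exists (cond_of B y); split=> //; apply/holds_cond_of.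
  have H2 : comeager (fun x => forall e, self e -> D e x).
    apply: comeager_bigcap => e; have [/HD[cD _ _ _]|n] := pselect (self e).
      by refine (comeager_sub cD _) => x Dx _.
    exact: comeager_all.
  refine (comeager_sub (comeagerI (comeagerI cC cCF) (comeagerI H1 H2)) _).
  by move=> x [[? ?] [? ?]].
have [x0 [A0 [_ se0]]] := dI C b nb xpred0 [::] [::].
exists Cfin, x0, A0; split=> // x y Cx Cy x0x x0y xy.
(* Equality has to be forced by conditions, not merely true at [x] and [y]: only the forced form
   falls under the minimality of [b]. *)
pose R x y s t := exists c c', [/\ holds c x, holds c' y & same_value k C b (c, s) (c', t)].
have Rsym x' y' s t : R x' y' s t -> R y' x' t s.
  move=> [c [c' [cx cy H]]]; exists c', c; split=> // u v Cu Cv cu cv uv.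
  by apply/esym; apply: H => //; exact: low_sym.
have Rstep x' y' s t : Cfin x' -> Cfin y' -> low k x' y' -> R x' y' s t ->
    F x' s = F y' t /\ forall i, exists j, R x' y' (rcons s i) (rcons t j).
  move=> [Cx' CFx ex Dx] [Cy' CFy ey Dy] xy' [c [c' [cx cy H]]]; split.
    exact: (min CF F _ _ nF H).
  move=> i; have [c1 [c1x self1]] := ex (rcons s i).
  have [cD DC lS nD] := HD _ self1.
  (* Minimality is applied to the name asking for a child of the type [(c1, rcons s i)]; the state
     [rcons s i] of [x'] is one. *)
  have := min _ _ _ _ nD H x' y' (Dx _ self1) (Dy _ self1) cx cy xy'.
  move=> /(congr1 (fun f => f 0)) /= eqS.
  have [j Sj] : exists j, S (c1, rcons s i) y' (rcons t j).
    by apply/asboolP; rewrite -eqS; apply/asboolP; exists i, x'.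
  exists j.
  have [A HA] := lS (rcons t j) y' (Dy _ self1).
  exists c1, (cond_of A y'); split=> //; first exact/holds_cond_of.
  apply: (same_value_restrict nb cD) => u v Cu Cv Du Dv cu /holds_cond_of yv uv /=.
  have [w [Cw ew vw ->]] := (HA v Dv yv).2 Sj.
  by apply: self1 => //; exact: low_trans uv vw.
exists (R x y); split; last by exists (cond_of A0 x0), (cond_of A0 x0); split=> //; apply/holds_cond_of.
move=> s t Rst; have [e H] := Rstep x y s t Cx Cy xy Rst; split=> // j.
have [_ H'] := Rstep y x t s Cy Cx (low_sym xy) (Rsym _ _ _ _ Rst).
by have [i Hi] := H' j; exists i; exact: Rsym.
Qed.

(** * Mutually generic rows *)

Fixpoint all_words (T : Type) (ns : seq T) k : seq (seq T) :=
  if k is k'.+1 then [seq x :: t | x <- ns, t <- all_words ns k'] else [:: [::]].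

Lemma mem_all_words (T : eqType) (ns : seq T) t :
  {subset t <= ns} -> t \in all_words ns (size t).
Proof.
elim: t => //= x t IH H; apply/allpairsP; exists (x, t) => /=.
split=> //; [by apply: H; rewrite inE eqxx|by apply: IH => y yt; apply: H; rewrite inE yt orbT].
Qed.

Definition rows_agree h M (w w' : nat -> nat -> bool) :=
  forall i j, i < h -> j < M -> w i j = w' i j.

Definition open_rows h (U : set (nat -> nat -> bool)) :=
  forall w, U w -> exists M, forall w', rows_agree h M w w' -> U w'.

Definition dense_rows h (U : set (nat -> nat -> bool)) :=
  forall w M, exists w', rows_agree h M w w' /\ U w'.

(** The rows at the nodes of [t] are changed only from [L] on, and [L'] bounds the part of them that
    secures [U]. *)
Lemma fusion_step (T : eqType) h (U : set (nat -> nat -> bool)) (V : T -> nat -> bool) L (t : seq T) :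
  open_rows h U -> dense_rows h U -> uniq t -> size t = h ->
  exists V' L', [/\ L <= L', forall a j, j < L -> V' a j = V a j, forall a, a \notin t -> V' a = V a &
    forall w, (forall i j a0, i < h -> j < L' -> w i j = V' (nth a0 t i) j) -> U w].
Proof.
case: t => [|a0 t] oU dU ut st.
  (* For the empty tuple [h = 0], and then a dense open [U] contains every [w]. *)
  have [w' [_ Uw']] := dU (fun _ _ => false) 0; have [M HM] := oU w' Uw'.
  exists V, L; split=> // w _; apply: HM => i j; by rewrite -st.
have [w' [ww' Uw']] := dU (fun i => V (nth a0 (a0 :: t) i)) L.
have [M HM] := oU w' Uw'.
exists (fun a => if a \in a0 :: t then w' (index a (a0 :: t)) else V a), (maxn L M); split.
- exact: leq_maxl.
- move=> a j jL; case: ifP => // at'.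
  by rewrite -ww' ?nth_index // -st index_mem.
- by move=> a /negbTE ->.
- move=> w Hw; apply: HM => i j ih jM.
  by rewrite (Hw i j a0) ?leq_max ?jM ?orbT // mem_nth ?st // index_uniq ?st.
Qed.

Lemma fusion_steps (T : eqType) (ns : seq T) (h : nat -> nat) (U : nat -> set (nat -> nat -> bool))
    (ts : seq (nat * seq T)) (V : T -> nat -> bool) L :
  (forall q, open_rows (h q) (U q)) -> (forall q, dense_rows (h q) (U q)) ->
  (forall q, q \in ts -> {subset q.2 <= ns}) ->
  exists V' L', [/\ L <= L', forall a j, j < L -> V' a j = V a j, forall a, a \notin ns -> V' a = V a &
    forall q, q \in ts -> uniq q.2 -> size q.2 = h q.1 ->
      forall w, (forall i j a0, i < h q.1 -> j < L' -> w i j = V' (nth a0 q.2 i) j) -> U q.1 w].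
Proof.
move=> oU dU; elim: ts V L => [|[q t] ts IH] V L sub; first by exists V, L.
have [V1 [L1 [LL1 VV1 nV1 H1]]] : exists V' L', [/\ L <= L', forall a j, j < L -> V' a j = V a j,
    forall a, a \notin ns -> V' a = V a & uniq t -> size t = h q ->
      forall w, (forall i j a0, i < h q -> j < L' -> w i j = V' (nth a0 t i) j) -> U q w].
  have [[ut st]|n] := pselect (uniq t /\ size t = h q); last first.
    by exists V, L; split=> // ut st; case: n.
  have [V1 [L1 [? ? nV1 ?]]] := fusion_step V L (oU q) (dU q) ut st.
  exists V1, L1; split=> // a /negP an; apply: nV1; apply/negP => at'; apply: an.
  by apply: (sub (q, t)) => //; rewrite inE eqxx.
have [|V2 [L2 [LL2 VV2 nV2 H2]]] := IH V1 L1.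
  by move=> p pts; apply: sub; rewrite inE pts orbT.
exists V2, L2; split.
- exact: leq_trans LL2.
- by move=> a j jL; rewrite VV2 ?VV1 // (leq_trans jL).
- by move=> a an; rewrite nV2 ?nV1.
- move=> p; rewrite inE => /orP[/eqP -> /= ut st w Hw|]; last exact: H2.
  apply: H1 => // i j a0 ih jL; rewrite -VV2 //; apply: Hw => //; exact: leq_trans LL2.
Qed.

(** A fusion over nodes made of a tag and a finite word. At each stage the words grow by one bit and
    the requirements listed so far are met along all tuples of distinct nodes; distinct pairs of a
    tag and a branch lie on distinct nodes from some stage on. *)
Theorem mycielski (s : nat -> seq bool) (h : nat -> nat) (U : nat -> set (nat -> nat -> bool)) :
  (forall q, open_rows (h q) (U q)) -> (forall q, dense_rows (h q) (U q)) ->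
  exists phi : nat -> (nat -> bool) -> nat -> bool,
  [/\ forall t r r' i, (forall j, j <= i -> r j = r' j) -> phi t r i = phi t r' i,
      forall t r i, i < size (s t) -> phi t r i = nth false (s t) i &
      forall q (a : nat -> nat * (nat -> bool)),
        (forall i i', i < h q -> i' < h q -> a i = a i' -> i = i') ->
        U q (fun i => phi (a i).1 (a i).2)].
Proof.
move=> oU dU.
pose node : eqType := (nat * seq bool)%type.
pose nodes n : seq node := [seq (t, w) | t <- iota 0 n, w <- all_words [:: true; false] n].
pose tasks n := flatten [seq [seq (q, t) | t <- all_words (nodes n) (h q)] | q <- iota 0 n].
(* Nodes whose tag is not below [n] still carry their prescribed prefix, padded with [false]. *)
pose Inv n (V : node -> nat -> bool) (L : nat) := n <= L /\
  forall a, n <= a.1 -> V a = nth false (s a.1).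
pose T := (nat * ((node -> nat -> bool) * nat))%type.
pose P (n : nat) (p p' : T) :=
  let: (k, (V, L)) := p in let: (k', (V', L')) := p' in
  [/\ k' = k.+1 , L <= L' /\ size (s k) <= L',
    forall a j, j < L -> V' a j = V (a.1, take k a.2) j,
    forall r j, j < size (s k) -> V' (k, r) j = nth false (s k) j &
    forall q, q \in tasks k.+1 -> uniq q.2 -> size q.2 = h q.1 ->
      forall w, (forall i j a0, i < h q.1 -> j < L' -> w i j = V' (nth a0 q.2 i) j) -> U q.1 w].
have [|n [k [V L]] [/= kL VI]|st [st0 Hst]] := @dependent_sequence T (fun p => Inv p.1 p.2.1 p.2.2) P
  (0, (fun a => nth false (s a.1), 0)).
- by [].
- have [|V' [L' [LL' VV' nV' H']]] := @fusion_steps node (nodes k.+1) h U (tasks k.+1)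
      (fun a => V (a.1, take k a.2)) (maxn L.+1 (size (s k))) oU dU.
    move=> q /flatten_mapP[t _ /mapP[u uw ->]] /=.
    elim: (h t) u uw => [|m IH] u /=; first by rewrite inE => /eqP ->.
    move=> /allpairsP[[x v] /= [xn vw ->]] y; rewrite inE => /orP[/eqP -> //|]; exact: IH.
  rewrite geq_max in LL'; case/andP: LL' => LL' sL'.
  exists (k.+1, (V', L')); split; last split=> //.
  + split=> /=; first exact: leq_trans LL'.
    move=> a /= ka; rewrite nV'; first by rewrite VI //=; exact: ltnW.
    apply/allpairsP => -[[t w] [tn _ ea]]; move: tn ka.
    by rewrite ea mem_iota add0n ltnNge => /= /negP.
  + by split=> //; exact: ltnW.
  + by move=> a j jL; rewrite VV' // leq_max ltnS (ltnW jL).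
  + by move=> r j jL; rewrite VV' ?leq_max ?jL ?orbT // VI.
have kn n : (st n).1 = n.
  elim: n => [|n IH]; first by rewrite st0.
  have [_] := Hst n; case: (st n) IH => k [V L] /= ->.
  by case: (st n.+1) => k' [V' L'] [-> _ _ _ _].
pose V n := (st n).2.1; pose L n := (st n).2.2.
have HP n : [/\ L n <= L n.+1 /\ size (s n) <= L n.+1,
    forall a j, j < L n -> V n.+1 a j = V n (a.1, take n a.2) j,
    forall r j, j < size (s n) -> V n.+1 (n, r) j = nth false (s n) j &
    forall q, q \in tasks n.+1 -> uniq q.2 -> size q.2 = h q.1 ->
      forall w, (forall i j a0, i < h q.1 -> j < L n.+1 -> w i j = V n.+1 (nth a0 q.2 i) j) -> U q.1 w].
  have [_] := Hst n; rewrite /V /L; have := kn n; have := kn n.+1.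
  case: (st n) => k [? ?] /= + ek; rewrite ek; case: (st n.+1) => k' [? ?] /= _.
  by case=> _ ? ? ? ?.
have nL n : n <= L n by have [[+ _] _] := Hst n; rewrite kn.
have VI n a : n <= a.1 -> V n a = nth false (s a.1).
  by have [[_ +] _] := Hst n; rewrite kn; apply.
have stab t r n m j : j < L n -> V (m + n) (t, mkseq r (m + n)) j = V n (t, mkseq r n) j.
  move=> jL; have jLm k : j < L (k + n).
    elim: k => // k IH; have [[+ _] _ _ _] := HP (k + n); rewrite addSn; exact: leq_trans.
  elim: m => // m IH; rewrite addSn; have [_ H _ _] := HP (m + n).
  rewrite H //= -IH; congr (V _ (_, _) _).
  by rewrite /mkseq -map_take take_iota /minn ltnSn.
(* Bit [i] is already frozen at stage [i.+1], because [n <= L n]. *)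
pose phi t r i := V i.+1 (t, mkseq r i.+1) i.
have phiV t r n i : i < L n -> phi t r i = V n (t, mkseq r n) i.
  move=> iL; rewrite /phi; case: (leqP n i.+1) => [le|lt].
    by rewrite -{1 2}(subnK le) stab // subnK.
  by rewrite -(subnK (ltnW lt)) stab // subnK // ltnW.
exists phi; split.
- move=> t r r' i H; rewrite /phi; congr (V _ (_, _) _).
  by apply/eq_in_map => j; rewrite mem_iota ltnS; exact: H.
- move=> t r i il; rewrite (phiV t r t.+1).
    by have [_ _ H _] := HP t; rewrite H.
  by have [[_ +] _ _ _] := HP t; exact: leq_trans.
- move=> q a ainj.
  (* The stage has to exceed [q] and all tags in use, and words of length [n] have to tell apart
     branches with the same tag. *)
  have [n [qn Hn nn]] : exists n, [/\ q < n, forall i, i < h q -> (a i).1 < n &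
      forall i i', i < h q -> i' < h q -> (a i).1 = (a i').1 ->
        mkseq (a i).2 n = mkseq (a i').2 n -> i = i'].
    have /choice[N HN] (p : nat * nat) : exists N, p.1 < h q -> p.2 < h q -> p.1 <> p.2 ->
        (a p.1).1 = (a p.2).1 -> exists2 j, j < N & (a p.1).2 j <> (a p.2).2 j.
      have [H|/existsNP[j nj]] := pselect (forall j, (a p.1).2 j = (a p.2).2 j).
        exists 0 => h1 h2 n12 e; case: n12; apply: ainj => //.
        by move/funext: H; case: (a p.1) (a p.2) e => [? ?] [? ?] /= -> ->.
      by exists j.+1 => *; exists j.
    exists (q.+1 + \max_(i < h q) (a i).1.+1 + \max_(i < h q) \max_(i' < h q) N (nat_of_ord i, nat_of_ord i')).
    split; first by rewrite -addnA leq_addr.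
      move=> i ih; apply: leq_trans (leq_addr _ _); apply: leq_trans (leq_addl _ _).
      exact: (leq_bigmax (Ordinal ih)).
    move=> i i' ih ih' e em; apply: contrapT => ni.
    have [/= j jN] := HN (i, i') ih ih' ni e; apply.
    set n := _ + _ in em; have jn : j < n.
      apply: leq_trans jN _; apply: leq_trans (leq_addl _ _).
      apply: leq_trans (leq_bigmax (Ordinal ih)).
      exact: (leq_bigmax (Ordinal ih') (F := fun i' : 'I__ => N (i, nat_of_ord i'))).
    by have := congr1 (fun u => nth false u j) em; rewrite !nth_mkseq.
  case: n qn Hn nn => // n qn Hn nn.
  have [_ _ _ H] := HP n.
  pose t : seq node := mkseq (fun i => ((a i).1, mkseq (a i).2 n.+1)) (h q).
  apply: (H (q, t)) => /=.
  + apply/flatten_mapP; exists q; first by rewrite mem_iota.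
    apply: map_f; rewrite -[X in all_words _ X](size_mkseq (fun i => ((a i).1, mkseq (a i).2 n.+1)) (h q)).
    apply: mem_all_words => _ /mapP[i + ->]; rewrite mem_iota /= => ih.
    apply/allpairsP; exists ((a i).1, mkseq (a i).2 n.+1); split=> //.
      by rewrite mem_iota; exact: Hn.
    rewrite -[X in all_words _ X](size_mkseq (a i).2 n.+1); apply: mem_all_words => b _.
    by case: b; rewrite !inE.
  + apply/mkseq_uniqP => i i'; rewrite !inE => ih ih' ee.
    by apply: nn => //; [exact: (congr1 fst ee)|exact: (congr1 snd ee)].
  + by rewrite size_mkseq.
  + by move=> i j a0 ih jL; rewrite nth_mkseq // (phiV _ _ n.+1).
Qed.

(** * The extension property *)

Lemma unbounded_injection (f : nat -> nat) N : injective f -> exists j, N < f j.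
Proof.
move=> fi; apply: contrapT => H.
have fN j : f j < N.+1 by rewrite ltnS leqNgt; apply/negP => h; apply: H; exists j.
suff : #|'I_N.+2| <= #|'I_N.+1| by rewrite !card_ord ltnn.
by apply: (@leq_card _ _ (fun i : 'I_N.+2 => Ordinal (fN i))) => i j [] /fi /val_inj.
Qed.

Lemma eq_map_inj (T U : eqType) (f : T -> U) (s t : seq T) :
  (forall x y, x \in s -> y \in t -> f x = f y -> x = y) -> map f s = map f t -> s = t.
Proof.
elim: s t => [|x s IH] [|y t] //= H [e es]; congr (_ :: _); first by apply: H e; rewrite inE eqxx.
by apply: IH es => a b as' bt; apply: H; rewrite inE ?as' ?bt orbT.
Qed.

(* A tag carries a finite table prescribing memberships with objects of the next level, one for
   the previous level, an initial segment of the row at level 1, and a counter making it large. *)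
Definition key := (nat * seq (seq nat))%type.
Definition tag_data := (seq key * seq key * seq bool * nat)%type.
Definition untag (n : nat) : tag_data := odflt ([::], [::], [::], 0) (unpickle n).
Definition tag_up n := (untag n).1.1.1.
Definition tag_down n := (untag n).1.1.2.
Definition tag_prefix n := (untag n).1.2.

Lemma tag_exists (U D : seq key) (s : seq bool) (N : nat) : exists n,
  [/\ N < n, tag_up n = U, tag_down n = D & tag_prefix n = s].
Proof.
have [|j jN] := @unbounded_injection (fun j => pickle ((U, D, s, j) : tag_data)) N.
  by move=> i j /(pcan_inj (@pickleK _)) [].
by exists (pickle ((U, D, s, j) : tag_data)); rewrite /tag_up /tag_down /tag_prefix /untag pickleK.
Qed.

Definition node (B : Type) := (nat * seq B)%type.

(** The leading row of zeros records the length of [w], which would be lost for empty [v]. *)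
Definition profile (B : Type) (test : B -> B -> nat) (v w : seq B) : seq (seq nat) :=
  [seq 0 | o <- w] :: [seq [seq test a o | o <- w] | a <- v].

(* The larger tag decides, so that a node whose tag exceeds those of finitely many given nodes can
   realize any membership pattern with respect to them. *)
Definition member (B : Type) (test : B -> B -> nat) (u t : node B) : bool :=
  let M := profile test u.2 t.2 in
  if u.1 < t.1 then (u.1, M) \in tag_down t.1 else (t.1, M) \in tag_up u.1.

Definition level (B : eqType) (d : B -> nat) (S : set B) (l : nat) : set (node B) :=
  fun u => forall v, v \in u.2 -> S v /\ d v < l.

Definition separated (B : Type) (d : B -> nat) (test : B -> B -> nat) (S T : set B) (l : nat) :=
  forall o o', T o -> T o' -> d o <= l -> d o' <= l -> o <> o' ->
    exists v, [/\ S v, d v < l & test v o <> test v o'].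

Lemma separators (B : eqType) (d : B -> nat) test (S T : set B) l (os : seq B) :
  separated d test S T l -> (forall o, o \in os -> T o /\ d o <= l) ->
  exists Z : seq B, (forall v, v \in Z -> S v /\ d v < l) /\
    forall o o', o \in os -> o' \in os -> o <> o' -> exists2 v, v \in Z & test v o <> test v o'.
Proof.
move=> sep Hos.
suff [Z [SZ HZ]] : exists Z : seq B, (forall v, v \in Z -> S v /\ d v < l) /\
    forall p, p \in [seq (o, o') | o <- os, o' <- os] -> p.1 <> p.2 ->
      exists2 v, v \in Z & test v p.1 <> test v p.2.
  by exists Z; split=> // o o' oo oo'; apply: (HZ (o, o')); exact: allpairs_f.
have : forall p, p \in [seq (o, o') | o <- os, o' <- os] -> p.1 <> p.2 ->
    exists v, [/\ S v, d v < l & test v p.1 <> test v p.2].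
  move=> _ /allpairsP[[o o'] [/= /Hos[To do_] /Hos[To' do'] ->]] /=; exact: sep.
elim: [seq (o, o') | o <- os, o' <- os] => [|p ps IH] H; first by exists [::].
have [|Z [SZ HZ]] := IH; first by move=> q qps; apply: H; rewrite inE qps orbT.
have [e|n] := pselect (p.1 = p.2).
  by exists Z; split=> // q; rewrite inE => /orP[/eqP ->|] //; exact: HZ.
have [|v [Sv dv tv]] := H p _ n; first by rewrite inE eqxx.
exists (v :: Z); split.
  by move=> w; rewrite inE => /orP[/eqP ->|/SZ].
move=> q; rewrite inE => /orP[/eqP ->|qps nq]; first by exists v => //; rewrite inE eqxx.
by have [w wZ tw] := HZ q qps nq; exists w => //; rewrite inE wZ orbT.
Qed.

(** The new tag exceeds all given ones, so its tables decide. Its list [g] contains the base objects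
    of [LW], and the entries 2 in a profile recover the node [w]; it also contains separators for
    the base objects of [LT], so that the columns recover [t]. Hence no two given nodes have the
    same key. *)
Lemma extension (B : eqType) (d : B -> nat) test (S T : set B) l (LW LT : seq (node B))
    (beta gamma : node B -> bool) (s : seq bool) (forb : seq (node B)) :
  (forall v o, test v o = 2 <-> v = o) -> separated d test S T l ->
  (forall w, w \in LW -> level d S l.-1 w) -> (forall t, t \in LT -> level d T l.+1 t) ->
  exists u, [/\ level d S l u, u \notin forb, tag_prefix u.1 = s,
    forall w, w \in LW -> member test w u = beta w &
    forall t, t \in LT -> member test u t = gamma t].
Proof.
move=> t2 sep HLW HLT.
have [|Z [SZ HZ]] := @separators B d test S T l (flatten [seq t.2 | t <- LT]) sep.
  by move=> o /flatten_mapP[t /HLT Ht /Ht].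
pose g := flatten [seq w.2 | w <- LW] ++ Z.
pose keyw (w : node B) : key := (w.1, profile test w.2 g).
pose keyt (t : node B) : key := (t.1, profile test g t.2).
have [n [nN up dn pr]] := tag_exists [seq keyt t | t <- LT & gamma t] [seq keyw w | w <- LW & beta w] s
  (\max_(u <- LW ++ LT ++ forb) u.1).
have nn u : u \in LW ++ LT ++ forb -> u.1 < n.
  by move=> uu; apply: leq_ltn_trans nN; exact: (leq_bigmax_seq (F := fun u : node B => u.1)).
exists (n, g); split=> //=.
- move=> v; rewrite mem_cat => /orP[/flatten_mapP[w /HLW Hw /Hw[Sv dv]]|/SZ //].
  by split=> //; apply: leq_trans dv _; exact: leq_pred.
- by apply/negP => h; have := nn (n, g); rewrite !mem_cat h !orbT ltnn => /(_ isT).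
- move=> w wL; rewrite /member /= nn ?mem_cat ?wL // dn.
  apply/mapP/idP => [[w' + ew]|bw]; last by exists w => //; rewrite mem_filter bw.
  rewrite mem_filter => /andP[bw' w'L]; suff -> : w = w' by [].
  case: ew; case: w w' wL w'L {bw'} => [m v] [m' v'] vL vL' /= -> e; congr (_, _).
  apply: (eq_map_inj _ e) => a b av bv ab; apply/esym/t2.
  have ag : a \in g.
    by rewrite mem_cat; apply/orP; left; apply/flatten_mapP; exists (m, v).
  by move/eq_in_map/(_ a ag): ab => <-; apply/t2.
- move=> t tL; rewrite /member /= ltnNge ltnW ?nn ?mem_cat ?tL ?orbT //= up.
  apply/mapP/idP => [[t' + et]|bt]; last by exists t => //; rewrite mem_filter bt.
  rewrite mem_filter => /andP[bt' t'L]; suff -> : t = t' by [].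
  case: et; case: t t' tL t'L {bt'} => [m v] [m' v'] vL vL' /= -> e0 /eq_in_map e; congr (_, _).
  have sz : size v = size v' by have := congr1 size e0; rewrite !size_map.
  case: v vL e0 sz e => [|x0 v] vL e0 sz e; first by move/esym/eqP: sz; rewrite size_eq0 => /eqP.
  apply: (eq_from_nth (x0 := x0)) => // i iv; apply: contrapT => ni.
  have [||z zZ] := HZ _ _ _ _ ni.
  + by apply/flatten_mapP; exists (m, x0 :: v) => //; exact: mem_nth.
  + by apply/flatten_mapP; exists (m', v') => //; apply: mem_nth; rewrite -sz.
  + have zg : z \in g by rewrite mem_cat zZ orbT.
    have := congr1 (fun r => nth 0 r i) (e z zg).
    by rewrite !(nth_map x0) // -?sz.
Qed.

(** * Joint realization of generic configurations *)

Definition cube (M : nat) (x y : config) :=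
  forall l j i, l < M -> j < M -> i < M -> x (l, j, i) = y (l, j, i).

(** A pair in [shr] stands for one object of level [k.+1] that has the index [p.1] on the first side
    and [p.2] on the second. *)
Definition sharing k (shr : seq (nat * nat)) (x y : config) :=
  low k x y /\ forall p, p \in shr -> forall a, x (k, p.1, a) = y (k, p.2, a).

Definition partial_injection (shr : seq (nat * nat)) :=
  forall p p', p \in shr -> p' \in shr -> (p.1 = p'.1 <-> p.2 = p'.2).

(** Rows in [bad] are kept for objects that do not occur on the second side; being never shared,
    they may be used to make the two points differ. *)
Definition dense_requirement k (bad : pred nat) (D : config -> config -> Prop) :=
  forall shr x y A, partial_injection shr -> (forall p, p \in shr -> ~~ bad p.1) ->
    sharing k shr x y ->
    exists x' y', [/\ D x' y', sharing k shr x' y', agree A x x' & agree A y y'].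

Definition open_requirement (D : config -> config -> Prop) :=
  forall x y, D x y -> exists M, forall x' y', cube M x x' -> cube M y y' -> D x' y'.

Definition side (T : Type) (x y : T) (b : bool) := if b then x else y.

(** The parameters are finite lists, so countably many such sets cover all stages of all
    realizations. *)
Definition requirement_rows k (D : config -> config -> Prop) (shr : seq (nat * nat))
    (tab : seq ((bool * coord) * bool)) (idx : seq ((bool * nat) * nat)) (w : nat -> nat -> bool) :=
  exists x y M, [/\ forall x' y', cube M x x' -> cube M y y' -> D x' y', sharing k shr x y,
    forall e, e \in tab -> side x y e.1.1 e.1.2 = e.2 &
    forall e i, e \in idx -> i < M -> side x y e.1.1 (0, e.1.2, i) = w e.2 i].

Lemma open_requirement_rows k D shr tab idx h : (forall e, e \in idx -> e.2 < h) ->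
  open_rows h (requirement_rows k D shr tab idx).
Proof.
move=> idxh w [x [y [M [HD sh tb ix]]]]; exists M => w' ww'.
exists x, y, M; split=> // e i ei iM; rewrite ix // ww' //; exact: idxh.
Qed.

(* The rows of finitely many distinct nodes of level 1 are infinite objects fixed in advance, so they
   have to meet every dense condition that a finite realization may later impose on them. *)
Definition generic_rows (B : eqType) (L : set (node B)) (row : node B -> nat -> bool) k
    (D : config -> config -> Prop) :=
  forall shr tab idx h, (forall e, e \in idx -> e.2 < h) ->
    dense_rows h (requirement_rows k D shr tab idx) ->
    forall u : nat -> node B, (forall i, i < h -> L (u i)) ->
      (forall i i', i < h -> i' < h -> u i = u i' -> i = i') ->
      requirement_rows k D shr tab idx (fun i => row (u i)).

Definition slot := (bool * nat * nat)%type.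

(** The slot [(b, l, i)] holds the object with index [i] of level [l] on side [b]; objects of level
    0 are their own indices and have no slots. *)
Definition pull (B : eqType) test (row : node B -> nat -> bool) (e : slot -> node B) (b : bool) : config :=
  fun c => if c.1.1 is 0 then row (e (b, 1, c.1.2)) c.2
           else member test (e (b, c.1.1, c.2)) (e (b, c.1.1.+1, c.1.2)).

Record realization_data (B : eqType) := RealizationData {
  rd_d : B -> nat ;
  rd_test : B -> B -> nat ;
  rd_S : bool -> set B ;
  rd_row : node B -> nat -> bool ;
  rd_k : nat ;
  rd_bad : pred nat }.

(** The fourth clause separates objects of both sides by objects of either one; it lets a node of
    level at most [rd_k X] be chosen for both sides at once. *)
Definition admissible (B : eqType) (X : realization_data B) :=
  [/\ forall v o, rd_test X v o = 2 <-> v = o,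
      forall v b b', rd_d X v < rd_k X -> rd_S X b v -> rd_S X b' v,
      forall b l, 0 < l -> separated (rd_d X) (rd_test X) (rd_S X b) (rd_S X b) l,
      forall b l, 0 < l -> l <= rd_k X ->
        separated (rd_d X) (rd_test X) (rd_S X b) (fun v => exists b', rd_S X b' v) l &
      forall u i, i < size (tag_prefix u.1) -> rd_row X u i = nth false (tag_prefix u.1) i].

Definition obj (B : eqType) (X : realization_data B) (b : bool) l := level (rd_d X) (rd_S X b) l.

(** Finite partial enumerations of both towers: identical up to level [rd_k X], and with each bad
    row occupied by an object missing on the second side. *)
Definition valid (B : eqType) (X : realization_data B) (e : slot -> node B) (Dm : seq slot) :=
  [/\ forall b l i, (b, l, i) \in Dm -> 0 < l /\ obj X b l (e (b, l, i)),
      forall b l i i', (b, l, i) \in Dm -> (b, l, i') \in Dm -> e (b, l, i) = e (b, l, i') -> i = i',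
      forall b b' l i, l <= rd_k X -> e (b, l, i) = e (b', l, i),
      forall b b' l i, l <= rd_k X -> (b, l, i) \in Dm -> (b', l, i) \in Dm &
      forall i, rd_bad X i -> (true, (rd_k X).+1, i) \in Dm /\
        ~ obj X false (rd_k X).+1 (e (true, (rd_k X).+1, i))].

Definition extends (B : eqType) (e : slot -> node B) (Dm : seq slot) (e' : slot -> node B) (Dm' : seq slot) :=
  {subset Dm <= Dm'} /\ forall s, s \in Dm -> e' s = e s.

Definition matches (B : eqType) (X : realization_data B) (e : slot -> node B) (Dm : seq slot) (x y : config) M :=
  forall b l j i, (b, l.+1, j) \in Dm -> (if l is 0 then i < M else (b, l, i) \in Dm) ->
    side x y b (l, j, i) = pull (rd_test X) (rd_row X) e b (l, j, i).

Definition shares (B : eqType) (X : realization_data B) (e : slot -> node B) (Dm : seq slot) (x y : config) :=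
  low (rd_k X) x y /\ forall i i', (true, (rd_k X).+1, i) \in Dm -> (false, (rd_k X).+1, i') \in Dm ->
    e (true, (rd_k X).+1, i) = e (false, (rd_k X).+1, i') ->
    forall a, x (rd_k X, i, a) = y (rd_k X, i', a).

Lemma extends_refl (B : eqType) (e : slot -> node B) Dm : extends e Dm e Dm. Proof. by split. Qed.

Lemma extends_trans (B : eqType) (e1 e2 e3 : slot -> node B) D1 D2 D3 :
  extends e1 D1 e2 D2 -> extends e2 D2 e3 D3 -> extends e1 D1 e3 D3.
Proof. by move=> [s1 H1] [s2 H2]; split=> [s /s1/s2|s sD] //; rewrite (H2 _ (s1 _ sD)); exact: H1. Qed.

(** Up to level [k] a slot is filled together with its twin on the other side. *)
Definition new_slot k (s0 s : slot) :=
  [&& s.1.2 == s0.1.2, s.2 == s0.2 & (s.1.1 == s0.1.1) || (s0.1.2 <= k)].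

Lemma obj_low (B : eqType) (X : realization_data B) b b' l u : admissible X -> l <= rd_k X ->
  obj X b l u -> obj X b' l u.
Proof.
move=> [_ com _ _ _] lk H v vu; have [Sv dv] := H v vu; split=> //.
by apply: com Sv; exact: leq_trans dv lk.
Qed.

Lemma add_slot (B : eqType) (X : realization_data B) e Dm (s0 : slot) (u : node B) :
  admissible X -> valid X e Dm -> s0 \notin Dm -> 0 < s0.1.2 -> obj X s0.1.1 s0.1.2 u ->
  (forall i, (s0.1.1, s0.1.2, i) \in Dm -> e (s0.1.1, s0.1.2, i) <> u) ->
  exists e' Dm', [/\ valid X e' Dm', extends e Dm e' Dm',
    forall s, (s \in Dm') = new_slot (rd_k X) s0 s || (s \in Dm) &
    forall s, e' s = if new_slot (rd_k X) s0 s then u else e s].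
Proof.
move=> adm [v1 v2 v3 v4 v5] s0D l0 Lu fr; case: s0 s0D l0 Lu fr => [[b0 l0] i0] /= s0D l0p Lu fr.
set k := rd_k X in v3 v4 v5 *.
have newD s : new_slot k (b0, l0, i0) s -> s \notin Dm.
  case: s => [[b l] i] /and3P[/= /eqP -> /eqP ->] /orP[/eqP -> //|lk].
  by apply: contra s0D; exact: v4.
pose e' s := if new_slot k (b0, l0, i0) s then u else e s.
pose Dm' := (b0, l0, i0) :: (if l0 <= k then [:: (~~ b0, l0, i0)] else [::]) ++ Dm.
have memD s : (s \in Dm') = new_slot k (b0, l0, i0) s || (s \in Dm).
  case: s => [[b l] i]; rewrite /Dm' /new_slot inE mem_cat /= orbA; congr (_ || _).
  case: (l0 <= k); rewrite /= ?inE ?in_nil !xpair_eqE ?orbT ?orbF.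
    by case: (b) (b0) => -[]; case: (l == l0); case: (i == i0).
  by case: (b == b0); case: (l == l0); case: (i == i0).
have eD s : s \in Dm -> e' s = e s.
  by rewrite /e'; case: ifP => // /newD /negbTE ->.
have lev b i l : new_slot k (b0, l0, i0) (b, l, i) -> obj X b l u.
  move=> /and3P[/= /eqP -> _ /orP[/eqP -> //|lk]]; exact: obj_low lk Lu.
exists e', Dm'; split=> //; last by split=> // s sD; rewrite memD sD orbT.
have same_new b b' l i : l <= k -> new_slot k (b0, l0, i0) (b, l, i) -> new_slot k (b0, l0, i0) (b', l, i).
  by move=> lk /and3P[/= /eqP e1 /eqP -> _]; rewrite /new_slot /= e1 !eqxx -e1 lk orbT.
split.
- move=> b l i; rewrite memD => /orP[n|sD]; last by rewrite eD //; exact: v1.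
  rewrite /e' n; split; last exact: lev n.
  by case/and3P: n => /= /eqP ->.
- move=> b l i i'; rewrite !memD.
  have nold j j' : new_slot k (b0, l0, i0) (b, l, j) -> (b, l, j') \in Dm -> e (b, l, j') <> u.
    move=> /and3P[/= /eqP -> _ /orP[/eqP -> jD|lk jD]]; first exact: fr.
    rewrite (v3 _ b0 _ _ lk); apply: fr; exact: v4 jD.
  case/orP=> [n|iD]; case/orP=> [n'|iD'].
  + by case/and3P: n => _ /= /eqP -> _; case/and3P: n' => _ /= /eqP -> _.
  + by rewrite {1}/e' n eD // => /esym /(nold _ _ n iD').
  + by rewrite eD // /e' n' => /(nold _ _ n' iD).
  + by rewrite !eD //; exact: v2.
- move=> b b' l i lk; rewrite /e'; case: ifP => [/(same_new _ b' _ _ lk) -> //|].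
  case: ifP => [/(same_new _ b _ _ lk) -> //|_ _]; exact: v3.
- move=> b b' l i lk; rewrite !memD => /orP[/(same_new _ b' _ _ lk) -> //|iD].
  by apply/orP; right; apply: v4 iD.
- move=> i /v5[iD nL]; rewrite memD iD orbT; split=> //.
  by rewrite eD.
Qed.

(** The node comes from the extension property. Up to level [k] it serves both sides, so the nodes
    above it are collected from both; if one node of level [k.+1] occupies slots on both sides,
    [shares] makes the two demands consistent. *)
Lemma realize_one (B : eqType) (X : realization_data B) e Dm x y M (s0 : slot) :
  admissible X -> valid X e Dm -> matches X e Dm x y M -> shares X e Dm x y -> 0 < s0.1.2 ->
  exists e' Dm', [/\ valid X e' Dm', extends e Dm e' Dm', matches X e' Dm' x y M,
    shares X e' Dm' x y & s0 \in Dm'].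
Proof.
move=> adm va ma sh l0p; have [s0D|s0D] := boolP (s0 \in Dm); first by exists e, Dm; split=> //; exact: extends_refl.
have [t2 com sep sepk pre] := adm; have [v1 v2 v3 v4 v5] := va; have [lo shk] := sh.
case: s0 l0p s0D => [[b0 l0] i0] /= l0p s0D.
set k := rd_k X in com sepk v3 v4 v5 lo shk *.
pose pt b c := side x y b c.
have ptlow b b' (c : coord) : c.1.1 < k -> pt b c = pt b' c.
  by move=> /lo; rewrite /pt /side; case: b; case: b'.
pose LW := [seq e s | s <- Dm & (s.1.1 == b0) && (s.1.2 == l0.-1)].
pose LT := [seq e s | s <- Dm & (s.1.2 == l0.+1) && ((s.1.1 == b0) || (l0 <= k))].
(* Memberships are prescribed for nodes instead of slots; [betaE] and [gammaE] check that slots with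
   the same node make the same demand. *)
pose beta w := `[<exists a, [/\ (b0, l0.-1, a) \in Dm, e (b0, l0.-1, a) = w & pt b0 (l0.-1, i0, a)]>].
pose gamma t := `[<exists b a, [/\ (b, l0.+1, a) \in Dm, (b == b0) || (l0 <= k), e (b, l0.+1, a) = t &
  pt b (l0, a, i0)]>].
pose T : set B := fun v => rd_S X b0 v \/ (l0 <= k /\ exists b, rd_S X b v).
have betaE a : (b0, l0.-1, a) \in Dm -> beta (e (b0, l0.-1, a)) = pt b0 (l0.-1, i0, a).
  move=> aD; apply/asboolP/idP => [[a' [aD' ea pa]]|pa]; last by exists a.
  by rewrite (v2 _ _ _ _ aD aD' (esym ea)).
have gammaE b a : (b == b0) || (l0 <= k) -> (b, l0.+1, a) \in Dm ->
    gamma (e (b, l0.+1, a)) = pt b (l0, a, i0).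
  move=> bb aD; apply/asboolP/idP => [[b' [a' [aD' bb' ea pa]]]|pa]; last by exists b, a.
  have [bE|bN] := eqVneq b b'; first by subst b'; rewrite (v2 _ _ _ _ aD aD' (esym ea)).
  have lk : l0 <= k.
    by case/orP: bb => // /eqP b1; case/orP: bb' => // /eqP b2; move: bN; rewrite b1 b2 eqxx.
  suff -> : pt b (l0, a, i0) = pt b' (l0, a', i0) by [].
  move: lk; rewrite leq_eqVlt => /orP[/eqP lk|lk].
    rewrite {}lk in aD aD' ea *; rewrite /pt.
    case: b aD bN ea {bb pa} => aD; case: b' aD' {bb'} => //= aD' _ ea.
      exact: (shk _ _ aD aD').
    exact/esym/(shk _ _ aD' aD).
  rewrite (ptlow b b') //=; congr (pt _ (_, _, _)).
  by apply: (v2 b' l0.+1) => //; [exact: v4 aD|rewrite ea; exact: v3].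
(* A row of level 1 cannot be adjusted afterwards, so its first [M] bits are put into the tag. *)
have [||||u [Lu uf up uW uT]] := @extension B (rd_d X) (rd_test X) (rd_S X b0) T l0 LW LT beta gamma
    (mkseq (fun i => pt b0 (0, i0, i)) M) [seq e s | s <- Dm].
- exact: t2.
- move=> o o' To To' do_ do' no; have [lk|lk] := leqP l0 k.
    have H z : T z -> exists b, rd_S X b z by case=> [|[_ ?]] //; exists b0.
    by apply: (sepk b0 l0) => //; exact: H.
  have H z : T z -> rd_S X b0 z by case=> // -[]; rewrite leqNgt lk.
  by apply: sep => //; exact: H.
- move=> w /mapP[[[b l] a]]; rewrite mem_filter /= => /andP[/andP[/eqP -> /eqP ->] sD] -> v vu.
  by have [_ /(_ v vu)] := v1 _ _ _ sD.
- move=> w /mapP[[[b l] a]]; rewrite mem_filter /= => /andP[/andP[/eqP -> bb] sD] -> v vu.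
  have [_ /(_ v vu)[Sv dv]] := v1 _ _ _ sD; split=> //.
  by case/orP: bb => [/eqP be|lk]; [left; rewrite -be|right; split=> //; exists b].
have ufr b l a : (b, l, a) \in Dm -> e (b, l, a) <> u.
  by move=> aD ea; move/negP: uf; apply; rewrite -ea map_f.
have [|e' [Dm' [va' ex' memD eE]]] := @add_slot B X e Dm (b0, l0, i0) u adm va s0D l0p Lu.
  by move=> i; exact: ufr.
have uprow i : i < M -> rd_row X u i = pt b0 (0, i0, i).
  by move=> iM; rewrite pre up ?size_mkseq // nth_mkseq.
have eqn b l i : new_slot k (b0, l0, i0) (b, l, i) -> [/\ l = l0, i = i0 & (b = b0) \/ l0 <= k].
  by move=> /and3P[/= /eqP -> /eqP ->] /orP[/eqP|]; split=> //; [left|right].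
have oldl b l i : l <> l0 -> (b, l, i) \in Dm' -> (b, l, i) \in Dm.
  by move=> ll; rewrite memD => /orP[/eqn[]|].
exists e', Dm'; split=> //; last by rewrite memD /new_slot !eqxx.
- move=> b l j i; rewrite memD => /orP[/eqn[ll -> bb]|jD].
    subst l0; case: l => [|l] in l0p s0D LW LT beta gamma T betaE gammaE Lu uW uT eqn oldl memD eE bb *.
      move=> iM; rewrite /pull /= eE.
      have -> /= : new_slot k (b0, 1, i0) (b, 1, i0) by rewrite /new_slot /= !eqxx /=; case: bb => [->|->]; rewrite ?eqxx ?orbT.
      rewrite uprow //; case: bb => [-> //|k1]; exact: ptlow.
    move=> /oldl iD; have {}iD : (b, l.+1, i) \in Dm by apply: iD; lia.
    rewrite /pull /= !eE.
    have -> /= : new_slot k (b0, l.+2, i0) (b, l.+2, i0) by rewrite /new_slot /= !eqxx /=; case: bb => [->|->]; rewrite ?eqxx ?orbT.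
    have -> /= : new_slot k (b0, l.+2, i0) (b, l.+1, i) = false by apply/negbTE/negP => /eqn[]; lia.
    have iD0 : (b0, l.+1, i) \in Dm by case: bb => [<- //|lk]; apply: v4 iD; lia.
    have -> : e (b, l.+1, i) = e (b0, l.+1, i) by case: bb => [-> //|lk]; apply: v3; lia.
    rewrite uW ?betaE //; last by apply/mapP; exists (b0, l.+1, i) => //; rewrite mem_filter /= !eqxx.
    by case: bb => [-> //|lk]; apply: ptlow => /=; lia.
  have njD : new_slot k (b0, l0, i0) (b, l.+1, j) = false.
    by apply/negbTE/negP => /eqn[ll ji bb]; move: jD; rewrite ll ji; case: bb => [->|lk];
      apply/negP => //; apply: contra s0D; exact: v4.
  case: l => [|l] in jD njD *.
    move=> iM; have := ma b 0 j i jD iM; rewrite /pull /= eE.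
    by rewrite /= njD.
  rewrite memD => /orP[ni|iD].
    have [ll -> bb] := eqn _ _ _ ni; rewrite ll in jD njD ni *.
    have bb' : (b == b0) || (l0 <= k) by case: bb => [->|->]; rewrite ?eqxx ?orbT.
    rewrite /pull /=; case: l0 => [|l0'] // in l0p s0D LW LT beta gamma T betaE gammaE Lu uW uT eqn oldl memD eE bb bb' ll jD njD ni *.
    rewrite !eE njD /=.
    have -> /= : new_slot k (b0, l0'.+1, i0) (b, l0'.+1, i0) by rewrite /new_slot /= !eqxx /=.
    by rewrite uT ?gammaE //; apply/mapP; exists (b, l0'.+2, j) => //; rewrite mem_filter /= eqxx bb'.
  have niD : new_slot k (b0, l0, i0) (b, l.+1, i) = false.
    by apply/negbTE/negP => /eqn[ll ji bb]; move: iD; rewrite ll ji; case: bb => [->|lk];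
      apply/negP => //; apply: contra s0D; exact: v4.
  have := ma b l.+1 j i jD iD; rewrite /pull /= !eE.
  by rewrite njD niD.
- split=> // i i'; rewrite !memD.
  have nk b j : new_slot k (b0, l0, i0) (b, k.+1, j) -> b = b0 /\ l0 = k.+1.
    by move=> /eqn[<- _ [->|]]; rewrite ?ltnn.
  case/orP=> [ni|iD]; case/orP=> [ni'|iD'].
  + by have [b1 _] := nk _ _ ni; have [b2 _] := nk _ _ ni'; rewrite -b1 in b2.
  + rewrite !eE ni; case: ifP => [ni' |_ /esym /(ufr _ _ _ iD') //].
    by have [b1 _] := nk _ _ ni; have [b2 _] := nk _ _ ni'; rewrite -b1 in b2.
  + rewrite !eE ni'; case: ifP => [ni|_ /(ufr _ _ _ iD) //].
    by have [b1 _] := nk _ _ ni; have [b2 _] := nk _ _ ni'; rewrite -b1 in b2.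
  + by case: ex' => _ Hex; rewrite !Hex //; exact: shk.
Qed.

Lemma realize_many (B : eqType) (X : realization_data B) e Dm x y M (ss : seq slot) :
  admissible X -> valid X e Dm -> matches X e Dm x y M -> shares X e Dm x y ->
  (forall s, s \in ss -> 0 < s.1.2) ->
  exists e' Dm', [/\ valid X e' Dm', extends e Dm e' Dm', matches X e' Dm' x y M,
    shares X e' Dm' x y & {subset ss <= Dm'}].
Proof.
move=> adm; elim: ss e Dm => [|s ss IH] e Dm va ma sh Hs; first by exists e, Dm; split=> //; exact: extends_refl.
have [|e1 [D1 [va1 ex1 ma1 sh1 sD1]]] := @realize_one B X e Dm x y M s adm va ma sh.
  by apply: Hs; rewrite inE eqxx.
have [|e2 [D2 [va2 ex2 ma2 sh2 sD2]]] := IH e1 D1 va1 ma1 sh1.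
  by move=> t ts; apply: Hs; rewrite inE ts orbT.
exists e2, D2; split=> //; first exact: extends_trans ex1 ex2.
by move=> t; rewrite inE => /orP[/eqP ->|/sD2 //]; case: ex2 => + _; apply.
Qed.

(** If the rows of level 1 were arbitrary, density of [D] would extend the finite part into [D]. So
    the rows that permit this form a dense set, and the actual rows, being mutually generic, belong
    to it. *)
Lemma meet_requirement (B : eqType) (X : realization_data B) e Dm (D : config -> config -> Prop) :
  admissible X -> valid X e Dm -> open_requirement D -> dense_requirement (rd_k X) (rd_bad X) D ->
  generic_rows (fun u => exists b, obj X b 1 u) (rd_row X) (rd_k X) D ->
  exists x y M, [/\ forall x' y', cube M x x' -> cube M y y' -> D x' y',
    matches X e Dm x y M & shares X e Dm x y].
Proof.
move=> adm [v1 v2 v3 v4 v5] oD dD gen.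
set k := rd_k X in v3 v4 v5 dD gen *.
pose L1 := [seq s <- Dm | s.1.2 == 1].
(* Both sides may hold the same node, so rows are indexed by distinct nodes. *)
pose vals := undup (map e L1).
pose num s := index (e s) vals.
have num_lt s : s \in L1 -> num s < size vals by move=> sL; rewrite index_mem mem_undup map_f.
have num_inj s s' : s \in L1 -> s' \in L1 -> num s = num s' -> e s = e s'.
  move=> sL sL' ee; have H t : t \in L1 -> nth (e s) vals (num t) = e t.
    by move=> tL; rewrite nth_index // mem_undup map_f.
  by rewrite -(H s) // ee H.
have L1E b l i : ((b, l, i) \in L1) = (l == 1) && ((b, l, i) \in Dm) by rewrite mem_filter.
pose idx := [seq ((s.1.1, s.2), num s) | s <- L1].
pose up (s s' : slot) := (s.1.1 == s'.1.1) && (s.1.2 == s'.1.2.+1).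
pose tab : seq ((bool * coord) * bool) := [seq ((s.1.1, (s'.1.2, s.2, s'.2)), member (rd_test X) (e s') (e s)) |
  s <- Dm, s' <- [seq s' <- Dm | up s s']].
pose top (s s' : slot) := [&& s.1.1, ~~ s'.1.1, s.1.2 == k.+1, s'.1.2 == k.+1 & e s == e s'].
pose shr := [seq (s.2, s'.2) | s <- Dm, s' <- [seq s' <- Dm | top s s']].
have shrP p : p \in shr <-> [/\ (true, k.+1, p.1) \in Dm, (false, k.+1, p.2) \in Dm &
    e (true, k.+1, p.1) = e (false, k.+1, p.2)].
  split=> [/allpairsPdep[[[b l] i] [[[b' l'] i'] [sD + ->]]]|[D1 D2 ee]] /=.
    rewrite mem_filter => /andP[/and5P[/= b1 /negbTE b2 /eqP l1 /eqP l2 /eqP ee] sD'].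
    by move: sD sD' ee; rewrite b1 b2 l1 l2.
  apply/allpairsPdep; exists (true, k.+1, p.1), (false, k.+1, p.2); split=> //; last by case: (p).
  by rewrite mem_filter /top /= !eqxx ee eqxx.
have inj_shr : partial_injection shr.
  move=> p p' /shrP[D1 D2 ee] /shrP[D1' D2' ee']; split=> pp.
    by apply: (v2 _ _ _ _ D2 D2'); rewrite -ee -ee' pp.
  by apply: (v2 _ _ _ _ D1 D1'); rewrite ee ee' pp.
have bad_shr p : p \in shr -> ~~ rd_bad X p.1.
  move=> /shrP[D1 D2 ee]; apply/negP => /v5[_]; apply; rewrite ee.
  by have [] := v1 _ _ _ D2.
have dense : dense_rows (size vals) (requirement_rows k D shr tab idx).
  move=> w M0.
  pose pt b : config := fun c => if (c.1.1 == 0) && ((b, 1, c.1.2) \in Dm) then w (num (b, 1, c.1.2)) c.2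
    else pull (rd_test X) (rd_row X) e b c.
  have pt_low : low k (pt true) (pt false).
    move=> [[l j] i] /= lk; rewrite /pt /=; case: l lk => [|l] lk /=.
      have -> : ((true, 1, j) \in Dm) = ((false, 1, j) \in Dm) by apply/idP/idP; apply: v4.
      by rewrite /num /pull /= (v3 true false).
    by rewrite /pull /= (v3 true false) ?(v3 true false l.+2) // ltnW.
  have pt_shr p : p \in shr -> forall a, pt true (k, p.1, a) = pt false (k, p.2, a).
    move=> /shrP[D1 D2 ee] a; rewrite /pt /=; case: (posnP k) => k0.
      by rewrite k0 /= in D1 D2 ee *; rewrite D1 D2 /num ee.
    rewrite -(prednK k0) /pull /= (prednK k0) (v3 true false) //.
    by rewrite ee.
  have pt_num s : s \in L1 -> forall i, pt s.1.1 (0, s.2, i) = w (num s) i.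
    by case: s => [[b l] j]; rewrite L1E => /andP[/eqP -> sD] i; rewrite /pt /= sD.
  pose A := map (fun e => e.1.2) tab ++ [seq (0, s.2, i) | s <- L1, i <- iota 0 M0].
  have [x [y [Dxy [lo sh] ax ay]]] := dD shr (pt true) (pt false) A inj_shr bad_shr (conj pt_low pt_shr).
  have agr b : agree A (pt b) (side x y b) by case: b.
  have [M HM] := oD _ _ Dxy.
  (* On different sides, slots with one node have equal rows by the sharing when [k = 0], and by
     equality of the lower levels when [k > 0]. *)
  have welldef s s' i : s \in L1 -> s' \in L1 -> num s = num s' ->
      side x y s.1.1 (0, s.2, i) = side x y s'.1.1 (0, s'.2, i).
    move=> sL sL' /(num_inj _ _ sL sL'); case: s s' sL sL' => [[b l] j] [[b' l'] j'].
    rewrite !L1E => /andP[/eqP -> sD] /andP[/eqP -> sD'] ee /=.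
    have [bb|bb] := eqVneq b b'; first by subst b'; rewrite (v2 _ _ _ _ sD sD' ee).
    case: (posnP k) => k0.
      have shh j1 j2 : (true, 1, j1) \in Dm -> (false, 1, j2) \in Dm -> e (true, 1, j1) = e (false, 1, j2) ->
          x (0, j1, i) = y (0, j2, i).
        by move=> D1 D2 e12; rewrite -k0; apply: (sh (j1, j2)); apply/shrP; rewrite k0.
      case: b b' sD sD' ee bb => -[] // sD sD' ee _; first exact: shh.
      exact/esym/shh.
    have -> : j = j'.
      by apply: (v2 b' 1) => //; [exact: v4 sD|rewrite -ee; exact: v3].
    by have := lo (0, j', i) k0; case: (b); case: (b') => //= ->.
  pose w' r i := if [seq s <- L1 | num s == r] is s :: _ then side x y s.1.1 (0, s.2, i) else w r i.
  have w'E s i : s \in L1 -> w' (num s) i = side x y s.1.1 (0, s.2, i).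
    move=> sL; rewrite /w'; case E: [seq _ <- _ | _] => [|s' ss].
      by have := mem_filter (fun s' => num s' == num s) s L1; rewrite E sL eqxx.
    have : s' \in [seq s0 <- L1 | num s0 == num s] by rewrite E inE eqxx.
    by rewrite mem_filter => /andP[/eqP ns sL']; exact: welldef.
  exists w'; split.
    move=> r i rv iM; rewrite /w'; case E: [seq _ <- _ | _] => [//|s ss].
    have : s \in [seq s0 <- L1 | num s0 == r] by rewrite E inE eqxx.
    rewrite mem_filter => /andP[/eqP <- sL]; rewrite -agr ?pt_num //.
    rewrite /A mem_cat; apply/orP; right; apply/allpairsP; exists (s, i); split=> //=.
    by rewrite mem_iota.
  exists x, y, M; split=> //.
  - move=> t tt; rewrite -agr; last by rewrite /A mem_cat; apply/orP; left; apply: (map_f (fun e => e.1.2)).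
    move: tt => /allpairsPdep[[[b l] j] [[[b' l'] i] [sD + ->]]].
    rewrite mem_filter => /andP[/andP[/= /eqP bb /eqP ll] sD']; subst b' l.
    by have [l0 _] := v1 _ _ _ sD'; rewrite /pt /=; case: l' l0 {sD sD'}.
  - by move=> t i /mapP[s sL ->] iM /=; rewrite w'E.
have oi t : t \in idx -> t.2 < size vals by move=> /mapP[s sL ->]; exact: num_lt.
pose u0 : node B := (0, [::]).
have [||x [y [M [HM [lo sh] tb ix]]]] := gen shr tab idx (size vals) oi dense (nth u0 vals).
- move=> i iv; have := mem_nth u0 iv; rewrite mem_undup => /mapP[[[b l] j]].
  by rewrite L1E => /andP[/eqP -> sD] ->; exists b; have [] := v1 _ _ _ sD.
- by move=> i i' iv iv' /eqP; rewrite nth_uniq ?undup_uniq // => /eqP.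
exists x, y, M; split=> //; last first.
  by split=> // i i' iD iD' ee; apply: (sh (i, i')); apply/shrP.
move=> b [|l] j i jD.
  move=> iM; have sL : (b, 1, j) \in L1 by rewrite L1E jD.
  have := ix ((b, j), num (b, 1, j)) i; rewrite /= => -> //; last by apply/mapP; exists (b, 1, j).
  by rewrite /pull /= nth_index // mem_undup map_f.
move=> iD; have := tb ((b, (l.+1, j, i)), member (rd_test X) (e (b, l.+1, i)) (e (b, l.+2, j))).
apply; apply/allpairsPdep; exists (b, l.+2, j), (b, l.+1, i); split=> //.
by rewrite mem_filter /up /= !eqxx.
Qed.

Definition slot_block M : seq slot :=
  [seq (p, i) | p <- [seq (b, l) | b <- [:: true; false], l <- iota 1 M], i <- iota 0 M].

Lemma mem_slot_block M b l i : ((b, l, i) \in slot_block M) = (0 < l <= M) && (i < M).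
Proof.
apply/allpairsP/idP => [[[p j] [/allpairsP[[c m] [_ mM ->]] jM [_ -> ->]]]|/andP[lM iM]].
  by move: mM jM; rewrite !mem_iota /= add0n add1n ltnS => -> ->.
exists ((b, l), i); split=> //; last by rewrite mem_iota.
apply/allpairsP; exists (b, l); split=> //; first by case: (b); rewrite !inE.
by rewrite mem_iota /= add1n ltnS.
Qed.

(** Once [D] is secured by a cube, all slots of that cube are filled in agreement with it; from then
    on the enumeration itself meets [D]. *)
Lemma extend_step (B : eqType) (X : realization_data B) e Dm (D : config -> config -> Prop)
    N b l (u : node B) :
  admissible X -> valid X e Dm -> open_requirement D -> dense_requirement (rd_k X) (rd_bad X) D ->
  generic_rows (fun u => exists b, obj X b 1 u) (rd_row X) (rd_k X) D ->
  exists e' Dm', [/\ valid X e' Dm', extends e Dm e' Dm', {subset slot_block N <= Dm'},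
    exists x y M, [/\ forall x' y', cube M x x' -> cube M y y' -> D x' y', {subset slot_block M <= Dm'} &
      forall b, cube M (side x y b) (pull (rd_test X) (rd_row X) e' b)] &
    0 < l -> obj X b l u -> exists2 i, (b, l, i) \in Dm' & e' (b, l, i) = u].
Proof.
move=> adm va oD dD gen.
have [x [y [M [HM ma sh]]]] := meet_requirement adm va oD dD gen.
have [|e1 [D1 [va1 ex1 ma1 sh1 sD1]]] := @realize_many B X e Dm x y M (slot_block (maxn M N)) adm va ma sh.
  by move=> [[c m] i]; rewrite mem_slot_block => /andP[/andP[]].
have [e2 [D2 [va2 ex2 H2]]] : exists e' Dm', [/\ valid X e' Dm', extends e1 D1 e' Dm' &
    0 < l -> obj X b l u -> exists2 i, (b, l, i) \in Dm' & e' (b, l, i) = u].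
  have [[l0 Lu]|n] := pselect (0 < l /\ obj X b l u); last first.
    by exists e1, D1; split=> //; [exact: extends_refl|move=> l0 Lu; case: n].
  have [H|nH] := pselect (exists2 i, (b, l, i) \in D1 & e1 (b, l, i) = u).
    by exists e1, D1; split=> //; exact: extends_refl.
  have fresh : (b, l, (\max_(s <- D1) s.2).+1) \notin D1.
    apply/negP => sD; have := @leq_bigmax_seq _ D1 xpredT (fun s : slot => s.2) _ sD isT.
    by rewrite ltnn.
  have [|e2 [D2 [va2 ex2 mem2 eE2]]] := add_slot adm va1 fresh l0 Lu.
    by move=> i iD ei; apply: nH; exists i.
  exists e2, D2; split=> // _ _; exists (\max_(s <- D1) s.2).+1.
    by rewrite mem2 /new_slot !eqxx.
  by rewrite eE2 /new_slot !eqxx.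
have sub2 P : {subset slot_block P <= slot_block (maxn M N)} -> {subset slot_block P <= D2}.
  by move=> sP s /sP /sD1; case: ex2 => + _; apply.
exists e2, D2; split=> //.
- exact: extends_trans ex1 ex2.
- by apply: sub2 => -[[c m] i]; rewrite !mem_slot_block; lia.
- exists x, y, M; split=> //; first by apply: sub2 => -[[c m] i]; rewrite !mem_slot_block; lia.
  move=> c m j i mM jM iM; have D1P p q : 0 < p <= M -> q < M -> (c, p, q) \in D1.
    by move=> pM qM; apply: sD1; rewrite mem_slot_block; lia.
  have -> : side x y c (m, j, i) = pull (rd_test X) (rd_row X) e1 c (m, j, i).
    apply: ma1; first exact: D1P.
    by case: m mM => // m mM; apply: D1P => //; lia.
  case: ex2 => _ ex2; rewrite /pull /=; case: m mM => [|m] mM.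
    by rewrite ex2 //; exact: D1P.
  by rewrite !ex2 //; apply: D1P => //; lia.
Qed.

(** Each stage meets one requirement, fills a block of slots and gives a slot to one object, so the
    limit is total and enumerates both towers completely. *)
Theorem joint_realization (B : eqType) (X : realization_data B) (D : nat -> config -> config -> Prop)
    (en : bool -> nat -> nat -> node B) (x0 : config) M0 e0 Dm0 :
  admissible X -> (forall n, open_requirement (D n)) ->
  (forall n, dense_requirement (rd_k X) (rd_bad X) (D n)) ->
  (forall n, generic_rows (fun u => exists b, obj X b 1 u) (rd_row X) (rd_k X) (D n)) ->
  (forall b l u, 0 < l -> obj X b l u -> exists m, en b l m = u) ->
  valid X e0 Dm0 -> matches X e0 Dm0 x0 x0 M0 -> shares X e0 Dm0 x0 x0 ->
  exists e : slot -> node B, [/\ forall b l i, 0 < l -> obj X b l (e (b, l, i)),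
    forall b l u, 0 < l -> obj X b l u -> exists i, e (b, l, i) = u,
    forall b b' l i, l <= rd_k X -> e (b, l, i) = e (b', l, i),
    cube M0 x0 (pull (rd_test X) (rd_row X) e true) &
    forall n, D n (pull (rd_test X) (rd_row X) e true) (pull (rd_test X) (rd_row X) e false)].
Proof.
move=> adm oD dD gen Hen va0 ma0 sh0.
have [|e1 [D1 [va1 ex1 ma1 sh1 sD1]]] := @realize_many B X e0 Dm0 x0 x0 M0 (slot_block M0) adm va0 ma0 sh0.
  by move=> [[c m] i]; rewrite mem_slot_block => /andP[/andP[]].
pose T := ((slot -> node B) * seq slot)%type.
pose task n : bool * nat * nat := odflt (true, 0, 0) (unpickle n).
pose P n (p q : T) := [/\ extends p.1 p.2 q.1 q.2, {subset slot_block n.+1 <= q.2},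
    exists x y M, [/\ forall x' y', cube M x x' -> cube M y y' -> D n x' y', {subset slot_block M <= q.2} &
      forall b, cube M (side x y b) (pull (rd_test X) (rd_row X) q.1 b)] &
    0 < (task n).1.2 -> obj X (task n).1.1 (task n).1.2 (en (task n).1.1 (task n).1.2 (task n).2) ->
      exists2 i, ((task n).1.1, (task n).1.2, i) \in q.2 &
        q.1 ((task n).1.1, (task n).1.2, i) = en (task n).1.1 (task n).1.2 (task n).2].
have [|n [e Dm] /= va|st [st0 Hst]] := @dependent_sequence T (fun p => valid X p.1 p.2) P (e1, D1).
- by [].
- have [e' [Dm' [va' ex' sb rq ob]]] := @extend_step B X e Dm (D n) n.+1 (task n).1.1 (task n).1.2
    (en (task n).1.1 (task n).1.2 (task n).2) adm va (oD n) (dD n) (gen n).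
  by exists (e', Dm'); split.
have ext n m : extends (st n).1 (st n).2 (st (m + n)).1 (st (m + n)).2.
  elim: m => [|m IH]; first exact: extends_refl.
  by have [_ [ex _ _ _]] := Hst (m + n); rewrite addSn; exact: extends_trans IH ex.
have agr n m s : s \in (st n).2 -> s \in (st m).2 -> (st n).1 s = (st m).1 s.
  move=> sn sm; case: (leqP n m) => [nm|/ltnW mn].
    by have [_ /(_ s sn)] := ext n (m - n); rewrite subnK.
  by have [_ /(_ s sm)] := ext m (n - m); rewrite subnK.
pose h (s : slot) := (maxn s.1.2 s.2).+1.
have inh s : 0 < s.1.2 -> s \in (st (h s)).2.
  case: s => [[b l] i] /= l0; have [_ [_ sub _ _]] := Hst (maxn l i); apply: sub.
  by rewrite mem_slot_block; lia.
pose e s := (st (h s)).1 s.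
have eE n s : 0 < s.1.2 -> s \in (st n).2 -> e s = (st n).1 s.
  by move=> s0 sn; apply: agr => //; exact: inh.
have pullE n M b : {subset slot_block M <= (st n).2} -> forall x,
    cube M x (pull (rd_test X) (rd_row X) (st n).1 b) -> cube M x (pull (rd_test X) (rd_row X) e b).
  move=> sub x H l j i lM jM iM; rewrite (H l j i) //.
  have inn p q : 0 < p <= M -> q < M -> (b, p, q) \in (st n).2.
    by move=> pM qM; apply: sub; rewrite mem_slot_block pM.
  rewrite /pull /=; case: l lM => [|l] lM; first by rewrite (eE n) //; exact: inn.
  by rewrite !(eE n) //; apply: inn => //; lia.
exists e; split.
- move=> b l i l0; have := inh (b, l, i) l0.
  have [va _] := Hst (h (b, l, i)); case: va => v1 _ _ _ _ /v1[_]; exact.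
- move=> b l u l0 Lu; have [m um] := Hen b l u l0 Lu.
  have [_ [_ _ _]] := Hst (pickle (b, l, m)); rewrite /task pickleK /= um => /(_ l0 Lu)[i iD ei].
  by exists i; rewrite (eE _ _ _ iD).
- move=> b b' l i lk; rewrite /e /h /=.
  by have [[_ _ + _ _] _] := Hst (maxn l i).+1; apply.
- apply: (pullE 0); first by rewrite st0.
  rewrite st0 => l j i lM jM iM; have D1P p q : 0 < p <= M0 -> q < M0 -> (true, p, q) \in D1.
    by move=> pM qM; apply: sD1; rewrite mem_slot_block pM.
  apply: (ma1 true l j i); first by rewrite D1P.
  by case: l lM => // l lM; apply: D1P => //; lia.
- move=> n; have [_ [_ _ [x [y [M [HM sub cu]]]] _]] := Hst n.
  by apply: HM; [apply: (pullE n.+1) => //; exact: (cu true)|apply: (pullE n.+1) => //; exact: (cu false)].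
Qed.

(** * Divergence *)

Lemma cube_agree (A : seq coord) : exists M, forall x y, cube M x y -> agree A x y.
Proof.
elim: A => [|[[l j] i] A [M HM]]; first by exists 0.
exists (l + j + i + M).+1 => x y xy c; rewrite inE => /orP[/eqP ->|cA]; first by apply: xy; lia.
by apply: (HM x y) cA => l' j' i' ? ? ?; apply: xy; lia.
Qed.

Lemma cube_trans M x y z : cube M x y -> cube M y z -> cube M x z.
Proof. by move=> H H' l j i ? ? ?; rewrite H ?H'. Qed.

Lemma cube_le M N x y : M <= N -> cube N x y -> cube M x y.
Proof. by move=> MN H l j i ? ? ?; apply: H; lia. Qed.

Definition partner (shr : seq (nat * nat)) j := ohead [seq p.1 | p <- shr & p.2 == j].

Lemma partnerP shr j : partial_injection shr ->
  forall i, partner shr j = Some i <-> (i, j) \in shr.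
Proof.
move=> pinj i; rewrite /partner.
have H i' : i' \in [seq p.1 | p <- shr & p.2 == j] <-> (i', j) \in shr.
  split=> [/mapP[[a c]]|ij]; first by rewrite mem_filter => /andP[/= /eqP -> ?] ->.
  by apply/mapP; exists (i', j) => //; rewrite mem_filter eqxx.
case: [seq _ | _ <- _ & _] H => [|a s] H; split=> //.
- by move=> /H.
- by case=> <-; apply/H; rewrite inE eqxx.
- move=> ij; have aj : (a, j) \in shr by apply/H; rewrite inE eqxx.
  by have [_ /(_ (erefl _)) /= ->] := pinj _ _ ij aj.
Qed.

(* For a sharing pair of points: where the first holds the bit that the second has at [c]. *)
Definition shared_coord k shr (c : coord) : option coord :=
  if c.1.1 < k then Some c
  else if c.1.1 == k then omap (fun i => (k, i, c.2)) (partner shr c.1.2) else None.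

Lemma shared_coord_inj k shr c c' d : partial_injection shr ->
  shared_coord k shr c = Some d -> shared_coord k shr c' = Some d -> c = c'.
Proof.
move=> pinj; case: c c' => [[l j] i] [[l' j'] i']; rewrite /shared_coord /=.
have P j0 i0 := partnerP j0 pinj i0.
case: ltnP => [lk [<-]|lk].
  case: ltnP => [_ [] -> -> -> //|lk']; case: eqP => // -> ; case: partner => //= a [] ll.
  by rewrite -ll ltnn in lk.
case: eqP => // -> ; case E: partner => [a|] //= [<-].
case: ltnP => [lk' [ll]|lk']; first by rewrite ll ltnn in lk'.
case: eqP => // ->; case E': partner => [a'|] //= [aa ->].
move/P: E; move/P: E'; rewrite aa => h1 h2.
by have [/(_ (erefl _)) /= -> _] := pinj _ _ h1 h2.
Qed.

Lemma sharing_coord k shr x y : partial_injection shr ->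
  sharing k shr x y <-> forall c d, shared_coord k shr c = Some d -> y c = x d.
Proof.
move=> pinj; split=> [[lo sh] [[l j] i] d|H]; rewrite /shared_coord /=.
  case: ltnP => [lk [<-]|lk]; first by rewrite lo.
  case: eqP => // ->; case E: partner => [a|] //= [<-].
  by move/(partnerP _ pinj): E => /sh.
split=> [c ck|[a j] /(partnerP _ pinj) E i /=].
  by rewrite (H c c) // /shared_coord ck.
by rewrite (H (k, j, i) (k, a, i)) // /shared_coord /= ltnn eqxx E.
Qed.

(** Bits are numbered by owner: [x2] borrows from [x1] the lower levels and the rows in [shr], and
    [y] borrows all bits that it shares. *)
Lemma generic_triple k shr (C : set config) x1 x2 y A : partial_injection shr -> comeager C ->
  low k x1 x2 -> (forall p, p \in shr -> forall a, x1 (k, p.1, a) = x2 (k, p.1, a)) ->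
  sharing k shr x1 y ->
  exists x1' x2' y', [/\ C x1', C x2' & C y'] /\ [/\ agree A x1 x1', agree A x2 x2' & agree A y y'] /\
    (sharing k shr x1' y' /\ sharing k shr x2' y').
Proof.
move=> pinj cC lo12 sh12 /(sharing_coord _ _ _ pinj) sh.
pose both (c : coord) := (c.1.1 < k) || (c.1.1 == k) && (c.1.2 \in map fst shr).
pose h (n : nat) (c : coord) : nat * coord :=
  if n == 1 then (~~ both c : nat, c) else
  if n == 2 then (if shared_coord k shr c is Some d then (0, d) else (2, c)) else (0, c).
have hi n : injective (h n).
  move=> c c'; rewrite /h; case: ifP => _; first by case.
  case: ifP => _; last by case.
  case E: shared_coord => [d|]; case E': shared_coord => [d'|] //; last by case.
  by case=> dd; rewrite -dd in E'; exact: shared_coord_inj E E'.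
pose u (e : nat * coord) := if e.1 == 0 then x1 e.2 else if e.1 == 1 then x2 e.2 else y e.2.
have bothE c : both c -> x1 c = x2 c.
  case: c => [[l j] i] /orP[/lo12 //|/andP[/= /eqP -> /mapP[p pS ->]]]; exact: sh12.
have u1 c : u (h 1 c) = x2 c.
  by rewrite /u /h /=; case B: (both c) => //=; exact: bothE.
have u2 c : u (h 2 c) = y c.
  by rewrite /u /h /=; case E: shared_coord => [d|] //=; rewrite (sh _ _ E).
have [v [uv Cv]] := generic_family u (map (h 0) A ++ map (h 1) A ++ map (h 2) A) hi cC.
move: uv => /agree_cat[uv0 /agree_cat[uv1 uv2]].
exists (v \o h 0), (v \o h 1), (v \o h 2); split=> //; split.
  by split=> c cA; [rewrite /= -uv0 ?map_f|rewrite /= -uv1 ?map_f|rewrite /= -uv2 ?map_f].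
have shb c d : shared_coord k shr c = Some d -> both d.
  rewrite /shared_coord /both; case: ifP => [lk [<-]|lk]; first by rewrite lk.
  case: eqP => // _; case E: partner => [a|] //= [<-] /=; rewrite eqxx ltnn /=.
  by apply/mapP; exists (a, c.1.2) => //; apply/(partnerP _ pinj).
by split; apply/(sharing_coord _ _ _ pinj) => c d E; rewrite /h /= E ?(shb c d E).
Qed.

Lemma comeager_requirement k bad (D : set config) : is_open D -> is_dense D ->
  [/\ open_requirement (fun x _ => D x), open_requirement (fun _ y => D y),
    dense_requirement k bad (fun x _ => D x) & dense_requirement k bad (fun _ y => D y)].
Proof.
move=> oD dD; have cD := open_dense_comeager oD dD.
have opn x : D x -> exists M, forall y, cube M x y -> D y.
  move=> /oD[A HA]; have [M HM] := cube_agree A; exists M => y xy; exact/HA/HM.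
split.
- by move=> x y /opn[M HM]; exists M => x' y' xx' _; exact: HM.
- by move=> x y /opn[M HM]; exists M => x' y' _; exact: HM.
- move=> shr x y A pinj _ sh.
  have [x1 [_ [y1 [[D1 _ _] [[a1 _ a3] [s1 _]]]]]] :=
    generic_triple A pinj cD (@low_refl k x) (fun _ _ _ => erefl) sh.
  by exists x1, y1.
- move=> shr x y A pinj _ sh.
  have [x1 [_ [y1 [[_ _ D1] [[a1 _ a3] [s1 _]]]]]] :=
    generic_triple A pinj cD (@low_refl k x) (fun _ _ _ => erefl) sh.
  by exists x1, y1.
Qed.

(** Opposite values on whole cubes make this an open requirement; outside the condition [A0] it is
    vacuous. *)
Definition diverging (C : set config) (b : config -> tree) (x0 : config) A0 s t (x y : config) :=
  agree A0 x0 x -> exists M m v, (forall x', C x' -> cube M x x' -> b x' s m = v) /\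
    (forall y', C y' -> cube M y y' -> b y' t m = ~~ v).

Lemma diverging_open C b x0 A0 s t : open_requirement (diverging C b x0 A0 s t).
Proof.
move=> x y D; have [M0 H0] := cube_agree A0.
have [xx0|nx] := pselect (agree A0 x0 x).
  have [M [m [v [H1 H2]]]] := D xx0; exists M => x' y' xx' yy' _; exists M, m, v.
  by split=> z Cz xz; [apply: H1|apply: H2] => //; exact: cube_trans xz.
exists M0 => x' y' xx' _ x0x'; case: nx; apply: agree_trans x0x' _; apply: agree_sym; exact: H0.
Qed.

(** [x1] and [x2] can share rows with the same [y] and yet differ at some bit of the value; whatever
    bit [y] has there at [t], one of the two has the opposite one. *)
Lemma diverging_dense k F C b x0 A0 s t bad : name k F C b ->
  (forall shr x A, partial_injection shr -> (forall p, p \in shr -> ~~ bad p.1) -> agree A0 x0 x ->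
    exists x1 x2, [/\ C x1, C x2, agree A x x1 & agree A x x2] /\
      [/\ low k x1 x2, forall p, p \in shr -> forall a, x1 (k, p.1, a) = x2 (k, p.1, a) &
        b x1 s <> b x2 s]) ->
  dense_requirement k bad (diverging C b x0 A0 s t).
Proof.
move=> [cC con inv] H shr x y A pinj nb sh.
have [x0x|nx] := pselect (agree A0 x0 x); last by exists x, y; split.
pose A' := A ++ [seq (k, p.1, c.2) | p <- shr, c <- A].
have [x1 [x2 [[C1 C2 /agree_cat[a1 a1'] /agree_cat[a2 _]] [lo12 sh12 b12]]]] := H shr x A' pinj nb x0x.
have [m bm] : exists m, b x1 s m <> b x2 s m by apply/existsNP => e; apply/b12/funext.
have [N1 HN1] := con x1 s m C1; have [N2 HN2] := con x2 s m C2.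
(* [y] has to follow [x1] on shared bits; on [A] it stays unchanged, since [A'] protects the bits of
   [x] that [y] shares there. *)
pose y1 c := if shared_coord k shr c is Some d then x1 d else y c.
have yy1 : agree A y y1.
  move=> c cA; rewrite /y1; case E: shared_coord => [d|] //.
  rewrite ((sharing_coord _ _ _ pinj).1 sh _ _ E).
  move: E; rewrite /shared_coord; case: ifP => [lk [<-]|lk]; first exact: a1.
  case: eqP => // _; case E: partner => [a|] //= [<-].
  by apply: a1'; apply/allpairsP; exists ((a, c.1.2), c); split=> //; apply/(partnerP _ pinj).
have shy1 : sharing k shr x1 y1 by apply/(sharing_coord _ _ _ pinj) => c d; rewrite /y1 => ->.
have [v1 [v2 [w [[Cv1 Cv2 Cw] [[av1 av2 aw] [s1 s2]]]]]] :=
  generic_triple (A ++ N1 ++ N2) pinj cC lo12 sh12 shy1.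
move: av1 av2 aw => /agree_cat[av1 /agree_cat[n1 _]] /agree_cat[av2 /agree_cat[_ n2]] /agree_cat[aw _].
have e1 : b v1 s m = b x1 s m by exact: HN1.
have e2 : b v2 s m = b x2 s m by exact: HN2.
have key v : C v -> b v s m <> b w t m -> diverging C b x0 A0 s t v w.
  move=> Cv ne _; have [P1 HP1] := con v s m Cv; have [P2 HP2] := con w t m Cw.
  have [M1 HM1] := cube_agree P1; have [M2 HM2] := cube_agree P2.
  exists (maxn M1 M2), m, (b v s m); split=> z Cz vz.
    by apply: HP1 => //; apply: HM1; apply: cube_le vz; exact: leq_maxl.
  rewrite HP2 //; first by case: (b v s m) (b w t m) ne => -[].
  by apply: HM2; apply: cube_le vz; exact: leq_maxr.
have [bw|bw] := eqVneq (b v1 s m) (b w t m).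
  exists v2, w; split=> //.
  - by apply: key => //; rewrite -bw e1 e2 => /esym.
  - exact: agree_trans a2 av2.
  - exact: agree_trans yy1 aw.
exists v1, w; split=> //.
- by apply: key => //; exact/eqP.
- exact: agree_trans a1 av1.
- exact: agree_trans yy1 aw.
Qed.

Definition supported k (C : set config) (b : config -> tree) s n x A :=
  forall y y', C y -> C y' -> agree A x y -> agree A x y' -> low k y y' ->
    (forall j a, j < n -> y (k, j, a) = y' (k, j, a)) -> b y s = b y' s.

(** The finitely many shared rows do not support the value, so it can be changed without touching
    them. *)
Lemma unsupported_diverging_dense k F C b x0 A0 s t : name k F C b ->
  (forall n x A, agree A0 x0 x -> ~ supported k C b s n x A) ->
  dense_requirement k pred0 (diverging C b x0 A0 s t).
Proof.
move=> nb H; apply: (diverging_dense t nb) => shr x A pinj _ x0x.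
apply: contrapT => nH; apply: (H (\max_(p <- shr) p.1).+1 x A x0x) => y y' Cy Cy' xy xy' lo rows.
apply: contrapT => by_; apply: nH; exists y, y'; split=> //; split=> // p pS a.
by apply: rows; rewrite ltnS; exact: (leq_bigmax_seq (F := fun p : nat * nat => p.1)).
Qed.

(** [y3] is [y1] with row [j] taken from [y2]. By the support, a generic copy of it has the value of
    [y2] and so differs from [y1], although up to level [k] only row [j] was changed. *)
Lemma minimal_support_diverging_dense k F C b x0 A0 s t j : name k F C b ->
  supported k C b s j.+1 x0 A0 ->
  (forall x A, agree A0 x0 x -> ~ supported k C b s j x A) ->
  dense_requirement k (pred1 j) (diverging C b x0 A0 s t).
Proof.
move=> nb sup H; apply: (diverging_dense t nb) => shr x A pinj bad x0x.
have [cC con inv] := nb.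
have [y1 [y2 [[C1 C2 a1 a2] [lo rows [m bm]]]]] : exists y1 y2,
    [/\ C y1, C y2, agree (A ++ A0) x y1 & agree (A ++ A0) x y2] /\
    [/\ low k y1 y2, forall i a, i < j -> y1 (k, i, a) = y2 (k, i, a) & exists m, b y1 s m <> b y2 s m].
  apply: contrapT => nH; apply: (H x (A ++ A0) x0x) => y y' Cy Cy' xy xy' lo rows.
  apply: contrapT => by_; apply: nH; exists y, y'; split=> //; split=> //.
  by apply/existsNP => e; apply/by_/funext.
have [N1 HN1] := con y1 s m C1; have [N2 HN2] := con y2 s m C2.
pose off (c : coord) := (c.1.1 < k) || (c.1.1 == k) && (c.1.2 != j).
pose below (c : coord) := (c.1.1 < k) || (c.1.1 == k) && (c.1.2 < j).
(* The copies 0 and 1 share everything up to level [k] except row [j]; the copies 1 and 2 share the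
   levels below [k] and the rows up to [j]. *)
pose h (n : nat) (c : coord) : nat * coord :=
  if n == 0 then (0, c) else if n == 1 then (~~ off c : nat, c) else
  (if below c then 0 else if (c.1.1 == k) && (c.1.2 == j) then 1 else 2, c).
have hi n : injective (h n).
  by move=> c c'; rewrite /h; case: ifP => _; [case|case: ifP => _; case].
pose y3 c := if (c.1.1 == k) && (c.1.2 == j) then y2 c else y1 c.
pose u (e : nat * coord) := if e.1 == 0 then y1 e.2 else if e.1 == 1 then y3 e.2 else y2 e.2.
have u1 c : u (h 1 c) = y3 c.
  rewrite /u /h /=; case B: (off c) => //=; rewrite /y3; case: ifP => // /andP[/eqP k1 /eqP j1].
  by move: B; rewrite /off k1 j1 !eqxx ltnn.
have u2 c : u (h 2 c) = y2 c.
  rewrite /u /h /=; case B: (below c) => /=; last by rewrite /y3; case: ((c.1.1 == k) && (c.1.2 == j)).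
  case/orP: B => [/lo //|]; case: c => [[l i] a] /= /andP[/eqP -> ij]; exact: rows.
pose N := A ++ A0 ++ N1 ++ N2.
have [v [uv Cv]] := generic_family u (map (h 0) N ++ map (h 1) N ++ map (h 2) N) hi cC.
move: uv => /agree_cat[uv0 /agree_cat[uv1 uv2]].
have a0 : agree N y1 (v \o h 0) by move=> c cN; rewrite /= -uv0 ?map_f.
have {}uv1 : agree N y3 (v \o h 1) by move=> c cN; rewrite /= -uv1 ?map_f.
have {}uv2 : agree N y2 (v \o h 2) by move=> c cN; rewrite /= -uv2 ?map_f.
have y3A : agree (A ++ A0) x y3.
  by move=> c cA; rewrite /y3; case: ifP => _; [exact: a2|exact: a1].
have x0A y : agree (A ++ A0) x y -> agree A0 x0 y.
  by move=> /agree_cat[_]; exact: agree_trans.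
have nAA y z : agree N y z -> agree (A ++ A0) y z.
  by move=> /agree_cat[h1 /agree_cat[h2 _]]; apply/agree_cat.
exists (v \o h 0), (v \o h 1); split; split=> //.
- by have := agree_trans a1 (nAA _ _ a0) => /agree_cat[].
- by have := agree_trans y3A (nAA _ _ uv1) => /agree_cat[].
- by move=> c ck; rewrite /h /= /off ck.
- move=> p /bad /= pj a; by rewrite /h /= /off /= eqxx pj orbT.
have e1 : b (v \o h 0) s m = b y1 s m.
  by apply: HN1 => //; move: a0 => /agree_cat[_ /agree_cat[_ /agree_cat[]]].
have e2 : b (v \o h 2) s m = b y2 s m.
  by apply: HN2 => //; move: uv2 => /agree_cat[_ /agree_cat[_ /agree_cat[]]].
have e3 : b (v \o h 1) s = b (v \o h 2) s.
  apply: sup => //.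
  - by apply: x0A; exact: agree_trans y3A (nAA _ _ uv1).
  - by apply: x0A; exact: agree_trans a2 (nAA _ _ uv2).
  - by move=> c ck; rewrite /h /= /off /below ck.
  - move=> i a; rewrite ltnS leq_eqVlt /h /= /off /below /= !eqxx ltnn /=.
    by case/orP=> [/eqP ->|ij]; rewrite ?eqxx ?ltnn // ij (ltn_eqF ij).
by move=> /(congr1 (fun f => f m)); rewrite e3 e1 e2.
Qed.

(** * Hereditary classes and their coding *)

Lemma eq_jump_equivalence n : equivalence (@eq_jump n).
Proof.
elim: n => [|n [r [s t]]]; first by split=> //=; split=> // x y z -> ->.
split=> [x|]; first by split=> i; exists i; exact: r.
split=> [x y [H H']|x y z [H1 H1'] [H2 H2']]; split=> i.
- by have [j Hj] := H' i; exists j; exact: s.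
- by have [j Hj] := H i; exists j; exact: s.
- by have [j Hj] := H1 i; have [m Hm] := H2 j; exists m; exact: t Hj Hm.
- by have [j Hj] := H2' i; have [m Hm] := H1' j; exists m; exact: t Hm Hj.
Qed.

Lemma eq_jump_refl n x : @eq_jump n x x. Proof. by case: (eq_jump_equivalence n). Qed.
Lemma eq_jump_sym n x y : @eq_jump n x y -> @eq_jump n y x.
Proof. by case: (eq_jump_equivalence n) => _ [+ _]; apply. Qed.
Lemma eq_jump_trans n x y z : @eq_jump n x y -> @eq_jump n y z -> @eq_jump n x z.
Proof. by case: (eq_jump_equivalence n) => _ [_]; apply. Qed.

Definition jump_class (z : {d : nat & dom d}) : {d : nat & set (dom d)} :=
  existT _ (projT1 z) [set v | @eq_jump (projT1 z) (projT2 z) v].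

Lemma jump_classP d (u v : dom d) :
  jump_class (existT _ d u) = jump_class (existT _ d v) <-> eq_jump d u v.
Proof.
split=> [H|uv].
  have : [set w | @eq_jump d u w] = [set w | @eq_jump d v w].
    exact: (inj_pair2_eq_dec _ PeanoNat.Nat.eq_dec _ _ _ _ H).
  by move=> /(congr1 (fun A => A v)) /= ->; exact: eq_jump_refl.
congr existT; apply/funext => w; apply/propext => /=.
split; apply: eq_jump_trans => //; exact: eq_jump_sym.
Qed.

(** A path that goes on beyond a real stays there, so every path is legal and the dimension reached
    depends only on [n] and the length of the path. *)
Fixpoint descend n : dom n -> seq nat -> {d : nat & dom d} :=
  match n with
  | 0 => fun u _ => existT (fun d => carrier (dom d)) 0 u
  | m.+1 => fun u p => if p is i :: q then descend (u i) q else existT (fun d => carrier (dom d)) m.+1 u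
  end.

Lemma descend_rcons n (u : dom n) p d (w : dom d.+1) i :
  descend u p = existT _ d.+1 w -> descend u (rcons p i) = existT _ d (w i).
Proof.
elim: n u p => [|n IH] u [|j p] //=; last exact: IH.
move=> H; have dn : d = n by have /= [] := congr1 (@projT1 _ _) H.
subst d; have -> : w = u by apply/esym; exact: (inj_pair2_eq_dec _ PeanoNat.Nat.eq_dec _ _ _ _ H).
by case: (n) (u i).
Qed.

Lemma descend_dim n (u : dom n) p : projT1 (descend u p) = n - size p.
Proof. by elim: n u p => [|n IH] u [|i p] //=; rewrite IH. Qed.

(* A base object: a coordinate [n] and the class of a hereditary element of the [n]-th coordinate. *)
Definition base_object := (nat * {d : nat & set (dom d)})%type.
HB.instance Definition _ := gen_eqMixin base_object.

Definition base x n p : base_object := (n, jump_class (descend (x n : dom n) p)).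

Definition dim (v : base_object) : nat := projT1 v.2.

Definition child (v o : base_object) :=
  v.1 = o.1 /\ exists d (u : dom d.+1) i, v.2 = jump_class (existT _ d (u i)) /\
    o.2 = jump_class (existT _ d.+1 u).

(* Testing both equality and membership separates distinct base objects from above and from below. *)
Definition base_test (v o : base_object) : nat :=
  if `[<v = o>] then 2 else if `[<child v o>] then 1 else 0.

Definition bases (x : dom_omega) : set base_object := fun v => exists n p, v = base x n p.

Lemma base_test2 v o : base_test v o = 2 <-> v = o.
Proof. by rewrite /base_test; case: asboolP => // n; case: asboolP. Qed.

Lemma child_dim v o : child v o -> dim o = (dim v).+1.
Proof. by rewrite /dim => -[_ [d [u [i [-> ->]]]]]. Qed.

Lemma bases_dimS x v d : bases x v -> dim v = d.+1 ->
  exists u : dom d.+1, v = (v.1, jump_class (existT _ d.+1 u)) /\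
    forall i, bases x (v.1, jump_class (existT _ d (u i))).
Proof.
move=> [n [p ->]]; rewrite /dim /base /= => dv.
case E: (descend (x n : dom n) p) dv => [e u] /= dv; subst e; exists u; split=> // i.
by exists n, (rcons p i); rewrite /base (descend_rcons _ E).
Qed.

Lemma child_class n n' d (u : dom d.+1) (w : dom d) :
  child (n, jump_class (existT _ d w)) (n', jump_class (existT _ d.+1 u)) <->
  n = n' /\ exists i, eq_jump d w (u i).
Proof.
split=> [[/= -> [e [u' [i [H1 H2]]]]]|[-> [i wi]]]; last first.
  by split=> //; exists d, u, i; split=> //=; apply/jump_classP.
split=> //; have ed : d = e by have := congr1 (@projT1 _ _) H1.
subst e; move/jump_classP: H1 => H1; move/jump_classP: H2 => [_ H2].
by have [j Hj] := H2 i; exists j; apply: eq_jump_trans H1 _; exact: eq_jump_sym.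
Qed.

(** An object of dimension below [l] is separated by testing equality with itself. Two objects of
    dimension [l] are separated by extensionality of the jump, or by any member if their coordinates
    differ. *)
Lemma bases_separated x y l : 0 < l ->
  let S v := bases x v \/ bases y v in separated dim base_test S S l.
Proof.
move=> l0 S o o' So So' do_ do' no.
have sep_self v v' : v <> v' -> base_test v v <> base_test v v'.
  by move=> nv; have /base_test2 -> : v = v by []; move=> /esym /base_test2.
have [lo|lo] := ltnP (dim o) l; first by exists o; split=> //; exact: sep_self.
have [lo'|lo'] := ltnP (dim o') l.
  by exists o'; split=> // /esym; apply: sep_self => /esym.
case: l l0 do_ do' lo lo' => // l _ do_ do' lo lo'.
have {lo}do_ : dim o = l.+1 by apply/eqP; rewrite eqn_leq do_ lo.
have {lo'}do' : dim o' = l.+1 by apply/eqP; rewrite eqn_leq do' lo'.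
have SS v d : S v -> dim v = d.+1 -> exists u : dom d.+1, v = (v.1, jump_class (existT _ d.+1 u)) /\
    forall i, S (v.1, jump_class (existT _ d (u i))).
  by case=> Sv dv; have [u [? H]] := bases_dimS Sv dv; exists u; split=> // i; [left|right].
have [u [oE Hu]] := SS o l So do_; have [u' [oE' Hu']] := SS o' l So' do'.
have neq v w : dim v < dim w -> `[<v = w>] = false.
  by move=> vw; apply/asboolP => e; rewrite e ltnn in vw.
have memo n i n' (t : dom l.+1) : base_test (n, jump_class (existT _ l i)) (n', jump_class (existT _ l.+1 t)) =
    `[<n = n' /\ exists j, eq_jump l i (t j)>].
  rewrite /base_test neq //; have [H|H] := asboolP; have [H'|H'] := asboolP => //.
    by case: H'; exact/child_class.
  by case: H; exact/child_class.
have T0 (P Q : Prop) : P -> ~ Q -> (`[<P>] : nat) <> `[<Q>] by move=> p q; rewrite (asboolT p) (asboolF q).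
have [nn|nn] := pselect (o.1 = o'.1); last first.
  exists (o.1, jump_class (existT _ l (u 0))); split=> //.
  rewrite oE oE' !memo; apply: T0; last by case.
  by split=> //; exists 0; exact: eq_jump_refl.
have nu : ~ eq_jump l.+1 u u' by move=> uu; apply: no; rewrite oE oE' nn; congr (_, _); apply/jump_classP.
have [H|H] := pselect (forall i, exists j, eq_jump l (u i) (u' j)); last first.
  move/existsNP: H => [i ni]; exists (o.1, jump_class (existT _ l (u i))); split=> //.
  rewrite oE oE' !memo; apply: T0; last by case.
  by split=> //; exists i; exact: eq_jump_refl.
have [H'|H'] := pselect (forall j, exists i, eq_jump l (u i) (u' j)); first by case: nu.
move/existsNP: H' => [i ni]; exists (o'.1, jump_class (existT _ l (u' i))); split=> //.
rewrite oE oE' !memo => /esym; apply: T0; last by case=> _ [j] /eq_jump_sym uj; apply: ni; exists j.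
by split=> //; exists i; exact: eq_jump_refl.
Qed.

Lemma eq_omega_bases x y : eq_omega x y -> forall v, bases x v -> bases y v.
Proof.
move=> xy _ [n [p ->]]; suff [p' H] : exists p', jump_class (descend (x n) p) = jump_class (descend (y n) p').
  by exists n, p'; rewrite /base H.
move: (x n : dom n) (y n : dom n) (xy n) p; elim: n => [|n IH] u u' uu p.
  by exists p; rewrite /= uu.
case: p => [|i p]; first by exists [::]; exact/jump_classP.
by have [j /IH Hj] := uu.1 i; have [q Hq] := Hj p; exists (j :: q).
Qed.

Lemma descend_nil n (u : dom n) : descend u [::] = existT _ n u. Proof. by case: n u. Qed.

(** In coordinate [n] only the empty path reaches dimension [n], except for [n = 0], where all paths
    end in the same real; so the object [base x n [::]] is recognized among all base objects. *)
Lemma bases_eq_omega x y : (forall v, bases x v -> bases y v) -> eq_omega x y.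
Proof.
move=> H n; have [|m [p]] := H (base x n [::]); first by exists n, [::].
move=> E0; have nm : n = m := congr1 fst E0; subst m.
have E : jump_class (descend (x n : dom n) [::]) = jump_class (descend (y n : dom n) p) := congr1 snd E0.
apply/jump_classP; rewrite -!descend_nil.
rewrite E; have := congr1 (@projT1 _ _) E; rewrite /= !descend_dim /= subn0 => np.
case: p {E E0} np => [//|i p] /=; case: (n) (y n : dom n) => [//|m] u; lia.
Qed.

Lemma dim_base x n p : dim (base x n p) = n - size p.
Proof. exact: descend_dim. Qed.

Definition node_index j : nat * seq (nat * seq nat) := odflt (0, [::]) (unpickle j).

(** Addresses are decoded and filtered without regard to [x]; only the base objects at these
    addresses vary, which keeps the coding Borel. *)
Definition node_of (x : dom_omega) l j : node base_object :=
  ((node_index j).1, [seq base x a.1 a.2 | a <- (node_index j).2 & a.1 - size a.2 < l]).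

Lemma node_of_level x l j : level dim (bases x) l (node_of x l j).
Proof.
move=> v /mapP[a]; rewrite mem_filter => /andP[al _] ->; split; first by exists a.1, a.2.
by rewrite dim_base.
Qed.

Lemma level_node_of x l u : level dim (bases x) l u -> exists j, node_of x l j = u.
Proof.
case: u => m s Hs.
have [t [Ht st]] : exists t : seq (nat * seq nat), all (fun a => a.1 - size a.2 < l) t /\
    s = [seq base x a.1 a.2 | a <- t].
  elim: s Hs => [|v s IH] Hs; first by exists [::].
  have [|t [Ht ->]] := IH; first by move=> w ws; apply: Hs; rewrite inE /= ws orbT.
  have [|[n [p vE]] dv] := Hs v; first by rewrite inE eqxx.
  by exists ((n, p) :: t); rewrite /= Ht -(dim_base x) -vE dv.
exists (pickle (m, t)); rewrite /node_of /node_index pickleK /= st.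
by rewrite (all_filterP Ht).
Qed.

Definition rational q : R :=
  let z : nat * nat * nat := odflt (0, 0, 0) (unpickle q) in
  Rdiv (Rminus (INR z.1.1) (INR z.1.2)) (INR z.2.+1).

Lemma rational_dense (r s : R) : Rlt r s -> exists q, Rlt r (rational q) /\ Rlt (rational q) s.
Proof.
move=> rs.
have [c Hc] := INR_unbounded (Rdiv 1 (Rminus s r)).
have rc : Rlt 1 (Rmult (INR c.+1) (Rminus s r)).
  have Hs : Rlt 0 (Rminus s r) by lra.
  have Hc' : Rlt (Rdiv 1 (Rminus s r)) (INR c.+1) by rewrite S_INR; lra.
  have := Rmult_lt_compat_r _ _ _ Hs Hc'; rewrite /Rdiv Rmult_assoc Rinv_l; lra.
have Pc : Rlt 0 (INR c.+1) by rewrite S_INR; have := pos_INR c; lra.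
have [z1 z2] := archimed (Rmult r (INR c.+1)).
set z := up _ in z1 z2.
have [a [b zE]] : exists a b, IZR z = Rminus (INR a) (INR b).
  exists (Z.to_nat z), (Z.to_nat (Z.opp z)); rewrite !INR_IZR_INZ -minus_IZR; apply: (f_equal IZR); lia.
exists (pickle (a, b, c)); rewrite /rational pickleK [odflt _ _]/= [_.1.1]/= [_.1.2]/= [_.2]/= -zE.
split; [apply: (Rmult_lt_reg_r (INR c.+1)) => //|apply: (Rmult_lt_reg_r (INR c.+1)) => //];
  rewrite /Rdiv Rmult_assoc Rinv_l; nra.
Qed.

(** A Dedekind cut; objects of positive dimension have all bits [false]. *)
Definition real_bit (v : base_object) q :=
  `[<exists r : R, v.2 = jump_class (existT _ 0 r) /\ Rlt (rational q) r>].

Lemma real_bit_inj (v w : base_object) (r s : R) : v.1 = w.1 -> v.2 = jump_class (existT _ 0 r) ->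
  w.2 = jump_class (existT _ 0 s) -> (forall q, real_bit v q = real_bit w q) -> v = w.
Proof.
case: v w => [n v] [m w] /= -> -> -> H; congr (_, _); apply/jump_classP => /=.
have bitE (t : R) q : real_bit (m, jump_class (existT _ 0 t)) q -> Rlt (rational q) t.
  by move=> /asboolP[t' [/jump_classP /= <-]].
have bitI (t : R) q : Rlt (rational q) t -> real_bit (m, jump_class (existT _ 0 t)) q.
  by move=> qt; apply/asboolP; exists t.
have le t t' : (forall q, real_bit (m, jump_class (existT _ 0 t)) q -> real_bit (m, jump_class (existT _ 0 t')) q) ->
    Rle t t'.
  move=> Hq; apply: Rnot_lt_le => tt; have [q [q1 q2]] := rational_dense tt.
  have := bitE _ _ (Hq q (bitI _ _ q2)); lra.
by apply: Rle_antisym; apply: le => q; rewrite H.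
Qed.

(** The discrete part of a node becomes the tag and its reals become the branch in the family of
    mutually generic rows. *)
Definition row_code (u : node base_object) : nat * (nat -> bool) :=
  (pickle (u.1, map fst u.2), fun c =>
    let aq : nat * nat := odflt (0, 0) (unpickle c) in
    real_bit (nth (0, jump_class (existT _ 0 R0)) u.2 aq.1) aq.2).

Definition row phi (u : node base_object) : nat -> bool := phi (row_code u).1 (row_code u).2.

Lemma bases_real x v : bases x v -> dim v < 1 -> exists r : R, v.2 = jump_class (existT _ 0 r).
Proof.
move=> [n [p ->]]; rewrite /dim /base /=; case: (descend (x n : dom n) p) => d u /=; case: d u => // u _; by exists u.
Qed.

Lemma row_code_inj x y u u' : level dim (fun v => bases x v \/ bases y v) 1 u ->
  level dim (fun v => bases x v \/ bases y v) 1 u' -> row_code u = row_code u' -> u = u'.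
Proof.
case: u u' => [n s] [m t] Hs Ht E; have bits := congr1 snd E.
have /= [nm est] := pcan_inj (@pickleK _) (congr1 fst E); rewrite nm; congr (_, _).
have sz : size s = size t by have := congr1 size est; rewrite !size_map.
apply: (@eq_from_nth _ (0, jump_class (existT _ 0 R0))) => // i si.
have real v : (bases x v \/ bases y v) /\ dim v < 1 -> exists r : R, v.2 = jump_class (existT _ 0 r).
  by case=> [[|]]; exact: bases_real.
set d0 := (0, _) : base_object.
have ti : i < size t by rewrite -sz.
have [r Hr] := real _ (Hs (nth d0 s i) (mem_nth d0 si)).
have [r' Hr'] := real _ (Ht (nth d0 t i) (mem_nth d0 ti)).
apply: (real_bit_inj _ Hr Hr').
  by rewrite -!(nth_map _ 0) ?est // -sz.
move=> q; have := congr1 (fun f => f (pickle (i, q))) bits.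
by rewrite /= pickleK.
Qed.

Definition coding phi (x : dom_omega) : config :=
  pull base_test (row phi) (fun s : slot => node_of x s.1.2 s.2) true.

(** Equality up to enumeration with repetitions, except at level 0, where objects are named by
    indices. *)
Definition equiv_config (x y : config) := exists rho : nat -> nat -> nat -> Prop,
  [/\ forall l i, exists i', rho l i i', forall l i', exists i, rho l i i',
      forall i i', rho 0 i i' -> i = i' &
      forall l j j' i i', rho l.+1 j j' -> rho l i i' -> x (l, j, i) = y (l, j', i')].

Lemma pull_equiv (B : eqType) test (rw : node B -> nat -> bool) (e e' : slot -> node B) b b' :
  (forall l i, 0 < l -> exists i', e (b, l, i) = e' (b', l, i')) ->
  (forall l i', 0 < l -> exists i, e (b, l, i) = e' (b', l, i')) ->
  equiv_config (pull test rw e b) (pull test rw e' b').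
Proof.
move=> H H'; exists (fun l i i' => if l is 0 then i = i' else e (b, l, i) = e' (b', l, i')); split.
- by move=> [|l] i; [exists i|exact: H].
- by move=> [|l] i; [exists i|exact: H'].
- by [].
- by rewrite /pull => -[|l] j j' i i' /= -> ->.
Qed.

Fixpoint const_dom l (a : R) : dom l := match l with 0 => a | m.+1 => fun _ => const_dom m a end.

(* Position [i] holds a padding value when [i] is not a member; the constants [- INR l.+1] are never
   values of objects, see [object_not_const]. *)
Fixpoint object (x : config) l (j : nat) : dom l :=
  match l with
  | 0 => INR j
  | m.+1 => fun i => if x (m, j, i) then object x m i else const_dom m (Ropp (INR m.+1))
  end.

(** Coordinate [l.+1] lists the objects of level [l]; coordinate 0 has no room for a list and is
    constant. *)
Definition code (x : config) : dom_omega :=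
  fun n => match n return dom n with 0 => R0 | l.+1 => object x l end.

Lemma code_equiv x y : equiv_config x y -> eq_omega (code x) (code y).
Proof.
move=> [rho [r1 r2 r0 rS]].
have H l i i' : rho l i i' -> eq_jump l (object x l i) (object y l i').
  elim: l i i' => [|l IH] i i' /=; first by move=> /r0 ->.
  move=> ii; split=> a.
    have [a' aa] := r1 l a; exists a'; rewrite (rS _ _ _ _ _ ii aa).
    by case: ifP => _; [exact: IH|exact: eq_jump_refl].
  have [a' aa] := r2 l a; exists a'; rewrite (rS _ _ _ _ _ ii aa).
  by case: ifP => _; [exact: IH|exact: eq_jump_refl].
case=> [//|l] /=; split=> i; first by have [j ij] := r1 l i; exists j; exact: H.
by have [j ij] := r2 l i; exists j; exact: H.
Qed.

Lemma eq_const_dom l a b : eq_jump l (const_dom l a) (const_dom l b) -> a = b.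
Proof. by elim: l => //= l IH [/(_ 0)[i /IH]]. Qed.

Lemma object_not_const x l j m : l <= m -> ~ eq_jump l (object x l j) (const_dom l (Ropp (INR m.+1))).
Proof.
elim: l j m => [|l IH] j m lm.
  move=> e; have {}e : INR j = Ropp (INR m.+1) := e.
  by have := pos_INR j; have := pos_INR m; rewrite e S_INR; lra.
move=> [/(_ 0)[i Hi] _]; move: Hi; rewrite -[const_dom l.+1 _ i]/(const_dom l (Ropp (INR m.+1))).
rewrite -[object x l.+1 j 0]/(if x (l, j, 0) then object x l 0 else const_dom l (Ropp (INR l.+1))).
case: ifP => _; first by apply: IH; exact: ltnW.
by move=> /eq_const_dom /Ropp_eq_compat; rewrite !Ropp_involutive => /INR_eq; lia.
Qed.

(** Padding values are recognizable, so equivalent objects have equivalent true members; by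
    induction on the level these have equal labels, and extensionality carries this to the
    objects. *)
Lemma code_labels (T : Type) (mem : nat -> T -> T -> bool) (a a' : nat -> nat -> T) (x y : config) :
  (forall l j i, x (l, j, i) = mem l (a l i) (a l.+1 j)) ->
  (forall l j i, y (l, j, i) = mem l (a' l i) (a' l.+1 j)) ->
  (forall i, a 0 i = a' 0 i) ->
  (forall l j j', (forall i, exists i', a l i = a' l i') -> (forall i', exists i, a l i = a' l i') ->
    (forall i, mem l (a l i) (a l.+1 j) = mem l (a l i) (a' l.+1 j')) -> a l.+1 j = a' l.+1 j') ->
  eq_omega (code x) (code y) ->
  forall l, (forall i, exists i', a l i = a' l i') /\ (forall i', exists i, a l i = a' l i').
Proof.
move=> xE yE a0 ext xy l; suff [] : [/\ forall i, exists i', a l i = a' l i',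
    forall i', exists i, a l i = a' l i' &
    forall i i', eq_jump l (object x l i) (object y l i') -> a l i = a' l i'] by [].
elim: l => [|l [H1 H2 H3]]; first by split=> [i|i|i i' /= /INR_eq ->]; [exists i|exists i|].
have step i i' : eq_jump l.+1 (object x l.+1 i) (object y l.+1 i') -> a l.+1 i = a' l.+1 i'.
  move=> [E E']; apply: ext => // j; apply/idP/idP => mj.
    have [j' /=] := E j; rewrite xE mj yE; case: ifP => [mj' /H3 -> //|_].
    by move=> /object_not_const; case.
  have [j1 j1E] := H1 j; have [j' /=] := E' j1.
  rewrite yE -j1E mj; rewrite xE; case: ifP => [mj' /H3|_ /eq_jump_sym /object_not_const]; last by case.
  by rewrite -j1E => <-.
have := xy l.+2 => -[E E']; split=> //.
- by move=> i; have [i' /step] := E i; exists i'.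
- by move=> i'; have [i /step] := E' i'; exists i.
Qed.

(** * The two alternatives *)

Definition either_bases (x y : dom_omega) : set base_object := fun v => bases x v \/ bases y v.

Definition local_row (phi : nat -> (nat -> bool) -> nat -> bool) :=
  forall t r r' i, (forall j, j <= i -> r j = r' j) -> phi t r i = phi t r' i.

Definition prefixed_row (phi : nat -> (nat -> bool) -> nat -> bool) :=
  forall u i, i < size (tag_prefix u.1) -> row phi u i = nth false (tag_prefix u.1) i.

Definition injective_row (phi : nat -> (nat -> bool) -> nat -> bool) :=
  forall x y u u', level dim (either_bases x y) 1 u -> level dim (either_bases x y) 1 u' ->
    (forall i, row phi u i = row phi u' i) -> u = u'.

(** All instances of [requirement_rows] with dense value become requirements of the fusion; the
    remaining codes ask that two rows differ, which yields injectivity. *)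
Lemma generic_row_function (J : countType) (k : J -> nat) (D : J -> config -> config -> Prop) :
  (forall q, open_requirement (D q)) ->
  exists phi, [/\ local_row phi, prefixed_row phi, injective_row phi &
    forall q x y, generic_rows (fun u => exists b, level dim (bases (side x y b)) 1 u) (row phi) (k q) (D q)].
Proof.
move=> oD.
pose T : countType := (J * (seq (nat * nat) * (seq ((bool * coord) * bool) * (seq ((bool * nat) * nat) * nat))))%type.
pose Q (t : T) := requirement_rows (k t.1) (D t.1) t.2.1 t.2.2.1 t.2.2.2.1.
pose good (t : T) := (forall e, e \in t.2.2.2.1 -> e.2 < t.2.2.2.2) /\ dense_rows t.2.2.2.2 (Q t).
pose pick n : option T := if unpickle n is Some t then (if pselect (good t) then Some t else None) else None.
pose h n := if pick n is Some t then t.2.2.2.2 else 2.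
pose U n : set (nat -> nat -> bool) := if pick n is Some t then Q t else fun w => exists i, w 0 i <> w 1 i.
(* The tag of a row is the discrete part of a row code, from which the prefix stored in the node is
   read. *)
pose s t := if unpickle t is Some (n, c) then (fun _ : seq nat => tag_prefix n) c else [::].
have pickP n t : pick n = Some t -> good t.
  by rewrite /pick; case: unpickle => // t'; case: pselect => // g [<-].
have [||phi [p1 p2 p3]] := @mycielski s h U.
- move=> n; rewrite /U /h; case E: (pick n) => [t|].
    by have [g _] := pickP _ _ E; apply: open_requirement_rows.
  move=> w [i wi]; exists i.+1 => w' ww'; exists i; by rewrite -!ww'.
- move=> n; rewrite /U /h; case E: (pick n) => [t|]; first by case: (pickP _ _ E).
  move=> w M; exists (fun a i => if i < M then w a i else a == 0); split.
    by move=> a i _ ->.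
  by exists M; rewrite ltnn.
have codes x y (u u' : node base_object) : level dim (either_bases x y) 1 u ->
    level dim (either_bases x y) 1 u' -> row_code u = row_code u' -> u = u' by exact: row_code_inj.
exists phi; split.
- exact: p1.
- move=> u i iu; have es : s (row_code u).1 = tag_prefix u.1.
    by rewrite /s /row_code /= pickleK.
  by rewrite /row p2 es.
- move=> x y u u' Lu Lu' ee; apply: contrapT => nu.
  (* An index list with an entry not below [hh = 0] is never good, so some code does carry the
     requirement that two rows differ. *)
  have [n pn] : exists n, pick n = None.
    have [[t gt]|ng] := pselect (exists t, ~ good t).
      by exists (pickle t); rewrite /pick pickleK; case: pselect.
    have [e0|[t0 _]] : (forall t : T, False) \/ exists t : T, True.
      by have [[t _]|nt] := pselect (exists t : T, True); [right; exists t|left=> t; apply: nt; exists t].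
      by exists 0; rewrite /pick; case: unpickle => // t; case: (e0 t).
    case: ng; exists (t0.1, (t0.2.1, (t0.2.2.1, ([:: ((true, 0), 0)], 0)))) => -[/(_ _ (mem_head _ _))].
    by rewrite ltn0.
  have := p3 n (fun i => if i == 0 then row_code u else row_code u').
  rewrite /h /U pn => H; have [|i /=] := H; last by have := ee i; rewrite /row => ->.
  move=> [|[|i]] [|[|i']] //= _ _ e12; first by case: nu; exact: (codes x y).
  by case: nu; apply: (codes x y).
- move=> q x y shr tab idx hh bd dn u Lu uinj.
  have gd : good (q, (shr, (tab, (idx, hh)))) by split.
  have := p3 (pickle ((q, (shr, (tab, (idx, hh)))) : T)) (fun i => row_code (u i)).
  rewrite /h /U /pick pickleK; case: pselect => // _ /=; apply=> i i' ih ih' ec.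
  apply: uinj => //; have LL i0 : i0 < hh -> level dim (either_bases x y) 1 (u i0).
    by move=> /Lu[b Hb] v /Hb[Sv ?]; split=> //; case: b Sv {Hb}; [left|right].
  by apply: (codes x y) => //; exact: LL.
Qed.

(** * Joint enumerations of the towers of two elements, and divergence *)

Definition pair_data phi (x y : dom_omega) k bad : realization_data base_object :=
  RealizationData dim base_test (fun b => bases (side x y b)) (row phi) k bad.

Lemma pair_admissible phi x y k bad : prefixed_row phi ->
  (forall v, dim v < k -> bases x v <-> bases y v) -> admissible (pair_data phi x y k bad).
Proof.
move=> pre com.
have com' v b b' : dim v < k -> bases (side x y b) v -> bases (side x y b') v.
  by move=> /com vk; case: b; case: b' => //= /vk.
split=> //=.
- exact: base_test2.
- move=> b l l0 o o' So So' do_ do' no.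
  have [v [Sv dv tv]] := @bases_separated (side x y b) (side x y b) l l0 o o'
    (or_introl So) (or_introl So') do_ do' no.
  by exists v; split=> //; case: Sv.
- move=> b l l0 lk o o' So So' do_ do' no.
  have S2 w : (exists b', bases (side x y b') w) -> bases x w \/ bases y w by move=> [[]]; [left|right].
  have [v [Sv dv tv]] := @bases_separated x y l l0 o o' (S2 o So) (S2 o' So') do_ do' no.
  by exists v; split=> //; case: Sv => Sv; [apply: (com' v true)|apply: (com' v false)] => //; exact: leq_trans lk.
Qed.

(** [start] reserves a row on the first side for an object missing on the second. For [k = 0] this
    row is fixed in advance and must itself obey [x0]; for [k > 0] its members are enumerated
    later. *)
Lemma realize phi x y k bad (D : nat -> config -> config -> Prop) x0 M0 (start : option (nat * node base_object)) :
  prefixed_row phi -> (forall v, dim v < k -> bases x v <-> bases y v) ->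
  (forall n, open_requirement (D n)) -> (forall n, dense_requirement k bad (D n)) ->
  (forall n, generic_rows (fun u => exists b, level dim (bases (side x y b)) 1 u) (row phi) k (D n)) ->
  (forall i, bad i -> exists r, start = Some (i, r)) ->
  (forall i r, start = Some (i, r) -> [/\ level dim (bases x) k.+1 r, ~ level dim (bases y) k.+1 r &
    forall a, k = 0 -> a < M0 -> row phi r a = x0 (0, i, a)]) ->
  exists X Y, [/\ equiv_config X (coding phi x), equiv_config Y (coding phi y), low k X Y,
    cube M0 x0 X & forall n, D n X Y].
Proof.
move=> pre com oD dD gD badP startP.
pose e0 (s : slot) : node base_object :=
  if start is Some (i, r) then (if s == (true, k.+1, i) then r else (0, [::])) else (0, [::]).
pose Dm0 : seq slot := if start is Some (i, r) then [:: (true, k.+1, i)] else [::].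
pose X := pair_data phi x y k bad.
have adm : admissible X by exact: pair_admissible.
have mem0 s : s \in Dm0 -> exists i r, [/\ start = Some (i, r), s = (true, k.+1, i) & e0 s = r].
  rewrite /Dm0 /e0; case: start {startP badP e0 Dm0} => [[i r]|] //; rewrite inE => /eqP ->.
  by exists i, r; rewrite eqxx.
have va : valid X e0 Dm0.
  split.
  - move=> b l i /mem0[j [r [st [-> -> _] er]]]; split=> //.
    by rewrite er; have [] := startP _ _ st.
  - by move=> b l i i' /mem0[j [r [st [_ _ ->] _]]] /mem0[j' [r' [st' [_ _ ->] _]]]; move: st'; rewrite st => -[].
  - move=> b b' l i lk; rewrite /e0; case: (start) => [[j r]|] //; rewrite !xpair_eqE.
    by rewrite (ltn_eqF (_ : l < k.+1)) ?ltnS // !andbF.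
  - move=> b b' l i lk /mem0[j [r [_ [_ el _] _]]]; move: lk; by rewrite el ltnn.
  - move=> i /badP[r st]; rewrite /= /Dm0 /e0 st eqxx mem_head; split=> //.
    by have [] := startP _ _ st.
have ma : matches X e0 Dm0 x0 x0 M0.
  move=> b l j i /mem0[a [r [st [-> el ->] er]]]; move: el => [lk]; rewrite lk /= in er *.
  rewrite /pull /=; case: (posnP k) => [k0|kp].
    have [_ _ H] := startP _ _ st; move: er (H i k0); rewrite k0 => er Hi iM.
    by rewrite er Hi.
  rewrite -{1}(prednK kp) => /mem0[c [r' [_ [el _] _]]]; exfalso; lia.
have sh : shares X e0 Dm0 x0 x0.
  by split=> // i i' _ /mem0[a [r [_ ]]].
have en b l u : 0 < l -> obj X b l u -> exists m, node_of (side x y b) l m = u.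
  by move=> _; exact: level_node_of.
have [e [e1 e2 e3 e4 e5]] := joint_realization adm oD dD gD en va ma sh.
have eqv b : equiv_config (pull base_test (row phi) e b) (coding phi (side x y b)).
  apply: pull_equiv => l i l0 /=.
    by have [j] := level_node_of (e1 b l i l0); exists j.
  have [j ej] := e2 b l (node_of (side x y b) l i) l0 (@node_of_level _ _ _).
  by exists j.
exists (pull base_test (row phi) e true), (pull base_test (row phi) e false); split=> //.
move=> [[l j] i] /= lk; rewrite /pull /=; case: l lk => [|l] lk.
  by rewrite (e3 true false).
by rewrite (e3 true false) ?(e3 true false l.+2) // ltnW.
Qed.

Lemma bisimilar_sym T T' : bisimilar T T' -> bisimilar T' T.
Proof. exact: bisimilar_at_sym. Qed.

Lemma bisimilar_trans T1 T2 T3 : bisimilar T1 T2 -> bisimilar T2 T3 -> bisimilar T1 T3.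
Proof.
move=> [R [bR R0]] [Q [bQ Q0]]; exists (fun s u => exists t, R s t /\ Q t u); split; last by exists [::].
move=> s u [t [Rst Qtu]]; have [e a b] := bR _ _ Rst; have [e' a' b'] := bQ _ _ Qtu; split.
- by rewrite e.
- by move=> i; have [j Hj] := a i; have [m Hm] := a' j; exists m, (rcons t j).
- by move=> m; have [j Hj] := b' m; have [i Hi] := b j; exists i, (rcons t j).
Qed.

Definition respects (F : config -> tree) :=
  forall x y, equiv_config x y -> bisimilar (F x) (F y).

Lemma diverging_not_bisimilar k F C b x0 A0 s X Y : name k F C b -> C X -> C Y -> low k X Y ->
  agree A0 x0 X -> (forall t, diverging C b x0 A0 s t X Y) -> ~ bisimilar (F X) (F Y).
Proof.
move=> [_ _ inv] CX CY XY X0 div bis; have [t st] := bisimilar_at_state s bis.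
have [M [m [v [H1 H2]]]] := div t X0.
have := H1 X CX (fun _ _ _ _ _ _ => erefl); rewrite (inv X Y s t) // H2 //.
by case: (v).
Qed.

Definition divergence_requirement (D : nat -> set config) C b x0 A0 s (q : (nat + nat) + seq nat)
    (x y : config) :=
  match q with
  | inl (inl n) => D n x
  | inl (inr n) => D n y
  | inr t => diverging C b x0 A0 s t x y
  end.

Lemma divergence_requirement_open D C b x0 A0 s q : (forall n, is_open (D n) /\ is_dense (D n)) ->
  open_requirement (divergence_requirement D C b x0 A0 s q).
Proof.
move=> oD; case: q => [[n|n]|t] /=; last exact: diverging_open.
  by have [o d] := oD n; case: (comeager_requirement 0 pred0 o d).
by have [o d] := oD n; case: (comeager_requirement 0 pred0 o d).
Qed.

Lemma realize_divergence phi x y k F (D : nat -> set config) C b x0 A0 s bad M0 start :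
  prefixed_row phi -> (forall v, dim v < k -> bases x v <-> bases y v) -> respects F ->
  name k F C b ->
  (forall n, is_open (D n) /\ is_dense (D n)) -> (forall x, (forall n, D n x) -> C x) ->
  (forall t, dense_requirement k bad (diverging C b x0 A0 s t)) ->
  (forall q, generic_rows (fun u => exists b, level dim (bases (side x y b)) 1 u) (row phi) k
    (divergence_requirement D C b x0 A0 s q)) ->
  (forall x y, cube M0 x y -> agree A0 x y) ->
  (forall i, bad i -> exists r, start = Some (i, r)) ->
  (forall i r, start = Some (i, r) -> [/\ level dim (bases x) k.+1 r, ~ level dim (bases y) k.+1 r &
    forall a, k = 0 -> a < M0 -> row phi r a = x0 (0, i, a)]) ->
  ~ bisimilar (F (coding phi x)) (F (coding phi y)).
Proof.
move=> pre com resp nb oD DC dD gD AM badP startP.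
pose E n := divergence_requirement D C b x0 A0 s (odflt (inl (inl 0)) (unpickle n)).
have [||X [Y [eX eY lo cu HE]]] := @realize phi x y k bad E x0 M0 start pre com _ _ (fun n => gD _) badP startP.
- by move=> n; exact: divergence_requirement_open.
- move=> n; rewrite /E; case: (odflt _ _) => [[m|m]|t] /=; last exact: dD.
    by have [o d] := oD m; case: (comeager_requirement k bad o d).
  by have [o d] := oD m; case: (comeager_requirement k bad o d).
have {}HE q : divergence_requirement D C b x0 A0 s q X Y.
  by have := HE (pickle q); rewrite /E pickleK.
have CX : C X by apply: DC => n; exact: (HE (inl (inl n))).
have CY : C Y by apply: DC => n; exact: (HE (inl (inr n))).
have := diverging_not_bisimilar nb CX CY lo (AM _ _ cu) (fun t => HE (inr t)).
move=> nbis bis; apply: nbis; apply: bisimilar_trans (resp _ _ eX) _.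
by apply: bisimilar_trans bis _; apply: bisimilar_sym; exact: resp.
Qed.

(** The least support is taken over all stronger conditions, so no further strengthening shrinks it;
    it is not empty because the value varies while the lower levels are fixed. *)
Lemma divergent_name k F C b x0 A0 s : respects F -> name k F C b ->
  (forall x A, agree A0 x0 x -> exists x1 x2, [/\ C x1, C x2, agree A x x1 & agree A x x2] /\
    (low k x1 x2 /\ b x1 s <> b x2 s)) ->
  exists j x1 A1, forall t, dense_requirement k (pred1 j) (diverging C b x1 A1 s t).
Proof.
move=> resp nb ndet.
have [D [oD DC]] : comeager C by case: nb.
have sup : exists n, `[<exists x A, agree A0 x0 x /\ supported k C b s n x A>].
  apply: contrapT => ns.
  have dns t : dense_requirement k pred0 (diverging C b x0 A0 s t).
    apply: unsupported_diverging_dense nb _ => n x A x0x su; apply: ns; exists n.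
    by apply/asboolP; exists x, A.
  have [|phi [_ pre _ gen]] := @generic_row_function _ (fun=> k) (divergence_requirement D C b x0 A0 s).
    by move=> q; exact: divergence_requirement_open.
  have [M0 HM0] := cube_agree A0.
  pose x := code (fun _ => false).
  have nbis := @realize_divergence phi x x k F D C b x0 A0 s pred0 M0 None pre (fun _ _ => iff_refl _)
    resp nb oD DC dns (fun q => gen q x x) HM0.
  apply: nbis => //; apply: resp; exists (fun _ i i' => i = i'); split=> //; first by move=> l i; exists i.
    by move=> l i; exists i.
  by move=> l j j' i i' -> ->.
case: (ex_minnP sup) => n /asboolP[x1 [A1 [x01 su]]] nmin.
case: n su nmin => [|j] su nmin.
  have [y [y' [[Cy Cy' /agree_cat[a1 _] /agree_cat[a2 _]] [lo nby]]]] := ndet x1 (A1 ++ A0) x01.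
  by case: nby; exact: su.
exists j, x1, (A1 ++ A0) => t; apply: minimal_support_diverging_dense nb _ _.
  by move=> y y' Cy Cy' /agree_cat[a _] /agree_cat[a' _]; exact: su.
move=> x A /agree_cat[_ x1x] su'; suff : j.+1 <= j by rewrite ltnn.
apply: nmin; apply/asboolP; exists x, A; split=> //; exact: agree_trans x01 x1x.
Qed.

(** The dimension at which two elements first differ is not known in advance, so a single row
    function meets the requirements of every [k]. *)
Theorem coding_reduction F : respects F ->
  (forall k, exists C b x0 A0 s0, name k F C b /\ forall x A, agree A0 x0 x ->
    exists x1 x2, [/\ C x1, C x2, agree A x x1 & agree A x x2] /\ (low k x1 x2 /\ b x1 s0 <> b x2 s0)) ->
  exists phi, local_row phi /\
    forall x y, bisimilar (F (coding phi x)) (F (coding phi y)) -> eq_omega x y.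
Proof.
move=> resp H.
have /choice[W HW] k : exists w : (set config * (config -> tree) * (nat -> set config)) *
    (nat * (seq nat * (config * seq coord))),
  [/\ name k F w.1.1.1 w.1.1.2, (forall n, is_open (w.1.2 n) /\ is_dense (w.1.2 n)),
    (forall x, (forall n, w.1.2 n x) -> w.1.1.1 x) &
    forall t, dense_requirement k (pred1 w.2.1)
      (diverging w.1.1.1 w.1.1.2 w.2.2.2.1 w.2.2.2.2 w.2.2.1 t)].
  have [C [b [x0 [A0 [s0 [nb nd]]]]]] := H k.
  have [j [x1 [A1 dns]]] := divergent_name resp nb nd.
  have [D [oD DC]] : comeager C by case: nb.
  by exists (C, b, D, (j, (s0, (x1, A1)))).
pose rq (q : nat * ((nat + nat) + seq nat)) := let w := W q.1 in
  divergence_requirement w.1.2 w.1.1.1 w.1.1.2 w.2.2.2.1 w.2.2.2.2 w.2.2.1 q.2.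
have [|phi [loc pre _ gen]] := @generic_row_function _ (fun q => q.1) rq.
  by move=> q; have [_ oD _ _] := HW q.1; exact: divergence_requirement_open.
exists phi; split=> // x y bis.
have key x' y' k v : (forall v, dim v < k -> bases x' v <-> bases y' v) -> dim v = k -> bases x' v ->
    ~ bases y' v -> ~ bisimilar (F (coding phi x')) (F (coding phi y')).
  move=> com vk xv yv; have [nb oD DC dns] := HW k.
  set w := W k in nb oD DC dns.
  have [M0 HM0] := cube_agree w.2.2.2.2.
  (* The distinguishing node has [v] as its only base object; its tag makes its row obey the
     condition in the case [k = 0]. *)
  have [n [_ _ _ pn]] := tag_exists [::] [::] (mkseq (fun i => w.2.2.2.1 (0, w.2.1, i)) M0) 0.
  apply: (@realize_divergence phi x' y' k F w.1.2 w.1.1.1 w.1.1.2 w.2.2.2.1 w.2.2.2.2 w.2.2.1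
    (pred1 w.2.1) M0 (Some (w.2.1, (n, [:: v])))) => //.
  - by move=> q; exact: (gen (k, q) x' y').
  - by move=> i /= /eqP ->; exists (n, [:: v]).
  - move=> i r [<- <-]; split.
    + by move=> o; rewrite inE => /eqP ->; rewrite vk.
    + by move=> /(_ v); rewrite inE eqxx => /(_ isT)[].
    + by move=> a _ aM; rewrite pre /= pn ?size_mkseq // nth_mkseq.
apply: contrapT => nxy.
have dif : exists k, `[<exists v, dim v = k /\ ~ (bases x v <-> bases y v)>].
  apply: contrapT => nd; apply: nxy; apply: bases_eq_omega => v xv; apply: contrapT => yv.
  by apply: nd; exists (dim v); apply/asboolP; exists v; split=> // -[/(_ xv)].
case: (ex_minnP dif) => k /asboolP[v [vk nv]] kmin.
have com o : dim o < k -> bases x o <-> bases y o.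
  move=> ok; apply: contrapT => no; have /kmin : `[<exists v, dim v = dim o /\ ~ (bases x v <-> bases y v)>].
    by apply/asboolP; exists o.
  by rewrite leqNgt ok.
have [xv|nxv] := pselect (bases x v).
  have [yv|yv] := pselect (bases y v); first by case: nv.
  exact: (key x y k v com vk xv yv).
have [yv|yv] := pselect (bases y v); last by case: nv.
by apply: (key y x k v _ vk yv nxv) (bisimilar_sym bis) => o /com[].
Qed.

(** * Stacking a coded tower on a fixed generic part *)

Definition stack_coord k (c : coord) : option coord :=
  if c.1.1 < k then None else Some (c.1.1 - k, c.1.2, c.2).

Definition stack k (z x : config) : config := mix (stack_coord k) z x.

Lemma stackE k z x l j i : stack k z x (l, j, i) = if l < k then z (l, j, i) else x (l - k, j, i).
Proof. by rewrite /stack /mix /stack_coord /=; case: ifP. Qed.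

(** Level 0 of the upper tower is placed at level [k], and there re-enumeration is the identity,
    which fits the unchanged part below. *)
Lemma stack_equiv k z x y : equiv_config x y -> equiv_config (stack k z x) (stack k z y).
Proof.
move=> [rho [r1 r2 r0 rS]].
exists (fun l i i' => if l <= k then i = i' else rho (l - k) i i'); split.
- by move=> l i; case: (l <= k); [exists i|exact: r1].
- by move=> l i; case: (l <= k); [exists i|exact: r2].
- by move=> i i' /=.
- move=> l j j' i i'; rewrite !stackE; case: (ltngtP l k) => [lk -> -> //|lk|->].
    by rewrite (subSn (ltnW lk)); exact: rS.
  rewrite subSnn subnn => jj <-; apply: rS jj _.
  by have [a ia] := r1 0 i; rewrite {2}(r0 _ _ ia).
Qed.

Definition distinct_rows (x : config) :=
  forall l j j', (forall i, x (l, j, i) = x (l, j', i)) -> j = j'.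

Lemma comeager_distinct_rows : comeager distinct_rows.
Proof.
apply: (@comeager_sub _ (fun x : config => forall p : nat * nat * nat,
    p.1.2 <> p.2 -> exists i, x (p.1.1, p.1.2, i) <> x (p.1.1, p.2, i))).
  apply: comeager_bigcap => -[[l j] j'] /=.
  have [->|/eqP jj] := eqVneq j j'.
    exact: comeager_all.
  refine (@comeager_sub _ (fun x : config => exists i, x (l, j, i) <> x (l, j', i)) _ _ _); last by move=> x.
  apply: open_dense_comeager.
    move=> x [i xi]; exists [:: (l, j, i); (l, j', i)] => y xy; exists i.
    by rewrite -!xy // !inE eqxx ?orbT.
  move=> x A; have [M HM] := cube_agree A.
  exists (fun c => if c == (l, j, M) then ~~ x (l, j', M) else x c); split.
    by apply: HM => l' j0 i _ _ iM; rewrite !xpair_eqE (ltn_eqF iM) andbF.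
  exists M; rewrite eqxx; case: eqP => [[e]|_]; first by case: jj.
  by case: (x _).
move=> x H l j j' e; apply: contrapT => jj; have [i] := H (l, j, j') jj; exact.
Qed.

Lemma inr_inj (A B : Type) (u v : B) : inr u = inr v :> A + B -> u = v.
Proof. by case. Qed.

(** Labels are indices up to level [k] and nodes above. Extensionality holds for a different reason
    in each range: distinct rows of [z], then injectivity of the rows at the first upper level, then
    the extension property. *)
Lemma coding_code_injective phi k z x y : injective_row phi -> distinct_rows z ->
  eq_omega (code (stack k z (coding phi x))) (code (stack k z (coding phi y))) -> eq_omega x y.
Proof.
move=> inj dz E.
pose lab (w : dom_omega) l i : nat + node base_object := if l <= k then inl i else inr (node_of w (l - k) i).
pose mem l (u t : nat + node base_object) := match u, t with
  | inl i, inl j => z (l, j, i)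
  | inl i, inr t => row phi t i
  | inr u, inr t => member base_test u t
  | _, _ => false end.
have bits w l j i : stack k z (coding phi w) (l, j, i) = mem l (lab w l i) (lab w l.+1 j).
  rewrite stackE /lab; case: (ltngtP l k) => [lk //|lk|->] /=.
    by rewrite (subSn (ltnW lk)) /coding /pull /=; case: (l - k) (subn_gt0 k l) => //; rewrite lk.
  by rewrite subSnn subnn.
have lvl l j j' : (forall i, exists i', lab x l i = lab y l i') -> (forall i', exists i, lab x l i = lab y l i') ->
    (forall i, mem l (lab x l i) (lab x l.+1 j) = mem l (lab x l i) (lab y l.+1 j')) ->
    lab x l.+1 j = lab y l.+1 j'.
  rewrite /lab; case: (ltngtP l k) => [lk|lk|->] H1 H2 H.
  - by rewrite (dz _ _ _ H).
  - rewrite (subSn (ltnW lk)); rewrite (subSn (ltnW lk)) in H; congr inr; apply: contrapT => nt.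
    set t := node_of x _ j in H nt *; set t' := node_of y _ j' in H nt *.
    have lk0 : 0 < l - k by rewrite subn_gt0.
    (* A separating object taken from [y] also occurs in [x], because the node consisting of it
       alone has a counterpart by [H2]. *)
    have sep : separated dim base_test (bases x) (either_bases x y) (l - k).
      move=> o o' To To' do_ do' no; have [v [[Sv|Sv] dv tv]] := bases_separated lk0 To To' do_ do' no.
        by exists v.
      have [|i' yi'] := @level_node_of y (l - k) (0, [:: v]); first by move=> w; rewrite inE => /eqP ->.
      have [i xi0] := H2 i'; have xi := inr_inj xi0; exists v; split=> //.
      by have := @node_of_level x (l - k) i v; rewrite xi yi' inE eqxx => /(_ isT)[].
    have [||u [Lu _ _ _ Hu]] := @extension base_object dim base_test (bases x) (either_bases x y) (l - k)
        [::] [:: t; t'] (fun _ => false) (fun u => u == t) [::] [::] base_test2 sep.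
    + by [].
    + move=> w; rewrite !inE => /orP[/eqP ->|/eqP ->] v /node_of_level[Sv dv]; split=> //; [by left|by right].
    have [i ui] := level_node_of Lu; have := H i; rewrite /mem ui.
    rewrite (Hu t) ?(Hu t') ?inE ?eqxx ?orbT // => /esym /eqP e; by apply: nt.
  - rewrite subSnn /= in H *; congr inr.
    apply: (inj x y _ _ _ _ H).
    + by move=> v /node_of_level[Sv dv]; split=> //; left.
    + by move=> v /node_of_level[Sv dv]; split=> //; right.
have L := code_labels (bits x) (bits y) (fun i => erefl) lvl E.
apply: bases_eq_omega => v xv.
have [|i xi] := @level_node_of x (dim v).+1 (0, [:: v]); first by move=> w; rewrite inE => /eqP ->.
have [/(_ i)[i']] := L (k + (dim v).+1).
rewrite /lab leqNgt -[X in X < _]addn0 ltn_add2l /= addKn xi => yi0 _; have yi := inr_inj yi0.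
by have := @node_of_level y (dim v).+1 i' v; rewrite -yi inE eqxx => /(_ isT)[].
Qed.

Theorem coding_fiber k F (C : set config) x0 A0 : respects F -> comeager C ->
  (forall x y, C x -> C y -> agree A0 x0 x -> agree A0 x0 y -> low k x y -> bisimilar (F x) (F y)) ->
  exists phi z, [/\ local_row phi, forall x, bisimilar (F (stack k z (coding phi x))) (F z) &
    forall x y, eq_omega (code (stack k z (coding phi x))) (code (stack k z (coding phi y))) -> eq_omega x y].
Proof.
move=> resp cC H.
have gi c c' d : stack_coord k c = Some d -> stack_coord k c' = Some d -> c = c'.
  rewrite /stack_coord; case: c c' => [[l j] i] [[l' j'] i'] /=.
  case: ltnP => // kl [<-]; case: ltnP => // kl' [] e -> ->; congr (_, _, _); lia.
have [z [x0z [Cz dz cz]]] : exists z, agree A0 x0 z /\ [/\ C z, distinct_rows z &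
    comeager (fun y => C (stack k z y))].
  have [z [x0z [[Cz dz] cz]]] := baire (comeagerI (comeagerI cC comeager_distinct_rows)
    (kuratowski_ulam gi cC)) x0 A0.
  by exists z.
have [D [oD DC]] := cz.
have [|phi [loc pre inj gen]] := @generic_row_function _ (fun _ : nat => 0) (fun n x _ => D n x).
  by move=> n; have [o d] := oD n; case: (comeager_requirement 0 pred0 o d).
exists phi, z; split=> //; last by move=> x y; exact: coding_code_injective.
(* [y0] is [z] from level [k] on, shifted down: starting the enumeration like it makes the stack
   satisfy the condition [A0], as [z] does. *)
move=> x; pose y0 : config := fun c => z (c.1.1 + k, c.1.2, c.2).
have [M HM] := cube_agree A0.
have [||||X [_ [eX _ _ cu DX]]] := @realize phi x x 0 pred0 (fun n x _ => D n x) y0 M None pre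
    (fun _ _ => iff_refl _) _ _ (fun n => gen n x x).
- by move=> n; have [o d] := oD n; case: (comeager_requirement 0 pred0 o d).
- by move=> n; have [o d] := oD n; case: (comeager_requirement 0 pred0 o d).
- by [].
- by [].
apply: (@bisimilar_trans _ (F (stack k z X))).
  by apply: bisimilar_sym; apply: resp; exact: stack_equiv.
apply: H => //; first exact: DC.
- apply: agree_trans x0z _; apply: HM => l j i lM jM iM; rewrite stackE; case: ltnP => // kl.
  by rewrite -cu /y0 /= ?subnK //; lia.
- by move=> c ck; rewrite /stack /mix /stack_coord ck.
Qed.

(** * Measurability *)

Definition sigma_space (X : bspace) := sigma_algebra [set: X] (meas X).

Lemma generated_sigma_space (T : Type) (G : set (set T)) : sigma_space (BSpace T <<s G>>).
Proof. exact: smallest_sigma_algebra. Qed.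

Lemma dom_omega_sigma_space : sigma_space dom_omega.
Proof. exact: smallest_sigma_algebra. Qed.

Lemma measC (X : bspace) (P : X -> Prop) : sigma_space X ->
  meas X [set x | P x] -> meas X [set x | ~ P x].
Proof.
move=> [_ C _] /C; congr (meas X _); apply/seteqP; split=> x //=.
by case.
Qed.

Lemma meas_exists (X : bspace) (J : countType) (P : J -> X -> Prop) : sigma_space X ->
  (forall j, meas X [set x | P j x]) -> meas X [set x | exists j, P j x].
Proof.
move=> [m0 _ U] mP.
have := U (fun n => if unpickle n is Some j then [set x | P j x] else set0) _.
rewrite (_ : \bigcup_k _ = [set x | exists j, P j x]).
  by apply=> n; case: unpickle.
apply/seteqP; split=> x /=; first by move=> [n _]; case: unpickle => // j ?; exists j.
by move=> [j Pj]; exists (pickle j) => //; rewrite pickleK.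
Qed.

Lemma meas_forall (X : bspace) (J : countType) (P : J -> X -> Prop) : sigma_space X ->
  (forall j, meas X [set x | P j x]) -> meas X [set x | forall j, P j x].
Proof.
move=> sX mP; have := measC sX (meas_exists sX (fun j => measC sX (mP j))).
congr (meas X _); apply/seteqP; split=> x /= H; last by move=> [j]; apply; exact: H.
by move=> j; apply: contrapT => n; apply: H; exists j.
Qed.

Lemma meas_const (X : bspace) (P : Prop) : sigma_space X -> meas X [set _ | P].
Proof.
move=> sX; have [m0 C _] := sX; have [p|np] := pselect P.
  have := measC sX m0; congr (meas X _); apply/seteqP; split=> x //= _; by case.
by have := m0; congr (meas X _); apply/seteqP; split.
Qed.

Lemma meas_and (X : bspace) (P Q : X -> Prop) : sigma_space X ->
  meas X [set x | P x] -> meas X [set x | Q x] -> meas X [set x | P x /\ Q x].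
Proof.
move=> sX mP mQ; have := @meas_forall X bool (fun b x => if b then P x else Q x) sX.
rewrite (_ : [set x | forall j : bool, if j then P x else Q x] = [set x | P x /\ Q x]).
  by apply; case.
by apply/seteqP; split=> x /= => [H|[? ?] []]; [split; [exact: (H true)|exact: (H false)]| |].
Qed.

Lemma meas_or (X : bspace) (P Q : X -> Prop) : sigma_space X ->
  meas X [set x | P x] -> meas X [set x | Q x] -> meas X [set x | P x \/ Q x].
Proof.
move=> sX mP mQ; have := @meas_exists X bool (fun b x => if b then P x else Q x) sX.
rewrite (_ : [set x | exists j : bool, if j then P x else Q x] = [set x | P x \/ Q x]).
  by apply; case.
by apply/seteqP; split=> x /= => [[[]]|[]] ?; [left|right|exists true|exists false].
Qed.

(** The set is a union of patterns of the finitely many truth values, and there are countably many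
    finite patterns. *)
Lemma meas_determined (X : bspace) (J : countType) (b : J -> X -> Prop) (js : seq J) (P : X -> Prop) :
  sigma_space X -> (forall j, meas X [set x | b j x]) ->
  (forall x y, (forall j, j \in js -> (b j x <-> b j y)) -> P x -> P y) -> meas X [set x | P x].
Proof.
move=> sX mb H.
pose pat x := [seq `[<b j x>] | j <- js].
have mpat s : meas X [set x | pat x = s].
  rewrite /pat; elim: (js) s => [|j l IH] s; first exact: (@meas_const X ([::] = s)).
  case: s => [|c s] /=.
    by rewrite (_ : [set x | _] = [set _ | False]); [exact: meas_const|apply/seteqP; split].
  have := meas_and sX (_ : meas X [set x | `[<b j x>] = c]) (IH s).
  rewrite (_ : [set x | _ /\ _] = [set x | `[<b j x>] :: [seq `[<b i x>] | i <- l] = c :: s]).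
    apply; case: c; have := mb j; last move/(measC sX); congr (meas X _);
      apply/seteqP; split=> x /=; by [move/asboolP|move/asboolPn|move=> ?; apply/asboolF|].
  by apply/seteqP; split=> x /= [-> ->].
have := @meas_exists X _ (fun s x => pat x = s /\ exists y, P y /\ pat y = s) sX _.
rewrite (_ : [set x | exists j, _] = [set x | P x]).
  by apply=> s; apply: meas_and => //; exact: meas_const.
apply/seteqP; split=> x /=; last by move=> Px; exists (pat x); split=> //; exists x.
move=> [s [xs [y [Py ys]]]]; apply: H Py => j jl.
have : pat y = pat x by rewrite xs.
by move/eq_in_map => /(_ j jl) E; split=> /asboolP; [rewrite E|rewrite -E] => /asboolP.
Qed.

Lemma borel_map_generated (X Y : bspace) (G : set (set Y)) (f : X -> Y) : sigma_space X ->
  (forall B, meas Y B -> <<s G>> B) -> (forall B, G B -> meas X (f @^-1` B)) -> borel_map f.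
Proof.
move=> [m0 C U] YG H B /YG; move: B.
suff : <<s G>> `<=` [set B | meas X (f @^-1` B)] by [].
apply: smallest_sub => //; split => /=.
- by rewrite preimage_set0.
- by move=> A /C; rewrite !setTD preimage_setC.
- by move=> A HA; rewrite preimage_bigcup; exact: U.
Qed.

Lemma borel_map_seq (X Y : bspace) (f : X -> nat -> Y) : sigma_space X ->
  (forall i, borel_map (fun x => f x i)) -> borel_map (f : X -> seq_space Y).
Proof.
move=> sX H; apply: (@borel_map_generated X (seq_space Y)
  [set C | exists i A, meas Y A /\ C = [set x : nat -> Y | A (x i)]]) => // _ [i [A [mA ->]]]; exact: H.
Qed.

Lemma borel_map_omega (X : bspace) (f : X -> dom_omega) : sigma_space X ->
  (forall n, borel_map (fun x => f x n : dom n)) -> borel_map f.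
Proof.
move=> sX H; apply: (@borel_map_generated X dom_omega
  [set C | exists n A, meas (dom n) A /\ C = [set x : dom_omega | A (x n)]]) => // _ [i [A [mA ->]]]; exact: H.
Qed.

Lemma borel_map_const (X Y : bspace) (y : Y) : sigma_space X -> borel_map (fun _ : X => y).
Proof. by move=> sX B _; exact: meas_const. Qed.

Lemma borel_map_comp (X Y Z : bspace) (f : X -> Y) (g : Y -> Z) :
  borel_map f -> borel_map g -> borel_map (g \o f).
Proof. by move=> mf mg B /mg /mf. Qed.

Lemma borel_seq_coord (Y : bspace) i : borel_map (fun x : seq_space Y => x i).
Proof. by move=> B mB; apply: sub_sigma_algebra; exists i, B. Qed.

Lemma borel_omega_coord n : borel_map (fun x : dom_omega => x n : dom n).
Proof. by move=> B mB; apply: sub_sigma_algebra; exists n, B. Qed.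

Definition config_space : bspace :=
  BSpace config <<s [set C | exists c, C = [set x : config | x c = true]] >>.

Lemma config_sigma_space : sigma_space config_space.
Proof. exact: smallest_sigma_algebra. Qed.

Lemma meas_coord c : meas config_space [set x | x c].
Proof. by apply: sub_sigma_algebra; exists c. Qed.

Lemma borel_map_config (X : bspace) (f : X -> config) : sigma_space X ->
  (forall c, meas X [set x | f x c]) -> borel_map (f : X -> config_space).
Proof.
move=> sX H; apply: (@borel_map_generated X config_space
  [set C | exists c, C = [set x : config | x c = true]]) => // _ [c ->]; exact: H.
Qed.

Lemma object_borel l j : borel_map (fun x : config_space => object x l j : dom l).
Proof.
elim: l j => [|l IH] j; first exact: (@borel_map_const config_space (dom 0) _ config_sigma_space).
apply: (@borel_map_seq config_space (dom l) (fun x i => object x l.+1 j i)) => [|i B mB].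
  exact: config_sigma_space.
set r := Ropp (INR l.+1).
change (meas config_space [set x : config | B (if x (l, j, i) then object x l i else const_dom l r)]).
rewrite (_ : [set x : config | _] = [set x : config_space | (x (l, j, i) /\ B (object x l i)) \/
    (~ x (l, j, i) /\ B (const_dom l r))]).
  apply: meas_or; try exact: config_sigma_space.
    apply: meas_and; [exact: config_sigma_space|exact: meas_coord|exact: IH].
  apply: meas_and; [exact: config_sigma_space| |exact/meas_const/config_sigma_space].
  apply: measC; [exact: config_sigma_space|exact: meas_coord].
apply/seteqP; split=> x /=; case: (x (l, j, i)) => //; [by left|by right|by case=> -[]|by case=> -[]].
Qed.

Lemma code_borel : borel_map (code : config_space -> dom_omega).
Proof.
apply: (@borel_map_omega config_space) => [|[|l]]; first exact: config_sigma_space.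
  exact: (@borel_map_const config_space (dom 0) _ config_sigma_space).
apply: (@borel_map_seq config_space (dom l) (fun x i => object x l i)) => [|i]; first exact: config_sigma_space.
exact: object_borel.
Qed.

Lemma stack_borel k z : borel_map (stack k z : config_space -> config_space).
Proof.
apply: (@borel_map_config config_space) => [|[[l j] i]]; first exact: config_sigma_space.
rewrite (_ : [set x | _] = if l < k then [set x : config | z (l, j, i)] else [set x : config | x (l - k, j, i)]).
  by case: ifP => _; [apply: meas_const; exact: config_sigma_space|exact: meas_coord].
by apply/seteqP; split=> x /=; rewrite stackE; case: ifP.
Qed.

Lemma decided_measurable (S : set config) : meas config_space S -> decided S.
Proof.
move: S; suff : meas config_space `<=` [set S | decided S] by [].
apply: smallest_sub => /=; last first.
  move=> _ [c ->] x A; exists x, [:: c]; split=> //.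
  have H : forall z, agree [:: c] x z -> z c = x c by move=> z /(_ c); rewrite inE eqxx => ->.
  by case xc : (x c); [left|right]; apply: comeager_all => z /H /= ->; rewrite xc.
split=> /=.
- by move=> x A; exists x, [::]; split=> //; right; apply: comeager_all => z _; case.
- move=> A dA x B; rewrite setTD; have [y [B' [xy H]]] := dA x B; exists y, B'; split=> //.
  by case: H => H; [right|left]; refine (comeager_sub H _) => z Hz /Hz Az // /(_ Az).
- move=> A dA; have := @decided_bigcup coord nat A dA.
  congr (decided _); apply/seteqP; split=> x /=; first by move=> [n An]; exists n.
  by move=> [n _ An]; exists n.
Qed.

Lemma open_ray_meas q : meas real_space [set r : R | Rlt q r].
Proof.
apply: sub_sigma_algebra => x /= qx; exists (Rminus x q); split; first lra.
by move=> y; split_Rabs; lra.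
Qed.

Lemma open_ray_meas_lt q : meas real_space [set r : R | Rlt r q].
Proof.
apply: sub_sigma_algebra => x /= qx; exists (Rminus q x); split; first lra.
by move=> y; split_Rabs; lra.
Qed.

Lemma eq_jump_meas (X : bspace) d (f g : X -> dom d) : sigma_space X -> borel_map f -> borel_map g ->
  meas X [set x | eq_jump d (f x) (g x)].
Proof.
move=> sX; elim: d f g => [|d IH] f g mf mg.
  rewrite (_ : [set x | _] = [set x | ~ exists q, (Rlt (f x) (rational q) /\ Rlt (rational q) (g x)) \/
      (Rlt (g x) (rational q) /\ Rlt (rational q) (f x))]).
    apply: measC => //; apply: meas_exists => // q.
    by apply: meas_or => //; apply: meas_and => //;
      [exact: (mf _ (open_ray_meas_lt _))|exact: (mg _ (open_ray_meas _))|
       exact: (mg _ (open_ray_meas_lt _))|exact: (mf _ (open_ray_meas _))].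
  apply/seteqP; split=> x /= => [-> [q]|H]; first lra.
  have [lt|[//|gt]] := Rtotal_order (f x) (g x); case: H.
    by have [q ?] := rational_dense lt; exists q; left.
  by have [q ?] := rational_dense gt; exists q; right.
have mi (h : X -> dom d.+1) i : borel_map h -> borel_map (fun x => h x i : dom d).
  move=> mh; apply: (@borel_map_comp X (dom d.+1) (dom d) h (fun u => u i)) => //; exact: borel_seq_coord.
apply: meas_and => //; apply: meas_forall => // i; apply: meas_exists => // j; apply: IH; exact: mi.
Qed.

Lemma descend_borel (X : bspace) n (f : X -> dom n) p : borel_map f ->
  exists d (g : X -> dom d), borel_map g /\ forall x, descend (f x) p = existT _ d (g x).
Proof.
elim: n f p => [|n IH] f p mf; first by exists 0, f.
case: p => [|i p]; first by exists n.+1, f.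
apply: (IH (fun x => f x i)).
apply: (@borel_map_comp X (dom n.+1) (dom n) f (fun u => u i)) => //; exact: borel_seq_coord.
Qed.

Lemma base_borel a : exists d (g : dom_omega -> dom d), borel_map g /\
  forall x, base x a.1 a.2 = (a.1, jump_class (existT _ d (g x))).
Proof.
have [d [g [mg E]]] := @descend_borel dom_omega a.1 (fun x => x a.1) a.2 (@borel_omega_coord a.1).
by exists d, g; split=> // x; rewrite /base E.
Qed.

Lemma real_bit_meas a q : meas dom_omega [set x | real_bit (base x a.1 a.2) q].
Proof.
have sX := dom_omega_sigma_space; have [d [g [mg E]]] := base_borel a.
case: d g mg E => [|d] g mg E.
  rewrite (_ : [set x | _] = g @^-1` [set r : R | Rlt (rational q) r]); first exact: (mg _ (open_ray_meas _)).
  apply/seteqP; split=> x; rewrite /preimage /= E.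
    by move=> /asboolP[r [/jump_classP /= ->]].
  by move=> qg; apply/asboolP; exists (g x).
rewrite (_ : [set x | _] = [set _ | False]); first exact: meas_const.
apply/seteqP; split=> x //=; rewrite E => /asboolP[r [H _]].
by have := congr1 (@projT1 _ _) H.
Qed.

Lemma base_eq_meas a a' : meas dom_omega [set x | base x a.1 a.2 = base x a'.1 a'.2].
Proof.
have sX := dom_omega_sigma_space.
have [d [g [mg E]]] := base_borel a; have [d' [g' [mg' E']]] := base_borel a'.
have [ad|nad] := pselect (a.1 = a'.1 /\ d = d'); last first.
  rewrite (_ : [set x | _] = [set _ | False]); first exact: meas_const.
  apply/seteqP; split=> x //=; rewrite E E' => H; apply: nad; split; first exact: (congr1 fst H).
  exact: (congr1 (fun v => projT1 v.2) H).
case: ad => aa dd; subst d'.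
have := eq_jump_meas sX mg mg'; congr (meas dom_omega _); apply/seteqP; split=> x /=; rewrite E E' aa.
  by move=> H; congr (_, _); apply/jump_classP.
by move=> H; apply/jump_classP; exact: (congr1 snd H).
Qed.

Lemma child_meas a a' : meas dom_omega [set x | child (base x a.1 a.2) (base x a'.1 a'.2)].
Proof.
have sX := dom_omega_sigma_space.
have [d [g [mg E]]] := base_borel a; have [d' [g' [mg' E']]] := base_borel a'.
have [ad|nad] := pselect (a.1 = a'.1 /\ d' = d.+1); last first.
  rewrite (_ : [set x | _] = [set _ | False]); first exact: meas_const.
  apply/seteqP; split=> x //=; rewrite E E' => H; apply: nad; split; first by case: H.
  exact: (child_dim H).
case: ad => aa dd; subst d'.
rewrite (_ : [set x | _] = [set x | exists i, eq_jump d (g x) (g' x i)]).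
  apply: meas_exists => // i; apply: eq_jump_meas => //.
  apply: (@borel_map_comp dom_omega (dom d.+1) (dom d) g' (fun u => u i)) => //; exact: borel_seq_coord.
apply/seteqP; split=> x /=; rewrite E E' aa child_class; by [case|].
Qed.

(** Each bit depends on finitely many Borel facts: initial bits of the row code at level 1, by
    [local_row], and base tests between finitely many addresses above. *)
Lemma coding_borel phi : local_row phi -> borel_map (coding phi : dom_omega -> config_space).
Proof.
move=> loc; have sX := dom_omega_sigma_space.
apply: borel_map_config => // -[[l j] i].
rewrite /coding /pull /=; case: l => [|l].
  pose s := [seq a <- (node_index j).2 | a.1 - size a.2 < 1].
  pose bit c x := (row_code (node_of x 1 j)).2 c : Prop.
  apply: (@meas_determined _ _ bit (iota 0 i.+1)) => //.
    move=> c; rewrite /bit /row_code /node_of /=.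
    case: (odflt _ _) => a q /=.
    have [sa|sa] := ltnP a (size s).
      have := real_bit_meas (nth (0, [::]) s a) q; congr (meas _ _); apply/seteqP; split=> x /=;
        by rewrite (nth_map (0, [::])).
    rewrite (_ : [set x | _] = [set _ : dom_omega | is_true (real_bit (0, jump_class (existT _ 0 R0)) q)]).
      refine (@meas_const dom_omega (is_true (real_bit (0, jump_class (existT _ 0 R0)) q)) sX).
    by apply/seteqP; split=> x /=; rewrite nth_default ?size_map.
  move=> x y H; rewrite /row.
  have -> : (row_code (node_of y 1 j)).1 = (row_code (node_of x 1 j)).1.
    by rewrite /row_code /node_of /= -!map_comp.
  rewrite (loc _ _ (row_code (node_of y 1 j)).2) // => c ci.
  have := H c; rewrite mem_iota /= add0n ltnS ci => /(_ isT) [h1 h2].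
  by apply/idP/idP.
pose s := [seq a <- (node_index i).2 | a.1 - size a.2 < l.+1].
pose t := [seq a <- (node_index j).2 | a.1 - size a.2 < l.+2].
pose bit (p : (nat * seq nat) * (nat * seq nat) * bool) (x : dom_omega) :=
  if p.2 then base x p.1.1.1 p.1.1.2 = base x p.1.2.1 p.1.2.2
  else child (base x p.1.1.1 p.1.1.2) (base x p.1.2.1 p.1.2.2).
apply: (@meas_determined _ _ bit [seq (p, b) | p <- [seq (a, c) | a <- s, c <- t], b <- [:: true; false]]) => //.
  by move=> [[a c] []]; [exact: (base_eq_meas a c)|exact: (child_meas a c)].
move=> x y H; rewrite /member /node_of /=.
suff -> : profile base_test [seq base y a.1 a.2 | a <- s] [seq base y a.1 a.2 | a <- t] =
  profile base_test [seq base x a.1 a.2 | a <- s] [seq base x a.1 a.2 | a <- t] by [].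
rewrite /profile -!map_comp; congr (_ :: _); apply/eq_in_map => a al /=.
rewrite -!map_comp; apply/eq_in_map => c ct /=.
have Hb b : bit ((a, c), b) x <-> bit ((a, c), b) y.
  apply: H; apply/allpairsP; exists ((a, c), b); split=> //; last by case: (b); rewrite !inE.
  by apply/allpairsP; exists (a, c).
rewrite /base_test (asbool_equiv_eq (Hb true)) (asbool_equiv_eq (Hb false)).
by [].
Qed.

(** * Equivalence relations classified by trees *)

(** Wide enough for both isomorphism of structures and [eq_omega], so that one dichotomy gives both
    halves of the theorem. *)
Definition tree_classified (Y : bspace) (E : Y -> Y -> Prop) := exists T : Y -> tree,
  (forall s m, meas Y [set y | T y s m]) /\ forall y y', E y y' <-> bisimilar (T y) (T y').

Lemma reducible_tree_classified (X Y : bspace) (E : X -> X -> Prop) (F : Y -> Y -> Prop) :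
  borel_reducible E F -> tree_classified F -> tree_classified E.
Proof.
move=> [h [mh Eh]] [T [mT FT]]; exists (T \o h); split=> [s m|x x']; first exact: (mh _ (mT s m)).
by rewrite Eh FT.
Qed.

Lemma coding_equiv phi x y : eq_omega x y -> equiv_config (coding phi x) (coding phi y).
Proof.
move=> xy; have nodes x' y' l i : eq_omega x' y' -> exists j, node_of x' l i = node_of y' l j.
  move=> xy'; have [|j <-] := @level_node_of y' l (node_of x' l i); last by exists j.
  by move=> v /node_of_level[xv dv]; split=> //; exact: eq_omega_bases xv.
apply: pull_equiv => l i _ /=; first exact: nodes.
have [|j ->] := @nodes y x l i; last by exists j.
by move=> n; apply: eq_jump_sym.
Qed.

Theorem tree_classified_dichotomy (Y : bspace) (E : Y -> Y -> Prop) : tree_classified E ->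
  borel_reducible eq_omega E \/ prime_to eq_omega E.
Proof.
move=> [T [mT ET]]; have [?|nred] := pselect (borel_reducible eq_omega E); [by left|right].
move=> f [mf hf]; pose F x := T (f (code x)).
have dF s m : decided (fun x => F x s m).
  apply: decided_measurable; exact: (code_borel (mf _ (mT s m))).
have resp : respects F by move=> x y /code_equiv /hf /ET.
have [[k [C [x0 [A0 [cC H]]]]]|H] := pselect (exists k C x0 A0, comeager C /\
    forall x y, C x -> C y -> agree A0 x0 x -> agree A0 x0 y -> low k x y -> bisimilar (F x) (F y)).
  have [phi [z [loc Fz inj]]] := coding_fiber resp cC H.
  exists (f (code z)), (fun x => code (stack k z (coding phi x))); split; last split.
  - apply: (@borel_map_comp dom_omega config_space dom_omega (fun x => stack k z (coding phi x)) code).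
      apply: (@borel_map_comp dom_omega config_space config_space (coding phi) (stack k z)).
        exact: coding_borel.
      exact: stack_borel.
    exact: code_borel.
  - by move=> x; apply/ET; exact: Fz.
  - move=> x y; split=> [xy|]; last exact: inj.
    by apply: code_equiv; apply: stack_equiv; exact: coding_equiv.
have [|phi [loc red]] := @coding_reduction F resp.
  by move=> k; have [|nH] := name_dichotomy k dF; last by case: H; exists k.
case: nred; exists (fun x => f (code (coding phi x))); split.
  apply: (@borel_map_comp dom_omega dom_omega Y (fun x => code (coding phi x)) f) => //.
  apply: (@borel_map_comp dom_omega config_space dom_omega (coding phi) code); last exact: code_borel.
  exact: coding_borel.
move=> x y; split=> [xy|/ET]; last exact: red.
by apply/hf/code_equiv/coding_equiv.
Qed.

Definition label (I : countType) (ar : I -> nat) : countType :=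
  ((nat * nat) + {i : I & (ar i).-tuple nat})%type.

(* The states of the tree of a structure are finite tuples, labelled by their atomic diagrams. *)
Definition structure_tree (I : countType) (ar : I -> nat) (M : mod_space I ar) : tree := fun s m =>
  match unpickle m : option (label ar) with
  | Some (inl ab) => [&& ab.1 < size s, ab.2 < size s & nth 0 s ab.1 == nth 0 s ab.2]
  | Some (inr (existT i t)) => all (fun a => a < size s) t && M i (map_tuple (nth 0 s) t)
  | None => false
  end.

Lemma structure_tree_eq (I : countType) (ar : I -> nat) (M N : mod_space I ar) s t :
  structure_tree M s = structure_tree N t ->
  [/\ size s = size t,
    forall a b, a < size s -> b < size s -> (nth 0 s a == nth 0 s b) = (nth 0 t a == nth 0 t b) &
    forall i (u : (ar i).-tuple nat), all (fun a => a < size s) u ->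
      M i (map_tuple (nth 0 s) u) = N i (map_tuple (nth 0 t) u)].
Proof.
move=> E; have L (l : label ar) := congr1 (fun f => f (pickle l)) E.
have sz a : (a < size s) = (a < size t).
  by have := L (inl (a, a)); rewrite /structure_tree pickleK /= !eqxx !andbT !andbb.
have st : size s = size t.
  by apply/eqP; rewrite eqn_leq leqNgt sz ltnn /= leqNgt -sz ltnn.
split=> // [a b sa sb|i u su].
  by have := L (inl (a, b)); rewrite /structure_tree pickleK /= -!sz sa sb.
have := L (inr (existT _ i u)); rewrite /structure_tree pickleK /= su.
by rewrite (eq_all (a2 := fun a => a < size s)) ?su // => a; rewrite sz.
Qed.

Lemma iso_bisimilar (I : countType) (ar : I -> nat) (M N : mod_space I ar) :
  iso_rel ar M N -> bisimilar (structure_tree M) (structure_tree N).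
Proof.
move=> [pi [[pi' piK pi'K] H]]; exists (fun s t => t = map pi s); split=> // s _ ->; split.
- apply/funext => m; rewrite /structure_tree; case: unpickle => [[[a b]|[i t]]|] //=.
    rewrite size_map; case: ltnP => //= sa; case: ltnP => //= sb.
    by rewrite !(nth_map 0) // (inj_eq (can_inj piK)).
  rewrite size_map; case: allP => //= st; rewrite H; congr (N i _).
  apply: val_inj => /=; rewrite -map_comp; apply/eq_in_map => a at' /=.
  by rewrite (nth_map 0) //; exact: st.
- by move=> i; exists (pi i); rewrite map_rcons.
- by move=> j; exists (pi' j); rewrite map_rcons pi'K.
Qed.

(** Back and forth along one branch: the even positions enumerate [M], the odd ones enumerate [N],
    and equal labels make the matching an isomorphism. *)
Lemma bisimilar_iso (I : countType) (ar : I -> nat) (M N : mod_space I ar) :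
  bisimilar (structure_tree M) (structure_tree N) -> iso_rel ar M N.
Proof.
move=> [R [bR R0]].
pose P n (p q : seq nat * seq nat) := exists i j, q = (rcons (rcons p.1 n) i, rcons (rcons p.2 j) n).
have [|n [s t] /= Rst|st [st0 Hst]] := @dependent_sequence _ (fun p => R p.1 p.2) P ([::], [::]).
- by [].
- have [_ /(_ n)[j Rj] _] := bR _ _ Rst; have [_ _ /(_ n)[i Ri]] := bR _ _ Rj.
  by exists (rcons (rcons s n) i, rcons (rcons t j) n); split=> //; exists i, j.
have szs n : size (st n).1 = n.*2.
  elim: n => [|n IH]; first by rewrite st0.
  by have [_ [i [j ->]]] := Hst n; rewrite /= !size_rcons IH doubleS.
have szt n : size (st n).2 = n.*2.
  elim: n => [|n IH]; first by rewrite st0.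
  by have [_ [i [j ->]]] := Hst n; rewrite /= !size_rcons IH doubleS.
have stab n m a : a < n.*2 -> n <= m ->
    nth 0 (st m).1 a = nth 0 (st n).1 a /\ nth 0 (st m).2 a = nth 0 (st n).2 a.
  move=> an /subnK <-; elim: (m - n) => [//|d IH]; rewrite addSn.
  have [_ [i [j ->]]] := Hst (d + n); rewrite /= !nth_rcons !size_rcons szs szt.
  have -> : a < (d + n).*2 by lia.
  by rewrite ltnS ltnW //; lia.
pose pi n := nth 0 (st n.+1).2 n.*2.
pose pi' n := nth 0 (st n.+1).1 n.*2.+1.
have s_even n : nth 0 (st n.+1).1 n.*2 = n.
  have [_ [i [j ->]]] := Hst n; rewrite /= !nth_rcons !size_rcons szs ltnn eqxx ltnS leqnn.
  by [].
have t_odd n : nth 0 (st n.+1).2 n.*2.+1 = n.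
  by have [_ [i [j ->]]] := Hst n; rewrite /= !nth_rcons !size_rcons szt ltnn eqxx.
have lab n := structure_tree_eq (let: And3 e _ _ := bR _ _ (proj1 (Hst n)) in e).
have dbl n : n.*2 < n.+1.*2 /\ n.*2.+1 < n.+1.*2 by lia.
have s_evenN n m : n < m -> nth 0 (st m).1 n.*2 = n.
  by move=> nm; have [-> _] := stab _ _ _ (dbl n).1 nm; exact: s_even.
have t_evenN n m : n < m -> nth 0 (st m).2 n.*2 = pi n.
  by move=> nm; have [_ ->] := stab _ _ _ (dbl n).1 nm.
have s_oddN n m : n < m -> nth 0 (st m).1 n.*2.+1 = pi' n.
  by move=> nm; have [-> _] := stab _ _ _ (dbl n).2 nm.
have t_oddN n m : n < m -> nth 0 (st m).2 n.*2.+1 = n.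
  by move=> nm; have [_ ->] := stab _ _ _ (dbl n).2 nm; exact: t_odd.
exists pi; split.
  have [nm pm] : (forall n, n < (n + pi n).+1) /\ (forall n, pi n < (n + pi n).+1) by split=> n; lia.
  exists pi' => n.
    have [_ eqs _] := lab (n + pi n).+1.
    have := eqs n.*2 (pi n).*2.+1; rewrite szs s_evenN // t_evenN // s_oddN // t_oddN // eqxx => H.
    by apply/eqP; rewrite eq_sym H //; lia.
  have [_ eqs _] := lab (n + pi' n).+1.
  have [n1 n2] : n < (n + pi' n).+1 /\ pi' n < (n + pi' n).+1 by lia.
  have := eqs (pi' n).*2 n.*2.+1; rewrite szs s_evenN // t_evenN // s_oddN // t_oddN // eqxx => H.
  by apply/eqP; rewrite -H //; lia.
move=> i u; pose m := (\max_(a <- u) a).+1.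
have um a : a \in u -> a < m by move=> au; rewrite ltnS; exact: (leq_bigmax_seq (F := id)).
have [_ _ /(_ i (map_tuple double u))] := lab m.
have -> : map_tuple (nth 0 (st m).1) (map_tuple double u) = u.
  apply: val_inj => /=; rewrite -map_comp -[RHS]map_id; apply/eq_in_map => a /um /=; exact: s_evenN.
have -> : map_tuple (nth 0 (st m).2) (map_tuple double u) = map_tuple pi u.
  apply: val_inj => /=; rewrite -map_comp; apply/eq_in_map => a /um /=; exact: t_evenN.
apply; apply/allP => _ /mapP[a /um am ->]; rewrite szs; lia.
Qed.

Lemma classifiable_tree_classified (Y : bspace) (E : Y -> Y -> Prop) :
  classifiable_by_countable_structures E -> tree_classified E.
Proof.
move=> [I [ar red]]; apply: reducible_tree_classified red _.
have sX : sigma_space (mod_space I ar) by exact: smallest_sigma_algebra.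
exists (@structure_tree I ar); split; last by move=> M N; split; [exact: iso_bisimilar|exact: bisimilar_iso].
move=> s m; rewrite /structure_tree; case: unpickle => [[[a b]|[i t]]|] /=;
  [refine (@meas_const (mod_space I ar) (is_true _) sX)| |refine (@meas_const (mod_space I ar) (is_true false) sX)].
have [st|st] := boolP (all (fun a => a < size s) t); last refine (@meas_const (mod_space I ar) (is_true false) sX).
rewrite /=; by apply: sub_sigma_algebra; exists i, (map_tuple (nth 0 s) t).
Qed.

(** Labels contain the coordinate and the depth, so a bisimulation cannot mix coordinates or
    dimensions. *)
Definition omega_tree (x : dom_omega) : tree := fun s m =>
  if s is n :: p then
    match unpickle m : option (nat + nat) with
    | Some (inl a) => a == pickle (n, size p)
    | Some (inr q) => real_bit (base x n p) q
    | None => false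
    end
  else false.

Lemma omega_tree_eq x y n p t : omega_tree x (n :: p) = omega_tree y t ->
  exists p', [/\ t = n :: p', size p = size p' & forall q, real_bit (base x n p) q = real_bit (base y n p') q].
Proof.
move=> E; have L (l : nat + nat) := congr1 (fun f => f (pickle l)) E.
have := L (inl (pickle (n, size p))); rewrite /= pickleK eqxx.
case: t L {E} => [//|n' p'] L /=; rewrite pickleK => /esym /eqP /(pcan_inj (@pickleK _)) [e1 e2]; subst n'.
by exists p'; split=> // q; have := L (inr q); rewrite /= !pickleK.
Qed.

Lemma descend_rcons0 n (u : dom n) p (w : dom 0) i :
  descend u p = existT _ 0 w -> descend u (rcons p i) = existT _ 0 w.
Proof. by elim: n u p => [|n IH] u [|j p] //=; exact: IH. Qed.

Lemma bisimilar_eq_omega x y : bisimilar (omega_tree x) (omega_tree y) -> eq_omega x y.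
Proof.
move=> [R [bR R0]] n.
have key d p p' (u u' : dom d) : R (n :: p) (n :: p') -> descend (x n : dom n) p = existT _ d u ->
    descend (y n : dom n) p' = existT _ d u' -> eq_jump d u u'.
  elim: d p p' u u' => [|d IH] p p' u u' Rp xu yu; have [lab st st'] := bR _ _ Rp.
    have [_ [[<-] _ bits]] := omega_tree_eq lab; rewrite /base xu yu in bits.
    have := @real_bit_inj (n, jump_class (existT _ 0 u)) (n, jump_class (existT _ 0 u')) u u'
      erefl erefl erefl bits.
    by move=> /(congr1 snd) /jump_classP.
  split=> i; [have [j Rj] := st i|have [j Rj] := st' i]; exists j;
    by apply: IH Rj _ _; exact: descend_rcons.
have [_ /(_ n)[n' Rn] _] := bR _ _ R0; have [lab _ _] := bR _ _ Rn.
have [p' [[nn pp] _ _]] := omega_tree_eq lab; subst n'.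
by apply: (key _ _ _ _ _ Rn); exact: descend_nil.
Qed.

Lemma eq_omega_bisimilar x y : eq_omega x y -> bisimilar (omega_tree x) (omega_tree y).
Proof.
move=> xy.
pose R x y s t := (s = [::] /\ t = [::]) \/ exists n p p', [/\ s = n :: p, t = n :: p', size p = size p' &
  base x n p = base y n p'].
have Rsym x' y' s t : R x' y' s t -> R y' x' t s.
  by case=> [[-> ->]|[n [p [p' [-> -> sp e]]]]]; [left|right; exists n, p', p].
have step x' y' s t i : eq_omega x' y' -> R x' y' s t -> exists j, R x' y' (rcons s i) (rcons t j).
  move=> xy' [[-> ->]|[n [p [p' [-> -> sp e]]]]].
    exists i; right; exists i, [::], [::]; split=> //; congr (_, _).
    by rewrite !descend_nil; apply/jump_classP.
  case E: (descend (x' n : dom n) p) => [d u]; case E': (descend (y' n : dom n) p') => [d' u'].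
  move/(congr1 snd): e; rewrite /= E E' => e; have dd : d = d' := congr1 (@projT1 _ _) e; subst d'.
  move/jump_classP: e; case: d u u' E E' => [|d] u u' E E' /= uu.
    exists i; right; exists n, (rcons p i), (rcons p' i); split=> //; first by rewrite !size_rcons sp.
    by rewrite /base (descend_rcons0 _ E) (descend_rcons0 _ E') uu.
  have [j uj] := uu.1 i; exists j; right; exists n, (rcons p i), (rcons p' j).
  split=> //; first by rewrite !size_rcons sp.
  by rewrite /base (descend_rcons _ E) (descend_rcons _ E'); congr (_, _); apply/jump_classP.
exists (R x y); split; last by left.
move=> s t Rst; split=> [|i|j].
- case: Rst => [[-> ->]|[n [p [p' [-> -> sp e]]]]] //.
  by apply/funext => m; rewrite /omega_tree sp e.
- exact: step.
- have [|i /Rsym] := step y x t s j _ (Rsym _ _ _ _ Rst); last by exists i.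
  by move=> n; exact: eq_jump_sym.
Qed.

Lemma omega_tree_classified : @tree_classified dom_omega eq_omega.
Proof.
have sX := dom_omega_sigma_space.
exists omega_tree; split; last by move=> x y; split; [exact: eq_omega_bisimilar|exact: bisimilar_eq_omega].
case=> [|n p] m /=; first by refine (@meas_const dom_omega (is_true false) sX).
case: unpickle => [[a|q]|]; last by refine (@meas_const dom_omega (is_true false) sX).
  by refine (@meas_const dom_omega (is_true (a == _)) sX).
exact: (real_bit_meas (n, p) q).
Qed.

(** * Standard Borel products *)

Definition inv_succ (n : nat) : R := Rinv (INR n.+1).

Lemma inv_succ_gt0 n : Rlt 0 (inv_succ n).
Proof. apply: Rinv_0_lt_compat; rewrite S_INR; have := pos_INR n; lra. Qed.

Lemma inv_succ_le1 n : Rle (inv_succ n) 1.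
Proof.
rewrite -Rinv_1; apply: Rinv_le_contravar; first lra.
by rewrite S_INR; have := pos_INR n; lra.
Qed.

Lemma inv_succ_le m n : m <= n -> Rle (inv_succ n) (inv_succ m).
Proof.
move=> mn; apply: Rinv_le_contravar; first by rewrite S_INR; have := pos_INR m; lra.
by apply: le_INR; lia.
Qed.

Lemma inv_succ_small e : Rlt 0 e -> exists n, Rlt (inv_succ n) e.
Proof.
move=> e0; have [n Hn] := INR_unbounded (Rinv e); exists n.
rewrite -(Rinv_inv e); apply: Rinv_lt_contravar; last by rewrite S_INR; lra.
have e1 := Rinv_0_lt_compat e e0; apply: Rmult_lt_0_compat => //.
by rewrite S_INR; have := pos_INR n; lra.
Qed.

Definition product_space (X : nat -> bspace) : bspace :=
  BSpace (forall n, X n) <<s [set C | exists n A, meas (X n) A /\ C = [set x | A (x n)]] >>.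

(** [D] is the supremum of the distances truncated at [inv_succ n]; as these bounds tend to 0,
    closeness depends on finitely many coordinates. *)
Lemma product_metric (X : nat -> Type) (d : forall n, X n -> X n -> R) :
  (forall n, is_metric (d n)) -> exists D : (forall n, X n) -> (forall n, X n) -> R,
  [/\ is_metric D, forall n x y e, Rle e (inv_succ n) -> Rlt (D x y) e -> Rlt (d n (x n) (y n)) e &
    forall N x y e, Rlt (inv_succ N) e ->
      (forall n, n < N -> Rlt (d n (x n) (y n)) e) -> Rle (D x y) e].
Proof.
move=> md; pose t n x y := Rmin (d n (x n) (y n)) (inv_succ n).
have t0 n x y : Rle 0 (t n x y).
  by have [p _] := md n; apply: Rmin_glb => //; apply: Rlt_le; exact: inv_succ_gt0.
have /choice[D0 HD0] (p : (forall n, X n) * (forall n, X n)) : exists s,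
    (forall n, Rle (t n p.1 p.2) s) /\ forall c, (forall n, Rle (t n p.1 p.2) c) -> Rle s c.
  have [||s [ub lub]] := completeness (fun r => exists n, r = t n p.1 p.2).
  - by exists R1 => _ [n ->]; apply: Rle_trans (Rmin_r _ _) _; exact: inv_succ_le1.
  - by exists (t 0 p.1 p.2), 0.
  - exists s; split=> [n|c Hc]; first by apply: ub; exists n.
    by apply: lub => _ [n ->].
pose D x y := D0 (x, y).
have Du n x y : Rle (t n x y) (D x y) by exact: (HD0 (x, y)).1.
have Dl x y c : (forall n, Rle (t n x y) c) -> Rle (D x y) c by exact: (HD0 (x, y)).2.
have tlt n x y e : Rle e (inv_succ n) -> Rlt (t n x y) e -> Rlt (d n (x n) (y n)) e.
  by move=> en; rewrite /t /Rmin; case: Rle_dec => _; lra.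
exists D; split.
- split; last split; last split.
  + by move=> x y; apply: Rle_trans (t0 0 x y) (Du 0 x y).
  + move=> x y; split=> [Dxy|->]; last first.
      apply: Rle_antisym; last exact: Rle_trans (t0 0 y y) (Du 0 y y).
      apply: Dl => n; have [_ [z _]] := md n; rewrite /t (z (y n) (y n)).2 //.
      exact: Rmin_l.
    apply: functional_extensionality_dep => n; have [p [z _]] := md n; apply/z.
    have := Du n x y; rewrite Dxy /t /Rmin; have := inv_succ_gt0 n; have := p (x n) (y n).
    by case: Rle_dec => _; lra.
  + by move=> x y; apply: Rle_antisym; apply: Dl => n; have := Du n x y; have := Du n y x;
      have [_ [_ [s _]]] := md n; rewrite /t (s (x n)); lra.
  + move=> x y z; apply: Dl => n; have := Du n x y; have := Du n y z.
    have [p [_ [_ tr]]] := md n; have := tr (x n) (y n) (z n); have := inv_succ_gt0 n.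
    have := p (x n) (y n); have := p (y n) (z n).
    by rewrite /t /Rmin; case: Rle_dec => ?; case: Rle_dec => ?; case: Rle_dec => ?; lra.
- by move=> n x y e en De; apply: tlt => //; apply: Rle_lt_trans (Du n x y) De.
- move=> N x y e Ne H; apply: Dl => n; case: (ltnP n N) => nN.
    by apply: Rle_trans (Rmin_l _ _) _; apply: Rlt_le; exact: H.
  apply: Rle_trans (Rmin_r _ _) _; have := inv_succ_le nN; lra.
Qed.

Lemma eventually_all (P : nat -> nat -> Prop) N : (forall n, exists M, forall m, M <= m -> P n m) ->
  exists M, forall m, M <= m -> forall n, n < N -> P n m.
Proof.
move=> H; elim: N => [|N [M HM]]; first by exists 0.
have [M' HM'] := H N; exists (maxn M M') => m; rewrite geq_max => /andP[Mm M'm] n.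
by rewrite ltnS leq_eqVlt => /orP[/eqP ->|nN]; [exact: HM'|exact: HM].
Qed.

Lemma meas_finite_forall (X : bspace) N (P : nat -> X -> Prop) : sigma_space X ->
  (forall n, meas X [set x | P n x]) -> meas X [set x | forall n, n < N -> P n x].
Proof.
move=> sX mP; have := @meas_forall X nat (fun n x => n < N -> P n x) sX; apply=> n.
case: (n < N); last by have := meas_const True sX; congr (meas _ _); apply/seteqP; split.
by have := mP n; congr (meas _ _); apply/seteqP; split=> x /= H //; exact: H.
Qed.

Theorem product_standard_borel (X : nat -> bspace) :
  (forall n, standard_borel (X n)) -> standard_borel (product_space X).
Proof.
move=> HX; have sP : sigma_space (product_space X) by exact: smallest_sigma_algebra.
pose d n := projT1 (cid (HX n)).
have Hd n : [/\ is_metric (d n), metric_complete (d n), metric_separable (d n) &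
    forall A, meas (X n) A <-> <<s metric_open (d n) >> A] by exact: (projT2 (cid (HX n))).
have md n : is_metric (d n) by case: (Hd n).
pose q n := projT1 (cid (let: And4 _ _ s _ := Hd n in s)).
have Hq n x e : Rlt R0 e -> exists i, Rlt (d n x (q n i)) e.
  exact: (projT2 (cid (let: And4 _ _ s _ := Hd n in s)) x e).
have [D [mD Dd dD]] := product_metric md; exists D.
have center x N e : Rlt 0 e -> exists s : seq nat, size s = N /\
    forall n, n < N -> Rlt (d n (x n) (q n (nth 0 s n))) e.
  move=> e0; have /choice[i Hi] n := Hq n (x n) e e0.
  by exists (mkseq i N); split=> [|n nN]; rewrite ?size_mkseq // nth_mkseq.
split=> //.
- move=> s cau.
  have coord n : exists x, forall e, Rlt R0 e -> exists N, forall m, N <= m -> Rlt (d n (s m n) x) e.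
    have [_ cp _ _] := Hd n; apply: (cp (fun m => s m n)) => e e0.
    have [|N HN] := cau (Rmin e (inv_succ n)).
      by apply: Rmin_glb_lt => //; exact: inv_succ_gt0.
    exists N => m m' Nm Nm'; apply: Rlt_le_trans (Rmin_l _ (inv_succ n)).
    by apply: Dd; [exact: Rmin_r|exact: HN].
  exists (fun n => projT1 (cid (coord n))) => e e0.
  have [N HN] := @inv_succ_small (Rdiv e 2) ltac:(lra).
  have [|M HM] := @eventually_all (fun n m => Rlt (d n (s m n) (projT1 (cid (coord n)))) (Rdiv e 2)) N.
    by move=> n; apply: (projT2 (cid (coord n))); lra.
  exists M => m Mm; apply: (@Rle_lt_trans _ (Rdiv e 2)); last lra.
  by apply: (dD N) => // n; exact: HM.
- exists (fun k n => q n (nth 0 (odflt [::] (unpickle k)) n)) => x e e0.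
  have [N HN] := @inv_succ_small (Rdiv e 2) ltac:(lra).
  have [s [_ Hs]] := center x N (Rdiv e 2) ltac:(lra).
  exists (pickle s); apply: (@Rle_lt_trans _ (Rdiv e 2)); last lra.
  by apply: (dD N) => // n nN; rewrite pickleK; exact: Hs.
- have openP n A : meas (X n) A <-> <<s metric_open (d n) >> A by case: (Hd n).
  have ball_open n c e : meas (X n) [set y | Rlt (d n c y) e].
    apply/openP; apply: sub_sigma_algebra => y /= cy; exists (Rminus e (d n c y)); split; first lra.
    by move=> z yz; have [_ [_ [_ tr]]] := md n; have := tr c y z; lra.
  move=> A; split.
    move: A; suff : meas (product_space X) `<=` <<s metric_open D >> by [].
    apply: smallest_sub; first exact: smallest_sigma_algebra.
    move=> _ [n [A [/openP mA ->]]]; move: A mA.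
    suff : <<s metric_open (d n) >> `<=` [set A | <<s metric_open D >> [set x : product_space X | A (x n)]] by [].
    have [s0 sC sU] := @generated_sigma_space (product_space X) (metric_open D).
    apply: smallest_sub; first split=> /=.
    - exact: s0.
    - move=> A mA; have := sC _ mA.
      by congr (smallest _ _ _); apply/seteqP; split=> x [_ nA].
    - move=> A mA; have := sU (fun k => [set x : product_space X | A k (x n)]) mA.
      by congr (smallest _ _ _); apply/seteqP; split.
    move=> A oA; apply: sub_sigma_algebra => x /= /oA[e [e0 He]].
    exists (Rmin e (inv_succ n)); split; first by apply: Rmin_glb_lt => //; exact: inv_succ_gt0.
    move=> y xy; apply: He; apply: Rlt_le_trans (Rmin_l _ (inv_succ n)).
    by apply: Dd => //; exact: Rmin_r.
  move: A; suff : <<s metric_open D >> `<=` meas (product_space X) by [].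
  apply: smallest_sub => // U oU.
  (* Boxes around points of the dense sequences form a countable base. *)
  pose V (p : seq nat * nat) := [set y : product_space X |
    forall n, n < size p.1 -> Rlt (d n (q n (nth 0 p.1 n)) (y n)) (inv_succ p.2)].
  rewrite (_ : U = [set x | exists p, V p x /\ V p `<=` U]).
    apply: meas_exists => // p; apply: meas_and => //; last exact: meas_const.
    apply: meas_finite_forall => // n; apply: sub_sigma_algebra.
    by exists n, [set y | Rlt (d n (q n (nth 0 p.1 n)) y) (inv_succ p.2)].
  apply/seteqP; split=> x /=; last by move=> [p [Vx VU]]; exact: VU.
  move=> /oU[e [e0 He]]; have [N HN] := @inv_succ_small (Rdiv e 2) ltac:(lra).
  (* Both [x] and [y] are within [e / 4] of the centre, hence within [e / 2] of each other in the
     first [N] coordinates. *)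
  have [m Hm] := @inv_succ_small (Rdiv e 4) ltac:(lra).
  have [s [sN Hs]] := center x N (inv_succ m) (inv_succ_gt0 m).
  have sym n : forall y z, d n y z = d n z y by have [_ [_ []]] := md n.
  exists (s, m); split=> [n /=|y Vy]; first by rewrite sN sym; exact: Hs.
  apply: He; apply: (@Rle_lt_trans _ (Rdiv e 2)); last lra.
  apply: (dD N) => // n nN; have := Vy n; rewrite /= sN => /(_ nN).
  have := Hs n nN; have [_ [_ [_ tr]]] := md n; have := tr (x n) (q n (nth 0 s n)) (y n); lra.
Qed.

Lemma real_standard_borel : standard_borel real_space.
Proof.
exists (fun x y => Rabs (Rminus x y)); split=> //.
- split; first by move=> x y; exact: Rabs_pos.
  split; first by move=> x y; split=> [|->]; split_Rabs; lra.
  by split=> [x y|x y z]; split_Rabs; lra.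
- move=> s cau; have [|l Hl] := R_complete s.
    move=> e /cau[N HN]; exists N => n m Nn Nm; apply: HN; exact/leP.
  exists l => e /Hl[N HN]; exists N => n Nn; apply: HN; exact/leP.
- exists rational => x e e0; have [|q [q1 q2]] := @rational_dense x (Rplus x e); first lra.
  by exists q; split_Rabs; lra.
Qed.

Lemma dom_standard_borel n : standard_borel (dom n).
Proof.
elim: n => [|n IH]; first exact: real_standard_borel.
exact: (@product_standard_borel (fun _ => dom n)).
Qed.

Lemma eq_omega_equivalence : equivalence eq_omega.
Proof.
split; last split.
- by move=> x n; exact: eq_jump_refl.
- by move=> x y xy n; exact: eq_jump_sym.
- by move=> x y z xy yz n; exact: eq_jump_trans (xy n) (yz n).
Qed.

Lemma eq_omega_borel : @borel_rel dom_omega eq_omega.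
Proof.
pose P := BSpace (dom_omega * dom_omega) (prod_meas dom_omega dom_omega).
have sP : sigma_space P by exact: smallest_sigma_algebra.
have sO := dom_omega_sigma_space.
have mT : meas dom_omega setT by have := meas_const True sO; congr (meas _ _); apply/seteqP; split.
apply: (@meas_forall P nat (fun n p => eq_jump n (p.1 n) (p.2 n)) sP) => n.
apply: (@eq_jump_meas P n (fun p => p.1 n) (fun p => p.2 n) sP) => B /borel_omega_coord mB;
  apply: sub_sigma_algebra.
  by exists [set x : dom_omega | B (x n)], setT; split=> //; split=> //; apply/seteqP; split=> p //= [].
by exists setT, [set x : dom_omega | B (x n)]; split=> //; split=> //; apply/seteqP; split=> p //= [].
Qed.

Theorem theorem1p12 :
  (forall (Y : bspace) (E : Y -> Y -> Prop),
      standard_borel Y -> equivalence E ->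
      classifiable_by_countable_structures E ->
      borel_reducible eq_omega E \/ prime_to eq_omega E)
  /\ regular eq_omega.
Proof.
split=> [Y E _ _ /classifiable_tree_classified|]; first exact: tree_classified_dichotomy.
split.
- exact: (product_standard_borel dom_standard_borel).
- exact: eq_omega_equivalence.
- exact: eq_omega_borel.
- move=> Y F _ _ _ /reducible_tree_classified /(_ omega_tree_classified) cF nred.
  by have [/nred|] := tree_classified_dichotomy cF.
Qed.
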